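(* Let $T>0$, let $w\in C^\eta([0,T];\mathbb{R})$, $\eta\in[0,1]$, and suppose there is $\iota\in[\frac12,1]$ such that for every $\alpha\in(-1,0)$ there is a constant $C_\alpha\ge0$ with $$\int_0^T dr\int_0^{T-r}dt\ e^{-\lambda t}\,|w_{r+t}-w_r|^\alpha\ \le\ C_\alpha\,\lambda^{-1-\iota\alpha}\qquad\text{for all }\lambda\ge1 .$$ Let $u$ be a quasi-solution, with associated measure $m$, to $$\partial_t u+\tfrac12\partial_x u^2\circ dw_t=0$$ in one space dimension, let $\phi\in C_c^\infty(\mathbb{R})$ and set $u^\phi(t,x)=\int_{\mathbb{R}}\chi(u(t,x),v)\phi(v)\,dv$. Then $$u^\phi\in L^1_{loc}((0,T);\dot W^{s,1}_{x,loc})\qquad\text{for all } s<s_*:=\frac{1+\eta-\iota}{1+\eta+\iota},$$ with $$\|u^\phi\|_{L^1_{loc}((0,T);\dot W^{s,1}_{x,loc})}\ \lesssim\ \big(\|u\|_{L^\infty_tL^1_{x,loc}}+1\big)^{\frac{1+\eta}{\iota+1+\eta}}\big(\|m\|_{\mathcal{M}_{t,x}\mathcal{M}_{v,loc}}\vee1\big)^{\frac{\iota+\eta}{\iota+1+\eta}}+\|u^\phi\|_{L^1_t(\dot W^{-1,1}_x)} .$$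
   Context: Here $\mathbb{T}$ is the one-dimensional torus, and functions on $\mathbb{T}$ may be identified with periodic functions on $\mathbb{R}$; $\vee$ denotes maximum. Kinetic function: $\chi(u,v)=1$ if $0<v<u$, $-1$ if $u<v<0$, and $0$ otherwise; $\chi(t,x,v)=\chi(u(t,x),v)$, $\chi^0(x,v)=\chi(u_0(x),v)$ where $u_0\in L^\infty(\mathbb{T})$ is the initial datum. Quasi-solution: $u\in L^\infty([0,T]\times\mathbb{T})\cap C([0,T];L^1(\mathbb{T}))$ is a quasi-solution if there is a finite (possibly signed) Radon measure $m$ on $[0,T]\times\mathbb{T}\times\mathbb{R}$ such that, for all $\psi\in C_c^\infty(\mathbb{T}\times\mathbb{R})$ and $t\in[0,T]$, $$\int \chi(t,x,v)\,\psi(x-vw_t,v)\,dx\,dv=\int\chi^0(x,v)\,\psi(x,v)\,dx\,dv-\int_{[0,t]\times\mathbb{T}\times\mathbb{R}}\partial_v\big(\psi(x-vw_r,v)\big)\,m(dr,dx,dv).$$ $C^\eta$ is the space of $\eta$-Hölder continuous functions. $\dot W^{\sigma,1}_x$ denotes the homogeneous Sobolev space of order $\sigma$ in $x$. The subscript ''loc'' means that the norm is taken over (arbitrary, fixed) compact subsets in the corresponding variable: compact subintervals of $(0,T)$ in time, compact sets in $x$ and, for $\mathcal{M}_{t,x}\mathcal{M}_{v,loc}$ (measures with finite total mass on $[0,T]\times\mathbb{T}\times K$ for every compact $K\subset\mathbb{R}$), compact sets in $v$. The symbol $\lesssim$ means inequality up to a multiplicative constant that may depend on these compact sets and on $T,\phi,s,\eta,\iota,w$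 (through $\|w\|_\eta$ and the $C_\alpha$), but not on $u$ or $m$. *)

(* Defs.v *)
From HB Require Import structures.
From mathcomp Require Import all_boot all_order all_algebra.
From mathcomp Require Import all_classical all_reals all_analysis.
From mathcomp Require Import ess_sup_inf.

Set Implicit Arguments.
Unset Strict Implicit.
Unset Printing Implicit Defensive.

Import Order.TTheory GRing.Theory Num.Theory.
Import numFieldNormedType.Exports.

Local Open Scope classical_set_scope.
Local Open Scope ring_scope.

(** The torus is R/Z: functions on it are 1-periodic
    functions on R, and integrals over it are integrals over [0, 1[. *)

Section paths.
Context {R : realType}.
Implicit Types (T eta iota : R) (w : R -> R).

(** w is only evaluated on [0, T]. *)
Definition holder_norm T eta w : \bar R :=
  (ereal_sup [set `|w t|%:E | t in `[0%R, T]%classic] +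
   ereal_sup [set (`|w z.2 - w z.1| / (`|z.2 - z.1| `^ eta))%:E | z in
     [set z : R * R | [/\ z.1 \in `[0%R, T], z.2 \in `[0%R, T] & z.1 != z.2]]])%E.

(** Continuity is a separate requirement only because of the case eta = 0. *)
Definition holder_space T eta w : Prop :=
  {within `[0, T], continuous w} /\ (holder_norm T eta w < +oo)%E.

(** For alpha < 0, |x|^alpha is +oo at x = 0, whereas [0 `^ alpha] is 0; the
    extended inverse of |x|^(-alpha) has the right value. *)
Definition neg_power (x alpha : R) : \bar R :=
  ((`|x| `^ (- alpha))%:E^-1)%E.

Definition path_irregular T iota (Calpha : R -> R) w : Prop :=
  forall alpha : R, -1 < alpha < 0 ->
    0 <= Calpha alpha /\
    forall lambda : R, 1 <= lambda ->
      (\int[@lebesgue_measure R]_(r in `[0%R, T])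
         \int[@lebesgue_measure R]_(t in `[0%R, (T - r)%R])
           ((expR (- (lambda * t)))%:E * neg_power (w (r + t) - w r)%R alpha)
       <= (Calpha alpha * lambda `^ (-1 - iota * alpha))%:E)%E.

End paths.

Section test_functions.
Context {R : realType}.

(** On finite-dimensional V this is the usual class C^n. *)
Fixpoint Ck (V : normedModType R) (n : nat) (f : V -> R) : Prop :=
  if n is k.+1 then
    (forall x, differentiable f x) /\ forall v, Ck k (fun x => 'D_v f x)
  else continuous f.

Definition smooth (V : normedModType R) (f : V -> R) : Prop :=
  forall n, Ck n f.

Definition Cc_smooth (phi : R -> R) : Prop :=
  smooth phi /\ exists M : R, forall v, M < `|v| -> phi v = 0.

Definition Cc_smooth_torus (psi : R * R -> R) : Prop :=
  [/\ smooth psi,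
      forall x v, psi (x + 1, v) = psi (x, v) &
      exists M : R, forall x v, M < `|v| -> psi (x, v) = 0].

End test_functions.

Section signed_measures.
Context {d : measure_display} {X : measurableType d} {R : realType}.
Implicit Type m : {charge set X -> \bar R}.

Definition hahn_pos m : set X := sval (cid (Hahn_decomposition m)).
Definition hahn_neg m : set X := sval (cid (svalP (cid (Hahn_decomposition m)))).
Definition hahnPN m : hahn_decomposition m (hahn_pos m) (hahn_neg m) :=
  svalP (cid (svalP (cid (Hahn_decomposition m)))).

Definition charge_tv m : set X -> \bar R := charge_variation (hahnPN m).

Definition charge_integral m (D : set X) (f : X -> R) : R :=
  Rintegral (jordan_pos (hahnPN m)) D f - Rintegral (jordan_neg (hahnPN m)) D f.

End signed_measures.

Section quasi_solutions.
Context {R : realType}.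
Implicit Types (T : R) (w : R -> R) (u : R -> R -> R).
Local Notation mu := (@lebesgue_measure R).

Definition chi (u v : R) : R :=
  if 0 < v < u then 1 else if u < v < 0 then -1 else 0.

Definition Linfty_torus (u0 : R -> R) : Prop :=
  [/\ forall x, u0 (x + 1) = u0 x,
      measurable_fun setT u0 &
      exists M : R, {ae mu, forall x, `|u0 x| <= M}].

(** u t x is a jointly measurable representative, for t in [0, T], of an element
    of L^oo([0,T] x torus) and of C([0,T]; L^1(torus)). *)
Definition Linfty_CL1 T u : Prop :=
  [/\ forall t x, t \in `[0, T] -> u t (x + 1) = u t x,
      measurable_fun (`[0, T] `*` setT) (fun z : R * R => u z.1 z.2),
      exists M : R, {ae (mu \x mu)%E, forall z : R * R,
        z.1 \in `[0, T] -> `|u z.1 z.2| <= M},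
      forall t, t \in `[0, T] -> mu.-integrable `[0, 1[ (EFin \o u t) &
      forall t, t \in `[0, T] ->
        (\int[mu]_(x in `[0%R, 1%R[) `|u r x - u t x|%:E)%E
          @[r --> within `[0, T] (nbhs t)] --> 0%E].

(** Only the restriction of m to [0, T] x [0, 1[ x R is used; it is a finite
    signed Borel measure on [0, T] x torus x R, hence Radon. *)
Definition quasi_solution T w (u0 : R -> R) u
    (m : {charge set (R * R * R)%type -> \bar R}) : Prop :=
  [/\ Linfty_torus u0, Linfty_CL1 T u &
      forall (psi : R * R -> R) (t : R), Cc_smooth_torus psi -> t \in `[0, T] ->
        \int[(mu \x mu)%E]_(z in `[0, 1[ `*` setT)
          (chi (u t z.1) z.2 * psi (z.1 - z.2 * w t, z.2)) =
        \int[(mu \x mu)%E]_(z in `[0, 1[ `*` setT)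
          (chi (u0 z.1) z.2 * psi z)
        - charge_integral m (`[0, t] `*` `[0, 1[ `*` setT)
            (fun z => derive1 (fun v : R => psi (z.1.2 - v * w z.1.1, v)) z.2)].

Definition velocity_average (phi : R -> R) u (t x : R) : R :=
  \int[mu]_v (chi (u t x) v * phi v).

Definition Linfty_L1_norm T u : \bar R :=
  ess_sup mu ((fun t => \int[mu]_(x in `[0%R, 1%R[) `|u t x|%:E)%E \_ `[0, T]).

(** Norm of m in M_{t,x} M_{v,loc}, for the compact set K of velocities. *)
Definition kinetic_mass T (m : {charge set (R * R * R)%type -> \bar R})
    (K : set R) : \bar R :=
  charge_tv m (`[0, T] `*` `[0, 1[ `*` K).

End quasi_solutions.

Section homogeneous_sobolev.
Context {R : realType}.
Local Notation mu := (@lebesgue_measure R).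

Definition fourier_cos (f : R -> R) (k : nat) : R :=
  \int[mu]_(x in `[0, 1[) (f x * cos (2 * pi * k%:R * x)).
Definition fourier_sin (f : R -> R) (k : nat) : R :=
  \int[mu]_(x in `[0, 1[) (f x * sin (2 * pi * k%:R * x)).

(** g = |D|^sigma f, where |D| = (-d^2/dx^2)^(1/2) has symbol |2 pi k|. The zero
    mode of f is ignored, as homogeneous spaces are spaces modulo constants;
    sigma may be any real number. *)
Definition riesz_derivative (sigma : R) (f g : R -> R) : Prop :=
  [/\ mu.-integrable `[0, 1[ (EFin \o f),
      mu.-integrable `[0, 1[ (EFin \o g),
      fourier_cos g 0 = 0 &
      forall k : nat, (0 < k)%N ->
        fourier_cos g k = (2 * pi * k%:R) `^ sigma * fourier_cos f k /\
        fourier_sin g k = (2 * pi * k%:R) `^ sigma * fourier_sin f k].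

(** || |D|^sigma f ||_{L^1}: g is unique up to null sets, and the infimum of the
    empty set is +oo. *)
Definition hsobolev_norm (sigma : R) (f : R -> R) : \bar R :=
  ereal_inf [set (\int[mu]_(x in `[0%R, 1%R[) `|g x|%:E)%E |
             g in [set g | riesz_derivative sigma f g]].

Definition L1_hsobolev_norm (I : set R) (sigma : R) (f : R -> R -> R) : \bar R :=
  (\int[mu]_(t in I) hsobolev_norm sigma (f t))%E.

(** L^1_loc((0, T); W^{sigma,1}): through the isometry f |-> |D|^sigma f and
    L^1(I; L^1) = L^1(I x torus), Bochner integrability of t |-> f t amounts to
    joint integrability of |D|^sigma f. *)
Definition L1loc_hsobolev (T sigma : R) (f : R -> R -> R) : Prop :=
  forall a b : R, 0 < a -> a <= b -> b < T ->
    exists2 g : R -> R -> R,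
      (mu \x mu)%E.-integrable (`[a, b] `*` `[0, 1[)
        (fun z : R * R => (g z.1 z.2)%:E) &
      {ae mu, forall t : R, t \in `[a, b] -> riesz_derivative sigma (f t) (g t)}.

End homogeneous_sobolev.

(* Main.v *)
Require Import Defs.
From HB Require Import structures.
From mathcomp Require Import all_boot all_order all_algebra.
From mathcomp Require Import all_classical all_reals all_analysis.
From mathcomp Require Import measurable_realfun ess_sup_inf ring lra archimedean.

(** Since [chi] is bounded by 1 and [phi] has compact support, the norms of [u] play no role
    in the estimate. Let P be a kernel at frequency 1/delta on the torus, with P = Q'. Testing
    the equation with P(y - x) phi(v), transported by the path from time r to time t, shows
    that the frequency-1/delta part of [u^phi] at time t is the average of
    chi(u(r, x), v) against P(y - x - v (w_t - w_r)) phi(v), up to a term carried by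
    the measure m on [r, t]. Integrating by parts in v bounds the average by
    |Q|_1 / |w_t - w_r|; interpolating with the trivial bound |P|_1 gives
    |P|_1^(1-gamma) |Q|_1^gamma |w_t - w_r|^(-gamma). One then averages over r in [t - e, t],
    where the irregularity hypothesis with lambda = 1/e controls the negative power, and takes
    e = min(a, 1) (|m| \/ 1)^(-p) delta^(2p) with p = 1 / (1 + eta + iota), which balances the
    two contributions.

    The frequency decomposition is the one given by the second derivatives of the Poisson
    kernels of radius exp (- exp sigma), with delta = exp sigma: their Fourier coefficients
    are explicit, so that |D|^s is an exact integral of them over sigma in R with weight
    exp ((2 - s) sigma), up to a constant. *)

Set Implicit Arguments.
Unset Strict Implicit.
Unset Printing Implicit Defensive.

Import Order.TTheory GRing.Theory Num.Theory.
Import numFieldNormedType.Exports.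

Local Open Scope classical_set_scope.
Local Open Scope ring_scope.


(** * Integration *)

(** The second derivative of the Poisson kernel has the periodic primitive [dpoisson], whose L^1
    bound is smaller by one power of delta; the integration by parts in v consumes that power, while
    [d3poisson] appears when the weak formulation differentiates the test function in v. These three
    kernels have L^1 bounds of order delta^-2, delta^-1 and delta^-3, and with e of order delta^(2p)
    they lead to three rates in delta: gamma (1 - 2 p iota) - s, 2 p - s and 2 p (1 + eta) - 1 - s.
    As gamma tends to 1 the first meets the third, with common value s_* - s; hence s < s_* leaves a
    positive rate for some gamma < 1, the range in which the irregularity hypothesis is available.
    This rate makes the integral over sigma converge absolutely at -oo; at +oo the radius is doubly
    exponentially small.

    Measurability shapes several statements: the Sobolev norm of a time slice is an infimum, not
    known to be measurable in t, and [u] and [w] are only controlled on [0, T], outside which they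
    are replaced by 0. *)

Section measure_tools.
Context {R : realType}.
Local Notation mu := (@lebesgue_measure R).
Local Open Scope ereal_scope.

(** The integral of a nonnegative function is a supremum over the simple functions below it, and a
    larger function has more of them. This covers integrands whose measurability is not known, such
    as Sobolev norms of time slices. *)
Lemma ge0_le_integral_nomeas (d : measure_display) (T : measurableType d)
    (m : {measure set T -> \bar R}) (D : set T) (f g : T -> \bar R) :
  (forall x, D x -> 0 <= f x) -> (forall x, D x -> f x <= g x) ->
  \int[m]_(x in D) f x <= \int[m]_(x in D) g x.
Proof.
move=> f0 fg.
rewrite !ge0_integralE//; last first.
  by move=> x Dx; exact: le_trans (f0 _ Dx) (fg _ Dx).
apply: le_ereal_sup => _ [h hf <-]; exists h => // x.
apply: le_trans (hf x) _.
rewrite /patch; case: ifPn => // xD; apply: fg; exact: set_mem.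
Qed.

Lemma tonelli_on (d1 d2 : measure_display) (T1 : measurableType d1) (T2 : measurableType d2)
    (m1 : {sigma_finite_measure set T1 -> \bar R})
    (m2 : {sigma_finite_measure set T2 -> \bar R})
    (D1 : set T1) (D2 : set T2) (f : T1 * T2 -> \bar R) :
  measurable D1 -> measurable D2 -> measurable_fun [set: T1 * T2] f ->
  (forall z, 0 <= f z) ->
  \int[m1]_(x in D1) \int[m2]_(y in D2) f (x, y) =
  \int[m2]_(y in D2) \int[m1]_(x in D1) f (x, y).
Proof.
move=> mD1 mD2 mf f0.
have mD : measurable (D1 `*` D2) by exact: measurableX.
rewrite integral_mkcond [RHS]integral_mkcond.
have := @fubini_tonelli _ _ _ _ _ m1 m2 (f \_ (D1 `*` D2)).
rewrite /patch => fub.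
transitivity (\int[m1]_x \int[m2]_y
  (if (x, y) \in D1 `*` D2 then f (x, y) else 0)).
  apply: eq_integral => x _.
  case: ifPn => xD1 /=.
    by rewrite integral_mkcond; apply: eq_integral => y _;
      rewrite /patch classical_sets.in_setX xD1.
  by rewrite integral0_eq// => y _; rewrite classical_sets.in_setX (negbTE xD1).
rewrite fub; first last.
- by move=> z; case: ifP.
- exact/(measurable_restrictT f mD)/measurable_funTS.
apply: eq_integral => y _.
case: ifPn => yD2 /=.
  rewrite [RHS]integral_mkcond; apply: eq_integral => x _.
  by rewrite /patch classical_sets.in_setX yD2 andbT.
by rewrite integral0_eq// => x _; rewrite classical_sets.in_setX (negbTE yD2) andbF.
Qed.

Lemma measurable_integral_param (d1 d2 : measure_display) (T1 : measurableType d1)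
    (T2 : measurableType d2) (m2 : {sigma_finite_measure set T2 -> \bar R})
    (D2 : set T2) (f : T1 * T2 -> \bar R) :
  measurable D2 -> measurable_fun [set: T1 * T2] f -> (forall z, 0 <= f z) ->
  measurable_fun setT (fun x => \int[m2]_(y in D2) f (x, y)).
Proof.
move=> mD2 mf f0.
have mD : measurable ([set: T1] `*` D2) by exact: measurableX.
have := @measurable_fun_fubini_tonelli_F _ _ T1 T2 R m2 (f \_ ([set: T1] `*` D2)).
rewrite /fubini_F => H.
rewrite (_ : (fun x => _) =
  (fun x => \int[m2]_y (f \_ ([set: T1] `*` D2)) (x, y))).
  apply: H; first exact/(measurable_restrictT f mD)/measurable_funTS.
  by move=> z; rewrite /patch; case: ifP.
apply/funext => x; rewrite integral_mkcond; apply: eq_integral => y _.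
by rewrite /patch classical_sets.in_setX in_setT.
Qed.

(** [Rintegral] is [fine] of a difference of two nonnegative integrals, each measurable in the
    parameter; parameters at which the integral diverges are included, with the default value 0 of
    [fine]. *)
Lemma measurable_Rintegral_param (d1 d2 : measure_display) (T1 : measurableType d1)
    (T2 : measurableType d2) (m2 : {sigma_finite_measure set T2 -> \bar R})
    (D2 : set T2) (f : T1 * T2 -> R) :
  measurable D2 -> measurable_fun [set: T1 * T2] f ->
  measurable_fun setT (fun x => (\int[m2]_(y in D2) f (x, y))%R).
Proof.
move=> mD2 mf; rewrite /Rintegral.
apply: (@measurableT_comp _ _ _ _ _ _ (@fine R)) => //.
under eq_fun do rewrite integralE.
have mp : measurable_fun setT (EFin \o f)^\+.
  by apply: measurable_funepos; exact/measurable_EFinP.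
have mn : measurable_fun setT (EFin \o f)^\-.
  by apply: measurable_funeneg; exact/measurable_EFinP.
apply: emeasurable_funB.
- apply: eq_measurable_fun
    (measurable_integral_param m2 mD2 mp (fun z => funepos_ge0 _ _)) => x _.
  by apply: eq_integral => y _; rewrite !funeposE.
- apply: eq_measurable_fun
    (measurable_integral_param m2 mD2 mn (fun z => funeneg_ge0 _ _)) => x _.
  by apply: eq_integral => y _; rewrite !funenegE.
Qed.

(** By uniqueness of Lebesgue measure it suffices to compare the two measures on intervals []a,
    b]]. *)
Lemma lebesgue_measure_shift (c : R) (A : set R) : measurable A ->
  pushforward mu ((fun x : R => (x + c)%R) : _ -> measurableTypeR R) A = mu A.
Proof.
have mS : measurable_fun [set: measurableTypeR R]
    ((fun x : R => (x + c)%R) : measurableTypeR R -> measurableTypeR R).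
  exact: measurable_funD.
pose mixin := isMeasurableFun.Build _ _ _ _ _ mS.
pose pack : {mfun measurableTypeR R >-> measurableTypeR R} :=
  HB.pack ((fun x : R => (x + c)%R) : measurableTypeR R -> measurableTypeR R) mixin.
move=> mA; apply/esym.
apply: (@lebesgue_measure_unique R (pushforward mu pack)) => //= _ [[a b]] _ <-.
rewrite /pushforward /=.
rewrite (_ : _ @^-1` _ = `](a - c)%R, (b - c)%R]%classic).
  rewrite !lebesgue_measure_itv/= !lte_fin ltrD2r.
  case: ifP => // _; rewrite -!EFinB; congr EFin; ring.
by apply/seteqP; split => x /=; rewrite !in_itv/= ltrBlDr lerBrDr.
Qed.

Lemma ge0_integral_shift (c : R) (f : R -> \bar R) :
  measurable_fun [set: R] f -> (forall x, 0 <= f x) ->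
  \int[mu]_x f (x + c)%R = \int[mu]_x f x.
Proof.
move=> mf f0.
have mS : measurable_fun [set: measurableTypeR R]
    ((fun x : R => (x + c)%R) : measurableTypeR R -> measurableTypeR R).
  exact: measurable_funD.
have := @ge0_integral_pushforward _ _ (measurableTypeR R) (measurableTypeR R) R _ mS
  mu setT f measurableT mf (fun y _ => f0 y).
rewrite preimage_setT /comp => <-.
by apply: eq_measure_integral => A mA _; exact: lebesgue_measure_shift.
Qed.

Lemma ge0_integral_shift_itv (c x y : R) b0 b1 (f : R -> \bar R) :
  measurable_fun [set: R] f -> (forall x, 0 <= f x) ->
  \int[mu]_(z in [set` Interval (BSide b0 x) (BSide b1 y)]) f (z + c)%R =
  \int[mu]_(z in [set` Interval (BSide b0 (x + c)%R) (BSide b1 (y + c)%R)]) f z.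
Proof.
move=> mf f0; rewrite integral_mkcond [RHS]integral_mkcond.
rewrite -[RHS](@ge0_integral_shift c); last 2 first.
  exact: (proj1 (measurable_restrictT f (measurable_itv _)) (measurable_funTS mf)).
  by move=> z; rewrite /patch; case: ifP.
apply: eq_integral => z _; rewrite /patch !mem_setE !itv_boundlr /=.
by case: b0 b1 => -[]; rewrite !bnd_simp ?(lerD2r,ltrD2r).
Qed.

(** The shift is first reduced modulo 1 to some d in [0, 1[; then [d, 1 + d[ is cut at 1 and its
    second piece is moved back by one period. *)
Lemma ge0_integral_periodic (c : R) (f : R -> \bar R) :
  measurable_fun [set: R] f -> (forall x, 0 <= f x) ->
  (forall x, f (x + 1)%R = f x) ->
  \int[mu]_(y in `[0%R, 1%R[) f (y + c)%R = \int[mu]_(y in `[0%R, 1%R[) f y.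
Proof.
move=> mf f0 fper.
have fper_nat (n : nat) x : f (x + n%:R)%R = f x.
  by elim: n => [|n IH]; rewrite ?addr0// -natr1 addrA fper.
have fper_int (n : int) (x : R) : f (x + n%:~R)%R = f x.
  case: n => n; first exact: fper_nat.
  by rewrite NegzE mulrNz -(fper_nat n.+1 (x - _)%R) subrK.
pose d := (c - (Num.floor c)%:~R)%R.
have d0 : (0 <= d)%R by rewrite subr_ge0 floor_le_tmp.
have d1 : (d < 1)%R by rewrite ltrBlDl; have := floorD1_gt c; rewrite intrD.
transitivity (\int[mu]_(y in `[0%R, 1%R[) f (y + d)%R).
  apply: eq_integral => y _.
  by rewrite -(fper_int (Num.floor c) (y + d)%R) /d; congr f; ring.
rewrite (@ge0_integral_shift_itv d)// add0r.
have d1' : (1 <= 1 + d)%R by lra.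
rewrite (_ : `[d, (1 + d)%R[%classic = `[d, 1%R[ `|` `[1%R, (1 + d)%R[); last first.
  by rewrite -itv_bndbnd_setU// bnd_simp// ltW.
rewrite ge0_integral_setU//=; first last.
- apply/disj_setPS => z [] /=; rewrite !in_itv/=; lra.
- exact: (measurable_funTS mf).
rewrite (_ : `[0%R, 1%R[%classic = `[0%R, d[ `|` `[d, 1%R[); last first.
  by rewrite -itv_bndbnd_setU// bnd_simp// ltW.
rewrite [RHS]ge0_integral_setU//=; first last.
- apply/disj_setPS => z [] /=; rewrite !in_itv/=; lra.
- exact: (measurable_funTS mf).
rewrite addeC; congr (_ + _).
rewrite -{1}(add0r 1%R) (addrC 1%R d) -ge0_integral_shift_itv//.
by apply: eq_integral => z _; rewrite fper.
Qed.

End measure_tools.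

(** * Derivatives *)

Section elementary_derivatives.
Context {R : realType} {V : normedModType R}.
Implicit Types f g : V -> R.

Lemma is_derive_fctD f g x v df dg : is_derive x v f df -> is_derive x v g dg ->
  is_derive x v (fun z => f z + g z) (df + dg).
Proof. by move=> hf hg; exact: is_deriveD. Qed.

Lemma is_derive_fctB f g x v df dg : is_derive x v f df -> is_derive x v g dg ->
  is_derive x v (fun z => f z - g z) (df - dg).
Proof. by move=> hf hg; exact: is_deriveB. Qed.

Lemma is_derive_fctM f g x v df dg : is_derive x v f df -> is_derive x v g dg ->
  is_derive x v (fun z => f z * g z) (f x * dg + g x * df).
Proof. by move=> hf hg; exact: is_deriveM. Qed.

Lemma is_derive_fctV f x v df : f x != 0 -> is_derive x v f df ->
  is_derive x v (fun z => (f z)^-1) (- (f x)^-1 ^+ 2 * df).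
Proof.
move=> f0 hf; apply: DeriveDef; first exact: derivableV.
by rewrite (@deriveV _ _ f)// derive_val exprVn.
Qed.

Lemma is_derive_rew f x v df df' : is_derive x v f df -> df = df' ->
  is_derive x v f df'.
Proof. by move=> ? <-. Qed.

Lemma is_derive_fctC (c : R) (x v : V) : is_derive x v (fun=> c) 0.
Proof. exact: is_derive_cst. Qed.

End elementary_derivatives.

(** * Closure properties of the classes C^n *)

Section smooth_functions.
Context {R : realType} {V : normedModType R}.
Implicit Types f g : V -> R.

Lemma CkW n f : Ck n.+1 f -> Ck n f.
Proof.
elim: n f => [|n IH] f /= [df hf]; first by move=> x; exact: differentiable_continuous.
by split => // v; apply: IH; exact: hf.
Qed.

Lemma Ck_cst n (c : R) : Ck n (fun _ : V => c).
Proof.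
elim: n c => [|n IH] c /=; first by move=> x; exact: cvg_cst.
split => [x|v]; first exact: differentiable_cst.
by rewrite [X in Ck _ X](_ : _ = fun=> 0) //; apply/funext => x; exact: derive_cst.
Qed.

Lemma CkD n f g : Ck n f -> Ck n g -> Ck n (fun x => f x + g x).
Proof.
elim: n f g => [|n IH] f g /=; first by move=> cf cg x; apply: cvgD; [exact: cf|exact: cg].
move=> [df hf] [dg hg]; split => [x|v]; first exact: differentiableD.
rewrite [X in Ck _ X](_ : _ = fun x => 'D_v f x + 'D_v g x); first exact: IH.
by apply/funext => x; rewrite -deriveD//; exact: diff_derivable.
Qed.

(** In the Leibniz rule the undifferentiated factors also have to be of class C^n, which is the
    reason for [CkW]. *)
Lemma CkM n f g : Ck n f -> Ck n g -> Ck n (fun x => f x * g x).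
Proof.
elim: n f g => [|n IH] f g; first by move=> /= cf cg x; apply: cvgM; [exact: cf|exact: cg].
move=> hf0 hg0; have hf1 := CkW hf0; have hg1 := CkW hg0.
move: hf0 hg0 => /= [df hf] [dg hg]; split => [x|v]; first exact: differentiableM.
rewrite [X in Ck _ X](_ : _ = fun x => f x * 'D_v g x + g x * 'D_v f x).
  by apply: CkD; exact: IH.
by apply/funext => x; rewrite -[RHS]deriveM//; exact: diff_derivable.
Qed.

Lemma CkV n f : (forall x, f x != 0) -> Ck n f -> Ck n (fun x => (f x)^-1).
Proof.
move=> f0; elim: n => [|n IH]; first by move=> /= cf x; apply: cvgV => //; exact: cf.
move=> hf0; have hf1 := CkW hf0.
move: hf0 => /= [df hf]; split => [x|v]; first exact: differentiableV.
rewrite [X in Ck _ X](_ : _ = fun x => (-1) * ((f x)^-1 * (f x)^-1) * 'D_v f x).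
  apply: CkM => //; apply: CkM; first exact: Ck_cst.
  by apply: CkM; exact: IH.
apply/funext => x; rewrite (@deriveV _ _ f)//; last exact: diff_derivable.
by rewrite /GRing.scale/= -exprVn expr2 mulN1r.
Qed.

(** The hypothesis says that L is affine. *)
Lemma Ck_cos_sin n (L : V -> R) (dL : V -> R) : (forall x, differentiable L x) ->
  (forall x v, 'D_v L x = dL v) ->
  Ck n (fun x => cos (L x)) /\ Ck n (fun x => sin (L x)).
Proof.
move=> dfL DL.
have dc x : differentiable (@cos R) x by apply/derivable1_diffP; exact: derivable_cos.
have ds x : differentiable (@sin R) x by apply/derivable1_diffP; exact: derivable_sin.
have Dc v x : 'D_v (fun x => cos (L x)) x = (-1) * dL v * sin (L x).
  rewrite deriveE; last exact: differentiable_comp.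
  rewrite (_ : (fun x => cos (L x)) = cos \o L)// diff_comp//=.
  rewrite -(deriveE _ (dfL x)) DL deriv1E; last exact: derivable_cos.
  by rewrite derive1E derive_val /GRing.scale/=; ring.
have Ds v x : 'D_v (fun x => sin (L x)) x = dL v * cos (L x).
  rewrite deriveE; last exact: differentiable_comp.
  rewrite (_ : (fun x => sin (L x)) = sin \o L)// diff_comp//=.
  rewrite -(deriveE _ (dfL x)) DL deriv1E; last exact: derivable_sin.
  by rewrite derive1E derive_val.
elim: n => [|n [IHc IHs]] /=.
  by split => x; apply: differentiable_continuous; exact: differentiable_comp.
split; (split => [x|v]; first exact: differentiable_comp).
- rewrite [X in Ck _ X](_ : _ = fun x => (-1) * dL v * sin (L x)); last exact/funext.
  by apply: CkM => //; exact: Ck_cst.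
- rewrite [X in Ck _ X](_ : _ = fun x => dL v * cos (L x)); last exact/funext.
  by apply: CkM => //; exact: Ck_cst.
Qed.

End smooth_functions.

Section smooth_plane.
Context {R : realType}.

(** The derivative of [phi] after [snd] in direction v is that of [phi] in direction v.2, again
    after [snd], so the induction runs over all [phi]. *)
Lemma Ck_comp_snd n (phi : R -> R) : Ck n phi -> Ck n (fun z : R * R => phi z.2).
Proof.
have dsnd (z : R * R) : differentiable (@snd R R) z.
  by apply: linear_differentiable => y; exact: cvg_snd.
elim: n phi => [|n IH] phi /=.
  by move=> cphi z; apply: (continuous_comp (f := snd)); [exact: cvg_snd|exact: cphi].
move=> [dphi hphi]; split => [z|v]; first exact: (differentiable_comp (f := snd)).
rewrite [X in Ck _ X](_ : _ = fun z : R * R => 'D_(v.2) phi z.2).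
  by apply: (IH ('D_(v.2) phi)); exact: hphi.
apply/funext => z; rewrite deriveE; last exact: (differentiable_comp (f := snd)).
rewrite (_ : (fun z : R * R => phi z.2) = phi \o snd)// diff_comp//=.
by rewrite deriveE//= diff_lin// => y; exact: cvg_snd.
Qed.

Lemma Ck_plane_cos_sin n (a b c : R) :
  Ck n (fun z : R * R => cos (a + b * z.1 + c * z.2)) /\
  Ck n (fun z : R * R => sin (a + b * z.1 + c * z.2)).
Proof.
have d1 (z : R * R) : differentiable (@fst R R) z.
  by apply: linear_differentiable => y; exact: cvg_fst.
have d2 (z : R * R) : differentiable (@snd R R) z.
  by apply: linear_differentiable => y; exact: cvg_snd.
have df1 (z : R * R) : differentiable (fun z : R * R => b * z.1) z.
  by apply: differentiableM => //; exact: differentiable_cst.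
have df2 (z : R * R) : differentiable (fun z : R * R => c * z.2) z.
  by apply: differentiableM => //; exact: differentiable_cst.
apply: (@Ck_cos_sin _ _ n _ (fun v : R * R => b * v.1 + c * v.2)).
  move=> z.
  have da : differentiable (fun _ : R * R => a) z by exact: differentiable_cst.
  exact: (differentiableD (differentiableD da (df1 z)) (df2 z)).
move=> z v.
have h1 : is_derive z v (@fst R R) v.1.
  apply: DeriveDef; first exact: diff_derivable.
  by rewrite deriveE// diff_lin// => y; exact: cvg_fst.
have h2 : is_derive z v (@snd R R) v.2.
  apply: DeriveDef; first exact: diff_derivable.
  by rewrite deriveE// diff_lin// => y; exact: cvg_snd.
have := is_derive_fctD (is_derive_fctD (is_derive_fctC a z v)
  (is_derive_fctM (is_derive_fctC b z v) h1)) (is_derive_fctM (is_derive_fctC c z v) h2).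
by move=> /@derive_val ->; rewrite !mulr0 !addr0 add0r.
Qed.

End smooth_plane.

(** * Fundamental theorem of calculus and trigonometric functions *)

Section calculus_tools.
Context {R : realType}.
Local Notation mu := (@lebesgue_measure R).

Lemma is_derive_continuous (F f : R -> R) :
  (forall x, is_derive x (1 : R) F (f x)) -> continuous F.
Proof.
by move=> dF x; apply: differentiable_continuous; apply/derivable1_diffP; exact: ex_derive.
Qed.

Lemma continuous_integrable_cc (f : R -> R) (a b : R) : continuous f ->
  mu.-integrable `[a, b] (EFin \o f).
Proof.
move=> cf; apply: continuous_compact_integrable; first exact: segment_compact.
exact: continuous_subspaceT.
Qed.

Lemma continuous_integrable_co (f : R -> R) (a b : R) : continuous f ->
  mu.-integrable `[a, b[ (EFin \o f).
Proof.
move=> cf; apply: integrableS (continuous_integrable_cc a b cf) => //.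
exact: subset_itv_co_cc.
Qed.

Lemma Rintegral_derive (F f : R -> R) (a b : R) : a <= b ->
  (forall x, is_derive x (1 : R) F (f x)) -> continuous f ->
  \int[mu]_(x in `[a, b]) f x = F b - F a.
Proof.
rewrite le_eqVlt => /predU1P[->|ab] dF cf.
  by rewrite set_itv1 Rintegral_set1 subrr.
have cF := is_derive_continuous dF.
rewrite /Rintegral (@continuous_FTC2 _ f F)//; first exact: continuous_subspaceT.
  split => [x _||]; first exact: ex_derive.
  - by apply: cvg_at_right_filter; exact: cF.
  - by apply: cvg_at_left_filter; exact: cF.
by move=> x _; rewrite derive1E derive_val.
Qed.

Lemma Rintegral_derive_co (F f : R -> R) (a b : R) : a <= b ->
  (forall x, is_derive x (1 : R) F (f x)) -> continuous f ->
  \int[mu]_(x in `[a, b[) f x = F b - F a.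
Proof.
move=> ab dF cf; rewrite -(Rintegral_derive ab dF cf).
by rewrite Rintegral_itv_bndo_bndc//; exact: continuous_integrable_co.
Qed.

Lemma is_derive_mulr_comp (k x : R) (F : R -> R) dF :
  is_derive (k * x) (1 : R) F dF -> is_derive x (1 : R) (fun z => F (k * z)) (k * dF).
Proof.
move=> hF.
have hk : is_derive x (1 : R) ( *%R k) k.
  have := @is_deriveZ _ _ _ id k x 1 1 (is_derive_id _ _).
  by rewrite /GRing.scale/= mulr1.
by have := @is_derive1_comp _ F ( *%R k) x _ _ hF hk; rewrite mulrC.
Qed.

Lemma is_derive_cos_mulr (k x : R) :
  is_derive x (1 : R) (fun z => cos (k * z)) (k * - sin (k * x)).
Proof. exact: is_derive_mulr_comp. Qed.

Lemma is_derive_sin_mulr (k x : R) :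
  is_derive x (1 : R) (fun z => sin (k * z)) (k * cos (k * x)).
Proof. exact: is_derive_mulr_comp. Qed.

Lemma cos_periodic_nat (n : nat) (x : R) : cos (x + 2 * pi * n%:R) = cos x.
Proof.
elim: n => [|n IH]; first by rewrite mulr0 addr0.
have -> : x + 2 * pi * n.+1%:R = (x + 2 * pi * n%:R) + pi *+ 2 by ring.
by rewrite cosD2pi IH.
Qed.

Lemma sin_periodic_nat (n : nat) (x : R) : sin (x + 2 * pi * n%:R) = sin x.
Proof.
elim: n => [|n IH]; first by rewrite mulr0 addr0.
have -> : x + 2 * pi * n.+1%:R = (x + 2 * pi * n%:R) + pi *+ 2 by ring.
by rewrite sinD2pi IH.
Qed.

Lemma cos_2pin (n : nat) : cos (2 * pi * n%:R : R) = 1.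
Proof. by rewrite -[X in cos X]add0r cos_periodic_nat cos0. Qed.

Lemma sin_2pin (n : nat) : sin (2 * pi * n%:R : R) = 0.
Proof. by rewrite -[X in sin X]add0r sin_periodic_nat sin0. Qed.

(** b k = a k+1 - r a k satisfies b k = r b k+1, hence vanishes if a is bounded. *)
Lemma bounded_recurrence (r M : R) (a : nat -> R) : 0 < r < 1 ->
  (forall k, `|a k| <= M) ->
  (forall k, (1 + r ^+ 2) * a k.+1 = r * (a k.+2 + a k)) ->
  forall k, a k = r ^+ k * a 0%N.
Proof.
move=> /andP[r0 r1] aM rec.
pose b k := a k.+1 - r * a k.
have brec k : b k = r * b k.+1 by have := rec k; rewrite /b => h; nra.
have bM k : `|b k| <= 2 * M.
  rewrite (le_trans (ler_normB _ _))// normrM gtr0_norm//.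
  by have := aM k.+1; have := aM k; have := normr_ge0 (a k); nra.
have bn k n : b k = r ^+ n * b (k + n)%N.
  by elim: n => [|n IH]; rewrite ?addn0 ?mul1r// IH brec addnS exprSr mulrA.
have b0 k : b k = 0.
  apply/eqP; rewrite -normr_le0; apply/ler_addgt0Pl => e e0; rewrite addr0.
  have M0 : 0 <= M by exact: le_trans (aM 0%N).
  have : (fun n => r ^+ n) @ \oo --> (0 : R).
    by apply: cvg_expr; rewrite gtr0_norm.
  move/cvgrPdist_le => /(_ (e / (2 * M + 1))).
  have M1 : 0 < 2 * M + 1 by lra.
  move=> /(_ (divr_gt0 e0 M1))[n _ /(_ n (leqnn n))]; rewrite sub0r normrN => hn.
  rewrite (bn k n) normrM (le_trans (ler_pM _ _ hn (bM _)))//.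
  by rewrite mulrAC ler_pdivrMr// ler_wpM2l//; lra.
elim=> [|k IH]; first by rewrite mul1r.
by have := b0 k; rewrite /b IH exprS => /eqP; rewrite subr_eq0 => /eqP ->; ring.
Qed.

End calculus_tools.

(** * The Poisson kernel *)

Section poisson_kernel.
Context {R : realType}.
Local Notation mu := (@lebesgue_measure R).
Implicit Types r k z : R.

(** The denominator is |1 - r exp(2 pi i z)|^2, and [poisson r] is the Poisson kernel of the unit
    disc with period 1, the sum over k in Z of r^|k| exp(2 pi i k z). The next three functions are
    its derivatives, written with powers of the inverse denominator so that they can be bounded
    pointwise. *)
Definition pden r z : R := 1 - 2 * r * cos (2 * pi * z) + r ^+ 2.
Definition poisson r z : R := (1 - r ^+ 2) * (pden r z)^-1.
Definition dpoisson r z : R :=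
  (1 - r ^+ 2) * (- (4 * pi * r) * sin (2 * pi * z) * (pden r z)^-1 ^+ 2).
Definition d2poisson r z : R :=
  (1 - r ^+ 2) * (32 * pi ^+ 2 * r ^+ 2 * sin (2 * pi * z) ^+ 2 * (pden r z)^-1 ^+ 3
    - 8 * pi ^+ 2 * r * cos (2 * pi * z) * (pden r z)^-1 ^+ 2).
Definition d3poisson r z : R :=
  (1 - r ^+ 2) * (192 * pi ^+ 3 * r ^+ 2 * sin (2 * pi * z) * cos (2 * pi * z) *
      (pden r z)^-1 ^+ 3
    - 384 * pi ^+ 3 * r ^+ 3 * sin (2 * pi * z) ^+ 3 * (pden r z)^-1 ^+ 4
    + 16 * pi ^+ 3 * r * sin (2 * pi * z) * (pden r z)^-1 ^+ 2).

Lemma pden_ge r z : 0 < r < 1 -> (1 - r) ^+ 2 <= pden r z.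
Proof.
move=> /andP[r0 r1]; rewrite /pden; have := cos_le1 (2 * pi * z).
by nra.
Qed.

Lemma pden_gt0 r z : 0 < r < 1 -> 0 < pden r z.
Proof.
move=> r01; apply: lt_le_trans (pden_ge z r01).
by case/andP: r01 => r0 r1; rewrite exprn_gt0// subr_gt0.
Qed.

Lemma pden_ge_sin r z : 0 < r < 1 -> r * sin (2 * pi * z) ^+ 2 <= pden r z.
Proof.
move=> /andP[r0 r1]; rewrite sin2cos2 /pden.
set c := cos _; rewrite -subr_ge0.
rewrite (_ : _ - _ = (1 - r) ^+ 2 + r * (1 - c) ^+ 2); last by ring.
by rewrite addr_ge0 ?sqr_ge0// mulr_ge0 ?sqr_ge0// ltW.
Qed.

Lemma poisson_ge0 r z : 0 < r < 1 -> 0 <= poisson r z.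
Proof.
move=> r01; rewrite mulr_ge0 ?invr_ge0 ?(ltW (pden_gt0 _ _))//.
by case/andP: r01 => r0 r1; rewrite subr_ge0 expr_le1// ltW.
Qed.

Lemma is_derive_pden r z : 0 < r < 1 ->
  is_derive z (1 : R) (pden r) (4 * pi * r * sin (2 * pi * z)).
Proof.
move=> r01; rewrite /pden.
apply: (is_derive_rew (is_derive_fctD (is_derive_fctB (is_derive_fctC 1 _ _)
    (is_derive_fctM (is_derive_fctC (2 * r) _ _) (is_derive_cos_mulr _ _)))
    (is_derive_fctC _ _ _))).
by ring.
Qed.

Lemma is_derive_invpden r z : 0 < r < 1 ->
  is_derive z (1 : R) (fun z => (pden r z)^-1)
    (- (pden r z)^-1 ^+ 2 * (4 * pi * r * sin (2 * pi * z))).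
Proof.
move=> r01; apply: is_derive_fctV; last exact: is_derive_pden.
by rewrite gt_eqF// pden_gt0.
Qed.

Lemma is_derive_poisson r z : 0 < r < 1 ->
  is_derive z (1 : R) (poisson r) (dpoisson r z).
Proof.
move=> r01.
apply: (is_derive_rew (is_derive_fctM (is_derive_fctC _ _ _) (is_derive_invpden z r01))).
by rewrite /dpoisson; ring.
Qed.

Lemma is_derive_dpoisson r z : 0 < r < 1 ->
  is_derive z (1 : R) (dpoisson r) (d2poisson r z).
Proof.
move=> r01; have dV := is_derive_invpden z r01.
apply: (is_derive_rew (is_derive_fctM (is_derive_fctC _ _ _) (is_derive_fctM
    (is_derive_fctM (is_derive_fctC _ _ _) (is_derive_sin_mulr _ _))
    (is_derive_fctM dV dV)))).
by rewrite /d2poisson; ring.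
Qed.

Lemma is_derive_d2poisson r z : 0 < r < 1 ->
  is_derive z (1 : R) (d2poisson r) (d3poisson r z).
Proof.
move=> r01; have dV := is_derive_invpden z r01.
have ds := is_derive_sin_mulr (2 * pi) z; have dc := is_derive_cos_mulr (2 * pi) z.
apply: (is_derive_rew (is_derive_fctM (is_derive_fctC _ _ _) (is_derive_fctB
    (is_derive_fctM
      (is_derive_fctM (is_derive_fctC _ _ _) (is_derive_fctM ds ds))
      (is_derive_fctM dV (is_derive_fctM dV dV)))
    (is_derive_fctM (is_derive_fctM (is_derive_fctC _ _ _) dc) (is_derive_fctM dV dV))))).
by rewrite /d3poisson; ring.
Qed.

Lemma continuous_cos_mulr k : continuous (fun z => cos (k * z)).
Proof. exact: is_derive_continuous (is_derive_cos_mulr k). Qed.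

Lemma continuous_sin_mulr k : continuous (fun z => sin (k * z)).
Proof. exact: is_derive_continuous (is_derive_sin_mulr k). Qed.

Lemma continuous_poisson r : 0 < r < 1 -> continuous (poisson r).
Proof. by move=> r01; exact: is_derive_continuous (fun z => is_derive_poisson z r01). Qed.

Lemma continuous_dpoisson r : 0 < r < 1 -> continuous (dpoisson r).
Proof. by move=> r01; exact: is_derive_continuous (fun z => is_derive_dpoisson z r01). Qed.

Lemma continuous_d2poisson r : 0 < r < 1 -> continuous (d2poisson r).
Proof. by move=> r01; exact: is_derive_continuous (fun z => is_derive_d2poisson z r01). Qed.

Lemma continuous_invpden r : 0 < r < 1 -> continuous (fun z => (pden r z)^-1).
Proof.
by move=> r01; exact: is_derive_continuous (fun z => is_derive_invpden z r01).
Qed.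

Lemma continuous_d3poisson r : 0 < r < 1 -> continuous (d3poisson r).
Proof.
move=> r01 z; have cV := continuous_invpden r01.
have cc := @continuous_cos_mulr (2 * pi); have cs := @continuous_sin_mulr (2 * pi).
have cC (c : R) : continuous (fun _ : R => c) by move=> y; exact: cvg_cst.
have cM (f g : R -> R) : continuous f -> continuous g -> continuous (fun z => f z * g z).
  by move=> cf cg y; apply: cvgM; [exact: cf|exact: cg].
have cX n (f : R -> R) : continuous f -> continuous (fun z => f z ^+ n).
  move=> cf; elim: n => [|n IH]; first exact: cC.
  rewrite (_ : (fun z => f z ^+ n.+1) = fun z => f z * f z ^+ n); first exact: cM.
  by apply/funext => y; rewrite exprS.
have cD (f g : R -> R) : continuous f -> continuous g -> continuous (fun z => f z + g z).
  by move=> cf cg y; apply: cvgD; [exact: cf|exact: cg].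
have cB (f g : R -> R) : continuous f -> continuous g -> continuous (fun z => f z - g z).
  by move=> cf cg y; apply: cvgB; [exact: cf|exact: cg].
move: z; apply: (cM _ _ (cC _)); apply: cD; first apply: cB.
- exact: (cM _ _ (cM _ _ (cM _ _ (cC _) cs) cc) (cX _ _ cV)).
- exact: (cM _ _ (cM _ _ (cC _) (cX _ _ cs)) (cX _ _ cV)).
- exact: (cM _ _ (cM _ _ (cC _) cs) (cX _ _ cV)).
Qed.

Lemma sin_periodic1 z : sin (2 * pi * (z + 1)) = sin (2 * pi * z).
Proof. by rewrite mulrDr; exact: (@sin_periodic_nat _ 1). Qed.

Lemma cos_periodic1 z : cos (2 * pi * (z + 1)) = cos (2 * pi * z).
Proof. by rewrite mulrDr; exact: (@cos_periodic_nat _ 1). Qed.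

Lemma pden_periodic r z : pden r (z + 1) = pden r z.
Proof. by rewrite /pden cos_periodic1. Qed.

Lemma poisson_periodic r z : poisson r (z + 1) = poisson r z.
Proof. by rewrite /poisson pden_periodic. Qed.

Lemma dpoisson_periodic r z : dpoisson r (z + 1) = dpoisson r z.
Proof. by rewrite /dpoisson pden_periodic sin_periodic1. Qed.

Lemma d2poisson_periodic r z : d2poisson r (z + 1) = d2poisson r z.
Proof. by rewrite /d2poisson pden_periodic sin_periodic1 cos_periodic1. Qed.

Lemma d3poisson_periodic r z : d3poisson r (z + 1) = d3poisson r z.
Proof. by rewrite /d3poisson pden_periodic sin_periodic1 cos_periodic1. Qed.

(** The pointwise bounds rest on (1 - r)^2 <= pden and r sin^2 <= pden. *)
Section pointwise_bounds.
Variables (k r : R) (k0 : 0 < k) (k1 : k < 1) (rk : r = k ^+ 2).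

Let r01 : 0 < r < 1.
Proof. by rewrite rk exprn_gt0//= exprn_ilt1// ltW. Qed.

Let d := 1 - r.
Let d0 : 0 < d. Proof. by case/andP: r01; rewrite subr_gt0. Qed.
Let d1 : d <= 1. Proof. by case/andP: r01; rewrite /d; lra. Qed.

(** Up to the factor 4 pi this is the quotient of |dpoisson| by [poisson]. The factor k, the square
    root of r, survives in all bounds below and makes kernels of small radius small. *)
Let X z := r * `|sin (2 * pi * z)| * (pden r z)^-1.

Let Y_le z : r * (pden r z)^-1 <= (k / d) ^+ 2.
Proof.
rewrite expr_div_n -rk ler_pM2l; last by case/andP: r01.
by rewrite lef_pV2 ?posrE ?pden_gt0 ?exprn_gt0// pden_ge.
Qed.

Let X_ge0 z : 0 <= X z.
Proof.
case/andP: (r01) => r0 _.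
by rewrite !mulr_ge0 ?invr_ge0// ltW// pden_gt0.
Qed.

(** The square of X is the product of r / pden, at most (k / d)^2, and r sin^2 / pden, at most 1. *)
Let X_le z : X z <= k / d.
Proof.
rewrite -(ler_pXn2r (_ : (0 < 2)%N))// ?nnegrE ?X_ge0 ?divr_ge0 ?(ltW k0) ?(ltW d0)//.
apply: le_trans (Y_le z).
rewrite (_ : X z ^+ 2 = (r * (pden r z)^-1) * (r * sin (2 * pi * z) ^+ 2 * (pden r z)^-1)).
  rewrite ler_piMr//.
    by case/andP: (r01) => r0 _; rewrite mulr_ge0 ?invr_ge0 ?(ltW r0)// ltW// pden_gt0.
  by rewrite ler_pdivrMr ?pden_gt0// mul1r pden_ge_sin.
by rewrite /X !exprMn real_normK ?num_real//; ring.
Qed.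

Let normE z : `|(pden r z)^-1| = (pden r z)^-1.
Proof. by rewrite ger0_norm// invr_ge0 ltW// pden_gt0. Qed.

Let normA : `|1 - r ^+ 2| = 1 - r ^+ 2.
Proof.
rewrite ger0_norm// subr_ge0.
by case/andP: r01 => r0 r1; rewrite expr_le1// ltW.
Qed.

Let iD_ge0 z : 0 <= (pden r z)^-1. Proof. by rewrite -normE. Qed.
Let A_ge0 : 0 <= 1 - r ^+ 2. Proof. by rewrite -normA. Qed.
Let normr : `|r| = r. Proof. by rewrite gtr0_norm//; case/andP: r01. Qed.
Let r_ge0 : 0 <= r. Proof. by rewrite -normr. Qed.
Let normpi : `|pi : R| = pi. Proof. by rewrite gtr0_norm// pi_gt0. Qed.

Lemma dpoisson_le z : `|dpoisson r z| <= 4 * pi * (k / d) * poisson r z.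
Proof.
rewrite /dpoisson !normrM normrN !normrM normE normA normr normpi.
rewrite (@ger0_norm _ 4)//.
rewrite [leLHS](_ : _ = 4 * pi * X z * poisson r z); last first.
  by rewrite /X /poisson; ring.
by rewrite ler_wpM2r ?poisson_ge0// ler_wpM2l// mulr_ge0// pi_ge0.
Qed.

Let kd_ge0 : 0 <= k / d. Proof. by rewrite divr_ge0// ltW. Qed.

(** Here 40 = 32 + 8, from the two terms of [d2poisson]: once [poisson] is factored out they are
    controlled by X^2 and r / pden, both at most (k / d)^2, hence at most k / d^2 as k < 1. *)
Lemma d2poisson_le z : `|d2poisson r z| <= 40 * pi ^+ 2 * (k / d ^+ 2) * poisson r z.
Proof.
rewrite /d2poisson normrM normA.
rewrite (le_trans (ler_wpM2l A_ge0 (ler_normB _ _)))//.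
rewrite !normrM ?normrX normE normr normpi (@ger0_norm _ 32)// (@ger0_norm _ 8)//.
apply: (@le_trans _ _ ((32 * pi ^+ 2 * X z ^+ 2 +
    8 * pi ^+ 2 * (r * (pden r z)^-1)) * poisson r z)).
  rewrite /X /poisson.
  set iD := (pden r z)^-1; set A := 1 - r ^+ 2.
  have A0 : 0 <= A by exact: A_ge0.
  have iD0 : 0 <= iD by exact: iD_ge0.
  have := cos_max (2 * pi * z); set c := `|cos _| => c1.
  rewrite -subr_ge0.
  rewrite [X in 0 <= X](_ : _ = 8 * pi ^+ 2 * r * iD ^+ 2 * A * (1 - c)); last by ring.
  by do !apply: mulr_ge0 => //; rewrite ?subr_ge0 ?pi_ge0 ?r_ge0.
rewrite ler_wpM2r ?poisson_ge0//.
have X2 : X z ^+ 2 <= (k / d) ^+ 2 by rewrite ler_pXn2r// nnegrE ?X_ge0.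
have Y2 := Y_le z.
have kk : (k / d) ^+ 2 <= k / d ^+ 2.
  rewrite expr_div_n; apply: ler_wpM2r; first by rewrite invr_ge0 exprn_ge0// ltW.
  by rewrite expr2 ler_piMl ?(ltW k0) ?(ltW k1).
have pi2 : 0 <= (pi : R) ^+ 2 by rewrite exprn_ge0// pi_ge0.
rewrite [leRHS](_ : _ = 32 * pi ^+ 2 * (k / d ^+ 2) + 8 * pi ^+ 2 * (k / d ^+ 2)); last by ring.
have pic (c : R) : 0 <= c -> 0 <= c * pi ^+ 2 by move=> c0; exact: mulr_ge0.
by apply: lerD; apply: ler_wpM2l; [exact: pic|exact: le_trans X2 kk|
  exact: pic|exact: le_trans Y2 kk].
Qed.

(** Here 592 = 192 + 384 + 16: once [poisson] is factored out, the three terms are controlled by X r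
    / pden, X^3 and X, each at most k / d^3 because k < 1 and d <= 1. *)
Lemma d3poisson_le z : `|d3poisson r z| <= 592 * pi ^+ 3 * (k / d ^+ 3) * poisson r z.
Proof.
rewrite /d3poisson normrM normA.
apply: (@le_trans _ _ ((192 * pi ^+ 3 * (X z * (r * (pden r z)^-1)) +
    384 * pi ^+ 3 * X z ^+ 3 + 16 * pi ^+ 3 * X z) * poisson r z)).
  rewrite /X /poisson [in leRHS]mulrCA.
  rewrite ler_wpM2l ?A_ge0//.
  set iD := (pden r z)^-1.
  have iD0 : 0 <= iD by exact: iD_ge0.
  rewrite (le_trans (ler_normD _ _))// (le_trans (lerD (ler_normB _ _) (lexx _)))//.
  rewrite !normrM ?normrX normE -/iD normr normpi.
  rewrite (@ger0_norm _ 192)// (@ger0_norm _ 384)// (@ger0_norm _ 16)//.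
  have := cos_max (2 * pi * z); set c := `|cos _| => c1.
  set s := `|sin _|.
  have s0 : 0 <= s by rewrite /s.
  rewrite -subr_ge0.
  rewrite [X in 0 <= X](_ : _ = 192 * pi ^+ 3 * r ^+ 2 * s * iD ^+ 3 * (1 - c)); last by ring.
  by do !apply: mulr_ge0 => //; rewrite ?subr_ge0 ?pi_ge0 ?r_ge0.
rewrite ler_wpM2r ?poisson_ge0//.
have pi3 : 0 <= (pi : R) ^+ 3 by rewrite exprn_ge0// pi_ge0.
have kd n : (0 < n <= 3)%N -> forall m, (0 < m)%N -> k ^+ m / d ^+ n <= k / d ^+ 3.
  move=> /andP[n0 n3] m m0; rewrite ler_pM ?invr_ge0 ?exprn_ge0 ?(ltW d0) ?(ltW k0)//.
    by rewrite -[leRHS]expr1 ler_wiXn2l// ltW.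
  by rewrite lef_pV2 ?posrE ?exprn_gt0// ler_wiXn2l// ltW.
have X1 : X z <= k / d ^+ 3.
  by apply: le_trans (X_le z) _; rewrite -[leLHS](expr1 (k / d)) expr_div_n; exact: kd.
have X3 : X z ^+ 3 <= k / d ^+ 3.
  apply: (@le_trans _ _ ((k / d) ^+ 3)); first by rewrite ler_pXn2r// nnegrE ?X_ge0.
  by rewrite expr_div_n; exact: kd.
have XY : X z * (r * (pden r z)^-1) <= k / d ^+ 3.
  apply: (@le_trans _ _ ((k / d) * (k / d) ^+ 2)).
    by rewrite ler_pM// ?X_ge0// mulr_ge0.
  by rewrite -exprS expr_div_n; exact: kd.
rewrite [leRHS](_ : _ = 192 * pi ^+ 3 * (k / d ^+ 3) + 384 * pi ^+ 3 * (k / d ^+ 3)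
  + 16 * pi ^+ 3 * (k / d ^+ 3)); last by ring.
have pic (c : R) : 0 <= c -> 0 <= c * pi ^+ 3 by move=> c0; exact: mulr_ge0.
by apply: lerD; [apply: lerD|]; apply: ler_wpM2l; rewrite ?pic.
Qed.

End pointwise_bounds.

End poisson_kernel.

(** * Fourier coefficients of the Poisson kernel *)

Section poisson_fourier.
Context {R : realType}.
Local Notation mu := (@lebesgue_measure R).
Implicit Types (r z : R) (k : nat).

Let cs k x : R := cos (2 * pi * k%:R * x).
Let sn k x : R := sin (2 * pi * k%:R * x).

Let ccs k : continuous (cs k). Proof. exact: continuous_cos_mulr. Qed.
Let csn k : continuous (sn k). Proof. exact: continuous_sin_mulr. Qed.
Arguments ccs : clear implicits.
Arguments csn : clear implicits.

Let cM (f g : R -> R) : continuous f -> continuous g -> continuous (fun z => f z * g z).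
Proof. by move=> cf cg y; apply: cvgM; [exact: cf|exact: cg]. Qed.
Let cD (f g : R -> R) : continuous f -> continuous g -> continuous (fun z => f z + g z).
Proof. by move=> cf cg y; apply: cvgD; [exact: cf|exact: cg]. Qed.
Let cZ (c : R) (f : R -> R) : continuous f -> continuous (fun z => c * f z).
Proof. by move=> cf y; apply: cvgM; [exact: cvg_cst|exact: cf]. Qed.

Let RintD (f g : R -> R) : continuous f -> continuous g ->
  \int[mu]_(x in `[0, 1[) (f x + g x) =
  \int[mu]_(x in `[0, 1[) f x + \int[mu]_(x in `[0, 1[) g x.
Proof. by move=> cf cg; apply: RintegralD => //; exact: continuous_integrable_co. Qed.

Let RintZ (c : R) (f : R -> R) : continuous f ->
  \int[mu]_(x in `[0, 1[) (c * f x) = c * \int[mu]_(x in `[0, 1[) f x.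
Proof. by move=> cf; apply: RintegralZl => //; exact: continuous_integrable_co. Qed.

Let Rint_cst (c : R) : \int[mu]_(x in `[0, 1[) c = c.
Proof.
rewrite Rintegral_cst//= lebesgue_measure_itv/= lte_fin ltr01.
by rewrite oppr0 adde0/= mulr1.
Qed.

Lemma Rintegral_cos k :
  \int[mu]_(x in `[0, 1[) cos (2 * pi * k%:R * x) = (k == 0)%:R.
Proof.
case: k => [|k].
  rewrite -[RHS](Rint_cst 1); apply: eq_Rintegral => x _.
  by rewrite mulr0 mul0r cos0.
have c0 : 2 * pi * k.+1%:R != 0 :> R by rewrite !mulf_neq0 ?pnatr_eq0// gt_eqF// pi_gt0.
have dF x : is_derive x (1 : R) (fun x => (2 * pi * k.+1%:R)^-1 * sn k.+1 x) (cs k.+1 x).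
  apply: (is_derive_rew (is_derive_fctM (is_derive_fctC _ _ _) (is_derive_sin_mulr _ _))).
  by rewrite mulr0 addr0 mulrA mulVf// mul1r.
rewrite (Rintegral_derive_co ler01 dF (ccs _)).
by rewrite /sn mulr1 sin_2pin !mulr0 sin0 mulr0 subrr.
Qed.

Lemma Rintegral_sin k : \int[mu]_(x in `[0, 1[) sin (2 * pi * k%:R * x) = 0.
Proof.
case: k => [|k].
  rewrite -[RHS](Rint_cst 0); apply: eq_Rintegral => x _.
  by rewrite mulr0 mul0r sin0.
have c0 : 2 * pi * k.+1%:R != 0 :> R by rewrite !mulf_neq0 ?pnatr_eq0// gt_eqF// pi_gt0.
have dF x : is_derive x (1 : R) (fun x => - (2 * pi * k.+1%:R)^-1 * cs k.+1 x) (sn k.+1 x).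
  apply: (is_derive_rew (is_derive_fctM (is_derive_fctC _ _ _) (is_derive_cos_mulr _ _))).
  by rewrite mulr0 addr0 mulNr mulrN mulrN opprK mulKf.
rewrite (Rintegral_derive_co ler01 dF (csn _)).
by rewrite /cs mulr1 cos_2pin mulr0 cos0 subrr.
Qed.

Section fixed_radius.
Variables (r : R) (r01 : 0 < r < 1).

Let cp : continuous (poisson r). Proof. exact: continuous_poisson. Qed.

Let poisson_bounded : exists M : R, forall z, `|poisson r z| <= M.
Proof.
exists ((1 - r ^+ 2) * ((1 - r) ^+ 2)^-1) => z.
rewrite ger0_norm ?poisson_ge0// ler_wpM2l//.
  by case/andP: r01 => r0 r1; rewrite subr_ge0 expr_le1// ltW.
rewrite lef_pV2 ?posrE ?pden_gt0 ?pden_ge// exprn_gt0//.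
by case/andP: r01; rewrite subr_gt0.
Qed.

Let bounded_coef (e : nat -> R -> R) : (forall k, continuous (e k)) ->
  (forall k x, `|e k x| <= 1) ->
  exists M : R, forall k, `|\int[mu]_(x in `[0, 1[) (poisson r x * e k x)| <= M.
Proof.
move=> ce e1; have [M pM] := poisson_bounded.
exists (M * 1) => k.
have cpe : continuous (fun x => poisson r x * e k x) by exact: cM.
rewrite (le_trans (le_normr_Rintegral _ (continuous_integrable_co _ _ cpe)))//.
rewrite mulr1 -[leRHS](Rint_cst M).
apply: le_Rintegral => //.
- by apply: (continuous_integrable_co 0 1) => y; apply: cvg_norm; exact: cpe.
- by apply: (continuous_integrable_co 0 1) => y; exact: cvg_cst.
- by move=> x _; rewrite normrM -[leRHS]mulr1 ler_pM.
Qed.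

Let pden_mul x : pden r x * poisson r x = 1 - r ^+ 2.
Proof. by rewrite /poisson mulrCA divff ?mulr1// gt_eqF// pden_gt0. Qed.

(** Integrate [pden r x * poisson r x = 1 - r ^+ 2] against e1: the cosine in the denominator turns
    e1 into its two neighbours, which yields a three-term recurrence between coefficients. *)
Let coef_rec (e0 e1 e2 : R -> R) :
  continuous e0 -> continuous e1 -> continuous e2 ->
  (forall x, e2 x + e0 x = 2 * cos (2 * pi * x) * e1 x) ->
  (1 + r ^+ 2) * \int[mu]_(x in `[0, 1[) (poisson r x * e1 x) =
  r * (\int[mu]_(x in `[0, 1[) (poisson r x * e2 x) +
       \int[mu]_(x in `[0, 1[) (poisson r x * e0 x))
  + (1 - r ^+ 2) * \int[mu]_(x in `[0, 1[) e1 x.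
Proof.
move=> c0 c1 c2 E.
have cp0 := cM cp c0; have cp1 := cM cp c1; have cp2 := cM cp c2.
rewrite -(RintD cp2 cp0) -(RintZ _ cp1) -(RintZ _ (cD cp2 cp0)) -(RintZ _ c1).
rewrite -(RintD (cZ (c := r) (cD cp2 cp0)) (cZ (c := 1 - r ^+ 2) c1)).
apply: eq_Rintegral => x _.
by rewrite -(pden_mul x) -mulrDr E /pden; ring.
Qed.

Lemma poisson_fourier_sin k :
  \int[mu]_(x in `[0, 1[) (poisson r x * sin (2 * pi * k%:R * x)) = 0.
Proof.
have s0 : \int[mu]_(x in `[0, 1[) (poisson r x * sn 0 x) = 0.
  rewrite -[RHS](Rint_cst 0); apply: eq_Rintegral => x _.
  by rewrite /sn mulr0 mul0r sin0 mulr0.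
have [M hM] := bounded_coef csn (fun k x => sin_max _).
rewrite (bounded_recurrence (a := fun k => \int[mu]_(x in `[0, 1[) (poisson r x * sn k x)) r01 hM).
  by rewrite s0 mulr0.
move=> j; rewrite (coef_rec (csn j) (csn j.+1) (csn j.+2)).
  by rewrite Rintegral_sin mulr0 addr0.
move=> x; rewrite /sn.
have -> : 2 * pi * j.+2%:R * x = 2 * pi * j.+1%:R * x + 2 * pi * x by ring.
have -> : 2 * pi * j%:R * x = 2 * pi * j.+1%:R * x - 2 * pi * x by ring.
by rewrite sinD sinB; ring.
Qed.

Lemma poisson_fourier_cos k :
  \int[mu]_(x in `[0, 1[) (poisson r x * cos (2 * pi * k%:R * x)) = r ^+ k.
Proof.
have [M hM] := bounded_coef ccs (fun k x => cos_max _).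
have E : forall k, \int[mu]_(x in `[0, 1[) (poisson r x * cs k x) =
    r ^+ k * \int[mu]_(x in `[0, 1[) (poisson r x * cs 0 x).
  apply: (bounded_recurrence r01 hM) => j.
  rewrite (coef_rec (ccs j) (ccs j.+1) (ccs j.+2)).
    by rewrite Rintegral_cos mulr0 addr0.
  move=> x; rewrite /cs.
  have -> : 2 * pi * j.+2%:R * x = 2 * pi * j.+1%:R * x + 2 * pi * x by ring.
  have -> : 2 * pi * j%:R * x = 2 * pi * j.+1%:R * x - 2 * pi * x by ring.
  by rewrite cosD cosB; ring.
suff a0 : \int[mu]_(x in `[0, 1[) (poisson r x * cs 0 x) = 1 by rewrite E a0 mulr1.
(* The recurrence at frequency 0, where both neighbours are the frequency 1, fixes the remaining
   constant: with a1 = r a0 it reads (1 - r^2) a0 = 1 - r^2. *)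
have := @coef_rec (cs 1) (cs 0) (cs 1) (ccs 1) (ccs 0) (ccs 1).
rewrite (E 1%N) (Rintegral_cos 0) expr1 mulr1.
set a0 := Rintegral _ _ _ => H.
have {}H : (1 + r ^+ 2) * a0 = r * (r * a0 + r * a0) + (1 - r ^+ 2).
  by apply: H => x; rewrite /cs mulr0 mul0r cos0 !mulr1; ring.
have rr : 1 - r ^+ 2 != 0.
  by case/andP: r01 => r0 r1; rewrite gt_eqF// subr_gt0 expr_lt1// ltW.
by apply: (mulfI rr); rewrite mulr1; apply/eqP; rewrite -subr_eq0;
  move/eqP: H; rewrite -subr_eq0 => /eqP H; apply/eqP; rewrite -[RHS]H; ring.
Qed.

(** Two integrations by parts in one: the integrand plus w^2 times that of the Poisson kernel is the
    derivative of a 1-periodic function. *)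
Lemma d2poisson_fourier_cos k :
  \int[mu]_(x in `[0, 1[) (d2poisson r x * cos (2 * pi * k%:R * x)) =
  - (2 * pi * k%:R) ^+ 2 * r ^+ k.
Proof.
set w := 2 * pi * k%:R.
have c1 := continuous_dpoisson r01; have c2 := continuous_d2poisson r01.
have ck := ccs k; have c2k := cM c2 ck; have cpk := cM cp ck.
have : \int[mu]_(x in `[0, 1[) (d2poisson r x * cs k x + w ^+ 2 * (poisson r x * cs k x)) = 0.
  have dF x : is_derive x (1 : R)
      (fun x => dpoisson r x * cs k x + w * (poisson r x * sn k x))
      (d2poisson r x * cs k x + w ^+ 2 * (poisson r x * cs k x)).
    apply: (is_derive_rew (is_derive_fctD
      (is_derive_fctM (is_derive_dpoisson x r01) (is_derive_cos_mulr w x))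
      (is_derive_fctM (is_derive_fctC w _ _)
        (is_derive_fctM (is_derive_poisson x r01) (is_derive_sin_mulr w x))))).
    by rewrite /cs -/w; ring.
  rewrite (Rintegral_derive_co ler01 dF (cD c2k (cZ cpk))).
  have -> : dpoisson r 1 = dpoisson r 0 by rewrite -[RHS]dpoisson_periodic add0r.
  have -> : poisson r 1 = poisson r 0 by rewrite -[RHS]poisson_periodic add0r.
  by rewrite /cs /sn mulr1 cos_2pin sin_2pin !mulr0 cos0 sin0 ?mulr0 subrr.
rewrite RintD//; last exact: cZ.
rewrite RintZ// poisson_fourier_cos => /eqP.
by rewrite addr_eq0 mulNr => /eqP.
Qed.

Lemma d2poisson_fourier_sin k :
  \int[mu]_(x in `[0, 1[) (d2poisson r x * sin (2 * pi * k%:R * x)) = 0.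
Proof.
set w := 2 * pi * k%:R.
have c1 := continuous_dpoisson r01; have c2 := continuous_d2poisson r01.
have ck := csn k; have c2k := cM c2 ck; have cpk := cM cp ck.
have : \int[mu]_(x in `[0, 1[) (d2poisson r x * sn k x + w ^+ 2 * (poisson r x * sn k x)) = 0.
  have dF x : is_derive x (1 : R)
      (fun x => dpoisson r x * sn k x - w * (poisson r x * cs k x))
      (d2poisson r x * sn k x + w ^+ 2 * (poisson r x * sn k x)).
    apply: (is_derive_rew (is_derive_fctB
      (is_derive_fctM (is_derive_dpoisson x r01) (is_derive_sin_mulr w x))
      (is_derive_fctM (is_derive_fctC w _ _)
        (is_derive_fctM (is_derive_poisson x r01) (is_derive_cos_mulr w x))))).
    by rewrite /sn -/w; ring.
  rewrite (Rintegral_derive_co ler01 dF (cD c2k (cZ cpk))).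
  have -> : dpoisson r 1 = dpoisson r 0 by rewrite -[RHS]dpoisson_periodic add0r.
  have -> : poisson r 1 = poisson r 0 by rewrite -[RHS]poisson_periodic add0r.
  by rewrite /cs /sn mulr1 cos_2pin sin_2pin !mulr0 cos0 sin0 ?mulr0 subrr.
rewrite RintD//; last exact: cZ.
by rewrite RintZ// poisson_fourier_sin mulr0 addr0.
Qed.

Let poisson_mass : (\int[mu]_(x in `[0%R, 1%R[) (poisson r x)%:E = 1)%E.
Proof.
have := poisson_fourier_cos 0; rewrite expr0 => H.
have i : mu.-integrable `[0, 1[ (EFin \o poisson r) by exact: continuous_integrable_co.
rewrite -(fineK (integrable_fin_num _ i))//; congr EFin.
rewrite -[RHS]H /Rintegral; congr fine; apply: eq_integral => x _.
by rewrite mulr0 mul0r cos0 mulr1.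
Qed.

(** All the L^1 bounds come from the mass of the Poisson kernel being 1. *)
Lemma poisson_majorant (f : R -> R) (c : R) : 0 <= c ->
  (forall z, `|f z| <= c * poisson r z) ->
  (\int[mu]_(x in `[0%R, 1%R[) `|f x|%:E <= c%:E)%E.
Proof.
move=> c0 fc; rewrite -[leRHS]mule1 -poisson_mass.
rewrite -ge0_integralZl_EFin//=; last 2 first.
- by move=> x _; rewrite lee_fin poisson_ge0.
- apply/measurable_EFinP; apply: measurable_funTS; exact: continuous_measurable_fun.
by apply: ge0_le_integral_nomeas => x _; rewrite -?EFinM lee_fin.
Qed.

End fixed_radius.

End poisson_fourier.

(** * Averages of the kinetic function *)

Section measurability_rules.
Context {d : measure_display} {X : measurableType d} {R : realType}.
Implicit Types f g : X -> R.

Lemma measurable_fctD f g : measurable_fun setT f -> measurable_fun setT g ->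
  measurable_fun setT (fun x => f x + g x).
Proof. by move=> mf mg; exact: measurable_funD. Qed.

Lemma measurable_fctB f g : measurable_fun setT f -> measurable_fun setT g ->
  measurable_fun setT (fun x => f x - g x).
Proof. by move=> mf mg; exact: measurable_funB. Qed.

Lemma measurable_fctM f g : measurable_fun setT f -> measurable_fun setT g ->
  measurable_fun setT (fun x => f x * g x).
Proof. by move=> mf mg; exact: measurable_funM. Qed.

Lemma measurable_fctN f : measurable_fun setT f -> measurable_fun setT (fun x => - f x).
Proof. by move=> mf; exact: measurable_funN. Qed.

Lemma measurable_fctnorm f : measurable_fun setT f ->
  measurable_fun setT (fun x => `|f x|).
Proof. by move=> mf; exact: measurableT_comp. Qed.

Lemma measurable_continuous_comp (h : R -> R) f : continuous h ->
  measurable_fun setT f -> measurable_fun setT (fun x => h (f x)).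
Proof.
by move=> ch mf; apply: (measurableT_comp (f := h)) => //; exact: continuous_measurable_fun.
Qed.

Lemma measurable_fctC (c : R) : measurable_fun setT (fun _ : X => c).
Proof. exact: measurable_cst. Qed.

Lemma measurable_fctexp f : measurable_fun setT f -> measurable_fun setT (fun x => expR (f x)).
Proof. by move=> mf; apply: (measurableT_comp (f := expR)) => //; exact: measurable_expR. Qed.

Lemma measurable_if (b : X -> bool) f g : measurable_fun setT b ->
  measurable_fun setT f -> measurable_fun setT g ->
  measurable_fun setT (fun x => if b x then f x else g x).
Proof. by move=> mb mf mg; exact: measurable_fun_ifT. Qed.

Lemma measurable_chi f g : measurable_fun setT f -> measurable_fun setT g ->
  measurable_fun setT (fun x => chi (f x) (g x)).
Proof.
move=> mf mg; rewrite /chi; apply: measurable_if.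
- by apply: measurable_and; exact: measurable_fun_ltr.
- exact: measurable_fctC.
- apply: measurable_if; [|exact: measurable_fctC|exact: measurable_fctC].
  by apply: measurable_and; exact: measurable_fun_ltr.
Qed.

End measurability_rules.

(** Rules are selected by the shape of an explicit function [fun x => ...]; continuous or measurable
    heads are looked up among the hypotheses, so proofs name such facts before the call. *)
Ltac meas := repeat first
  [ assumption
  | match goal with
    | H : continuous ?h |- measurable_fun _ (fun x => ?h _) =>
        apply: (measurable_continuous_comp H)
    | H : measurable_fun _ ?h |- measurable_fun _ (fun x => ?h _) =>
        apply: (measurableT_comp H)
    end
  | exact: measurable_fctC
  | exact: measurable_id
  | exact: measurable_fst
  | exact: measurable_snd
  | apply: measurable_fctD
  | apply: measurable_fctB
  | apply: measurable_fctN
  | apply: measurable_fctM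
  | apply: measurable_fctnorm
  | apply: measurable_chi
  | apply: measurable_fctexp
  | match goal with
    | |- measurable_fun _ (fun x => (@?f x).1) =>
        apply: (measurableT_comp (f := fst) (g := f)); first exact: measurable_fst
    | |- measurable_fun _ (fun x => (@?f x).2) =>
        apply: (measurableT_comp (f := snd) (g := f)); first exact: measurable_snd
    end ].

Section chi_integrals.
Context {R : realType}.
Local Notation mu := (@lebesgue_measure R).

Lemma chi_norm_le (U v : R) : `|chi U v| <= 1.
Proof. by rewrite /chi; do 2?case: ifP => _; rewrite ?normrN ?normr1 ?normr0. Qed.

Lemma integrable_compact_support (f : R -> R) (C M : R) : measurable_fun setT f ->
  (forall v, `|f v| <= C) -> (forall v, M < `|v| -> f v = 0) ->
  mu.-integrable setT (EFin \o f).
Proof.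
move=> mf fC f0.
have fE : EFin \o f = (EFin \o f) \_ `[- M, M].
  apply/funext => v; rewrite /patch; case: ifPn => // /negP vM /=.
  rewrite f0// ltNge; apply/negP => /= vM'; apply: vM.
  by apply/mem_set => /=; rewrite in_itv/= -ler_norml.
rewrite fE; apply/integrable_restrict => //; rewrite setTI.
apply: measurable_bounded_integrable => //.
- by rewrite /= lebesgue_measure_itv/=; case: ifP => _; rewrite -?EFinB ltry.
- exact: measurable_funTS.
- exists `|C|; split; first exact: num_real.
  move=> x Cx v _ /=; apply: ltW; apply: le_lt_trans Cx.
  exact: le_trans (fC _) (ler_norm _).
Qed.

(** [chi U] is the indicator of the interval between 0 and U, with the sign of U, so the fundamental
    theorem of calculus applies on that interval in both cases. *)
Lemma Rintegral_chi_derive (F f : R -> R) (U : R) :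
  (forall v, is_derive v (1 : R) F (f v)) -> continuous f ->
  \int[mu]_v (chi U v * f v) = F U - F 0.
Proof.
move=> dF cf; have [U0|U0|<-] := ltgtP 0 U.
- rewrite -(Rintegral_derive (ltW U0) dF cf).
  rewrite -Rintegral_itv_bndo_bndc; last exact: continuous_integrable_co.
  rewrite -Rintegral_itv_obnd_cbnd; last first.
    apply: integrableS (continuous_integrable_co 0 U cf) => //.
    exact: subset_itv_oo_co.
  rewrite [RHS]Rintegral_mkcond; apply: eq_Rintegral => v _.
  rewrite /patch mem_setE in_itv/= /chi.
  case: ifPn => [|_]; first by rewrite mul1r.
  case: ifPn => [/andP[Uv v0]|_]; last by rewrite mul0r.
  by move: (lt_trans U0 (lt_trans Uv v0)); rewrite ltxx.
- rewrite -opprB -(Rintegral_derive (ltW U0) dF cf).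
  rewrite -Rintegral_itv_bndo_bndc; last exact: continuous_integrable_co.
  rewrite -Rintegral_itv_obnd_cbnd; last first.
    apply: integrableS (continuous_integrable_co U 0 cf) => //.
    exact: subset_itv_oo_co.
  rewrite -mulN1r -RintegralZl//; last first.
    apply: integrableS (continuous_integrable_co U 0 cf) => //.
    exact: subset_itv_oo_co.
  rewrite [RHS]Rintegral_mkcond; apply: eq_Rintegral => v _.
  rewrite /patch mem_setE in_itv/= /chi.
  case: ifPn => [/andP[v0 vU]|_].
    by move: (lt_trans v0 (lt_trans vU U0)); rewrite ltxx.
  by case: ifPn => // _; rewrite mul0r.
- rewrite subrr -[RHS](mul0r (fine (mu setT))) -Rintegral_cst//.
  apply: eq_Rintegral => v _; rewrite /chi.
  case: ifPn => [/andP[v0 vU]|_]; first by move: (lt_trans v0 vU); rewrite ltxx.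
  case: ifPn => [/andP[v0 vU]|_]; first by move: (lt_trans v0 vU); rewrite ltxx.
  by rewrite mul0r.
Qed.

End chi_integrals.

(** * Oscillatory averages in the velocity variable *)

Section kernel_average.
Context {R : realType}.
Local Notation mu := (@lebesgue_measure R).
Variables (M0 B : R) (M0_gt0 : 0 < M0) (B_gt0 : 0 < B).

Definition bounded_support (psi : R -> R) :=
  [/\ continuous psi, (forall v, M0 < `|v| -> psi v = 0) & (forall v, `|psi v| <= B)].

Definition periodic_kernel (q : R -> R) (n : R) :=
  [/\ continuous q, (forall z, q (z + 1) = q z) &
      (\int[mu]_(z in `[0%R, 1%R[) `|q z|%:E <= n%:E)%E].

(** With z = y - x, U = u(r, x) and delta = w_t - w_r, this is the velocity integral of the
    transported test function at the point x. *)
Definition chi_average (q psi : R -> R) (delta U z : R) : R :=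
  \int[mu]_v (chi U v * (q (z - v * delta) * psi v)).

Lemma continuous_affine (z delta : R) : continuous (fun v : R => z - v * delta).
Proof.
by move=> v; apply: cvgB; [exact: cvg_cst|apply: cvgM; [exact: cvg_id|exact: cvg_cst]].
Qed.

Lemma continuous_comp_affine (q : R -> R) (z delta : R) : continuous q ->
  continuous (fun v : R => q (z - v * delta)).
Proof.
move=> cq v; apply: (@continuous_comp _ _ _ (fun v : R => z - v * delta) q v).
  exact: continuous_affine.
exact: cq.
Qed.

Lemma integrable_chi_average (psi h : R -> R) (U : R) : bounded_support psi ->
  continuous h -> mu.-integrable setT (EFin \o (fun v => chi U v * (h v * psi v))).
Proof.
move=> [cpsi psi0 psiB] ch.
set f := fun v => _.
have mf : measurable_fun setT f.
  have mh := continuous_measurable_fun ch; have mpsi := continuous_measurable_fun cpsi.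
  by rewrite /f; meas.
have fE : EFin \o f = (EFin \o f) \_ `[- M0, M0].
  apply/funext => v; rewrite /patch; case: ifPn => // /negP vM /=.
  rewrite /f psi0 ?mulr0// ltNge; apply/negP => /= vM'; apply: vM.
  by apply/mem_set => /=; rewrite in_itv/= -ler_norml.
rewrite fE; apply/integrable_restrict => //; rewrite setTI.
have ih : mu.-integrable `[- M0, M0] (EFin \o (fun v => B * h v)).
  by apply: continuous_integrable_cc => y; apply: cvgM; [exact: cvg_cst|exact: ch].
apply: le_integrable ih => //.
  by apply/measurable_EFinP; exact: measurable_funTS mf.
move=> v _ /=; rewrite lee_fin /f !normrM [leRHS]mulrC (gtr0_norm B_gt0).
rewrite -[leRHS]mul1r ler_pM// ?chi_norm_le//.
by rewrite ler_wpM2l.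
Qed.

Lemma chi_average_le (q psi : R -> R) (delta U z : R) : continuous q ->
  bounded_support psi ->
  (`|chi_average q psi delta U z|%:E <=
   \int[mu]_(v in `[(- M0)%R, M0]) (B * `|q (z - v * delta)%R|)%:E)%E.
Proof.
move=> cq hpsi; have [cpsi psi0 psiB] := hpsi.
have cqa : continuous (fun v : R => q (z - v * delta)).
  exact: continuous_comp_affine.
have ia := integrable_chi_average U hpsi cqa.
rewrite /chi_average EFin_normr_Rintegral//.
have /integrableP[mi _] := ia.
apply: (le_trans (le_abse_integral mu measurableT mi)).
rewrite [leRHS]integral_mkcond; apply: ge0_le_integral_nomeas => v _ //=.
rewrite /patch mem_setE in_itv/= -ler_norml.
case: ifPn => [vM|]; last by rewrite -ltNge => /psi0 ->; rewrite !mulr0 normr0.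
rewrite lee_fin !normrM -[leRHS]mul1r [B * _]mulrC ler_pM ?mulr_ge0 ?chi_norm_le//.
by rewrite ler_wpM2l.
Qed.

Lemma integral_kernel_shift (q : R -> R) (n c : R) : periodic_kernel q n ->
  (\int[mu]_(z in `[0%R, 1%R[) `|q (z + c)%R|%:E <= n%:E)%E.
Proof.
move=> [cq qper qn].
have mq := continuous_measurable_fun cq.
rewrite (@ge0_integral_periodic _ c (fun z => `|q z|%:E))//.
- by apply/measurable_EFinP; meas.
- by move=> x; rewrite qper.
Qed.

(** After exchanging the integrals, the shift by v delta is invisible on the torus; 2 M0 is the
    length of the velocity interval. *)
Lemma integral_chi_average (q : R -> R) (n delta : R) : periodic_kernel q n ->
  (\int[mu]_(z in `[0%R, 1%R[) \int[mu]_(v in `[(- M0)%R, M0])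
     (B * `|q (z - v * delta)%R|)%:E <= (2 * M0 * B * n)%:E)%E.
Proof.
move=> hq; have [cq qper qn] := hq.
have mq := continuous_measurable_fun cq.
have mF : measurable_fun [set: R * R] (fun z : R * R => (B * `|q (z.1 - z.2 * delta)%R|)%:E).
  by apply/measurable_EFinP; meas.
have F0 (z : R * R) : (0 <= (B * `|q (z.1 - z.2 * delta)%R|)%:E)%E.
  by rewrite lee_fin mulr_ge0// ltW.
rewrite (@tonelli_on _ _ _ _ _ mu mu _ _ _ (measurable_itv _) (measurable_itv _) mF F0).
apply: (@le_trans _ _ (\int[mu]_(v in `[(- M0)%R, M0]) (B * n)%:E)%E).
  apply: ge0_le_integral_nomeas => v _; first exact: integral_ge0.
  under eq_integral do rewrite EFinM.
  rewrite ge0_integralZl_EFin ?(ltW B_gt0)//=; last first.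
    apply/measurable_EFinP/measurable_funTS; meas.
  by rewrite [leRHS]EFinM lee_pmul2l//; exact: integral_kernel_shift.
rewrite integral_cst//= lebesgue_measure_itv/= lte_fin gtrN// -EFinB -EFinM lee_fin.
by rewrite le_eqVlt; apply/orP; left; apply/eqP; ring.
Qed.

Section oscillation.
Variables (phi dphi P Q : R -> R) (nP nQ : R).
Hypotheses (hphi : bounded_support phi) (hdphi : bounded_support dphi).
Hypothesis (phiE : forall v, is_derive v (1 : R) phi (dphi v)).
Hypotheses (hP : periodic_kernel P nP) (hQ : periodic_kernel Q nQ).
Hypothesis (QE : forall z, is_derive z (1 : R) Q (P z)).

(** delta * P(z - v delta) is minus the v-derivative of Q(z - v delta), and the
    v-derivative of chi(U, .) has mass at most 2. *)
Lemma chi_average_by_parts (delta U z : R) :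
  delta * chi_average P phi delta U z =
  chi_average Q dphi delta U z - (Q (z - U * delta) * phi U - Q z * phi 0).
Proof.
have [cP _ _] := hP; have [cQ _ _] := hQ.
have [cphi _ _] := hphi; have [cdphi _ _] := hdphi.
have cPa : continuous (fun v : R => P (z - v * delta)).
  exact: continuous_comp_affine.
have cQa : continuous (fun v : R => Q (z - v * delta)).
  exact: continuous_comp_affine.
have dQa v : is_derive v (1 : R) (fun v => Q (z - v * delta)) (- delta * P (z - v * delta)).
  have da : is_derive v (1 : R) (fun v : R => z - v * delta) (- delta).
    apply: (is_derive_rew (is_derive_fctB (is_derive_fctC z _ _)
      (is_derive_fctM (is_derive_id v 1) (is_derive_fctC delta _ _)))).
    by ring.
  have := @is_derive1_comp _ Q _ v _ _ (QE (z - v * delta)) da.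
  by rewrite mulrC.
have dF v : is_derive v (1 : R) (fun v => Q (z - v * delta) * phi v)
    (Q (z - v * delta) * dphi v - delta * (P (z - v * delta) * phi v)).
  by apply: (is_derive_rew (is_derive_fctM (dQa v) (phiE v))); ring.
have cM (f g : R -> R) : continuous f -> continuous g -> continuous (fun z : R => f z * g z).
  by move=> cf cg y; apply: cvgM; [exact: cf|exact: cg].
have cf : continuous (fun v : R =>
    Q (z - v * delta) * dphi v - delta * (P (z - v * delta) * phi v)).
  move=> v; apply: cvgB; first exact: (cM _ _ cQa cdphi).
  by apply: cvgM; [exact: cvg_cst|exact: (cM _ _ cPa cphi)].
have := Rintegral_chi_derive U dF cf.
rewrite mul0r subr0 => <-.
have iQ := integrable_chi_average U hdphi cQa.
have iP := integrable_chi_average U hphi cPa.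
rewrite /chi_average -RintegralZl//.
have iPd : mu.-integrable setT
    (EFin \o (fun v => delta * (chi U v * (P (z - v * delta) * phi v)))).
  exact: (integrableZl measurableT delta iP).
rewrite [X in _ = _ - X](_ : _ = \int[mu]_v (chi U v * (Q (z - v * delta) * dphi v) -
  delta * (chi U v * (P (z - v * delta) * phi v)))); last first.
  by apply: eq_Rintegral => v _; ring.
by rewrite (RintegralB measurableT iQ iPd) opprB addrC subrK.
Qed.

Lemma integral_chi_average_size (delta U c : R) :
  (\int[mu]_(z in `[0%R, 1%R[) `|chi_average P phi delta U (z + c)%R|%:E
   <= (2 * M0 * B * nP)%:E)%E.
Proof.
have [cP Pper _] := hP.
apply: le_trans (integral_chi_average delta hP).
have mP := continuous_measurable_fun cP.
rewrite -[leRHS](@ge0_integral_periodic _ c); first last.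
- move=> x; apply: eq_integral => v _.
  by rewrite -(Pper (x - _)); congr (_ * `|P _|)%:E; ring.
- by move=> x; apply: integral_ge0 => v _; rewrite lee_fin mulr_ge0// ltW.
- apply: (@measurable_integral_param _ _ _ _ _ mu _
    (fun z : R * R => (B * `|P (z.1 - z.2 * delta)%R|)%:E)) => //.
    by apply/measurable_EFinP; meas.
  by move=> x; rewrite lee_fin mulr_ge0// ltW.
apply: ge0_le_integral_nomeas => z _ //.
exact: chi_average_le.
Qed.

(** Each of the three terms of the integration by parts is bounded on its own: in the constant, 2
    counts the boundary values at U and 0, and 2 M0 is the length of the interval supporting
    [dphi]. *)
Lemma integral_chi_average_osc (delta U c : R) :
  (\int[mu]_(z in `[0%R, 1%R[) (`|delta| * `|chi_average P phi delta U (z + c)%R|)%:E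
   <= ((2 + 2 * M0) * B * nQ)%:E)%E.
Proof.
have [cQ Qper _] := hQ; have mQ := continuous_measurable_fun cQ.
have B0 : (0 <= B)%R by exact: ltW.
have mI : measurable_fun [set: R] (fun z => \int[mu]_(v in `[(- M0)%R, M0])
     (B * `|Q (z - v * delta)%R|)%:E)%E.
  apply: (@measurable_integral_param _ _ _ _ _ mu _
    (fun z : R * R => (B * `|Q (z.1 - z.2 * delta)%R|)%:E)) => //.
    by apply/measurable_EFinP; meas.
  by move=> x; rewrite lee_fin mulr_ge0.
pose G z : \bar R := ((B * `|Q (z - U * delta)|)%:E + (B * `|Q z|)%:E +
   \int[mu]_(v in `[(- M0)%R, M0]) (B * `|Q (z - v * delta)%R|)%:E)%E.
have G0 z : (0 <= G z)%E.
  apply: adde_ge0; first by rewrite -EFinD lee_fin addr_ge0// mulr_ge0.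
  by apply: integral_ge0 => v _; rewrite lee_fin mulr_ge0.
have mG1 : measurable_fun setT (fun z : R => (B * `|Q (z - U * delta)|)%:E).
  by apply/measurable_EFinP; meas.
have mG2 : measurable_fun setT (fun z : R => (B * `|Q z|)%:E).
  by apply/measurable_EFinP; meas.
have mG : measurable_fun [set: R] G.
  by apply: emeasurable_funD mI; exact: emeasurable_funD.
apply: (@le_trans _ _ (\int[mu]_(z in `[0%R, 1%R[) G (z + c)%R)%E).
  apply: ge0_le_integral_nomeas => z _; first by rewrite lee_fin mulr_ge0.
  rewrite -normrM chi_average_by_parts.
  have [_ _ phiB] := hphi.
  apply: (@le_trans _ _ (`|Q (z + c - U * delta) * phi U|%:E + `|Q (z + c) * phi 0|%:E +
    `|chi_average Q dphi delta U (z + c)|%:E)%E).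
    rewrite -!EFinD lee_fin; apply: le_trans (ler_normB _ _) _; rewrite [leRHS]addrC.
    by apply: lerD => //; exact: ler_normB.
  rewrite /G leeD//; last exact: chi_average_le.
  by rewrite -!EFinD lee_fin !normrM ![_ * `|phi _|]mulrC lerD// ler_wpM2r.
rewrite ge0_integral_periodic//; last first.
  move=> x; rewrite /G; congr (_ + _ + _)%E.
  - by rewrite -(Qper (x - _)); congr (_ * `|Q _|)%:E; ring.
  - by rewrite Qper.
  - by apply: eq_integral => v _; rewrite -(Qper (x - _)); congr (_ * `|Q _|)%:E; ring.
have hZ e : (\int[mu]_(z in `[0%R, 1%R[) (B * `|Q (z + e)|)%:E <= (B * nQ)%:E)%E.
  under eq_integral do rewrite EFinM.
  rewrite ge0_integralZl_EFin//=; last first.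
    by apply/measurable_EFinP/measurable_funTS; meas.
  by rewrite [leRHS]EFinM lee_pmul2l//; exact: integral_kernel_shift.
rewrite /G ge0_integralD//=; first last.
- exact: (measurable_funTS mI).
- by move=> z _; apply: integral_ge0 => v _; rewrite lee_fin mulr_ge0.
- by apply: (measurable_funTS (emeasurable_funD mG1 mG2)).
- by move=> z _; rewrite -EFinD lee_fin addr_ge0// mulr_ge0.
rewrite ge0_integralD//=; first last.
- exact: (measurable_funTS mG2).
- by move=> z _; rewrite lee_fin mulr_ge0.
- exact: (measurable_funTS mG1).
- by move=> z _; rewrite lee_fin mulr_ge0.
have -> : (2 + 2 * M0) * B * nQ = B * nQ + B * nQ + 2 * M0 * B * nQ by ring.
rewrite !EFinD leeD//; last exact: integral_chi_average.
apply: leeD; first exact: hZ.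
by have := hZ 0; under eq_integral do rewrite addr0.
Qed.

End oscillation.

End kernel_average.

(** * Integrals over the strip [0, 1[ x R *)

Section strip_integrals.
Context {R : realType}.
Local Notation mu := (@lebesgue_measure R).

Lemma continuous_periodic_bounded (q : R -> R) : continuous q ->
  (forall z, q (z + 1) = q z) -> exists2 C, 0 < C & forall z, `|q z| <= C.
Proof.
move=> cq qper.
have [c _ hc] := @EVT_max R (fun z => `|q z|) 0 1 ler01
  (continuous_subspaceT (fun y => cvg_norm (cq y))).
exists (`|q c| + 1); first by rewrite ltr_wpDl.
move=> z.
have per_nat (n : nat) x : q (x + n%:R) = q x.
  by elim: n => [|n IH]; rewrite ?addr0// -natr1 addrA qper.
have per_int (n : int) (x : R) : q (x + n%:~R) = q x.
  case: n => n; first exact: per_nat.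
  by rewrite NegzE mulrNz -(per_nat n.+1 (x - _)) subrK.
rewrite -(per_int (- Num.floor z)) (le_trans (hc _ _))//; last by rewrite lerDl.
rewrite in_itv/= mulrNz subr_ge0 floor_le_tmp/= lerBlDl.
by have := floorD1_gt z; rewrite intrD => /ltW.
Qed.

(** The strip has infinite measure, but the support condition on g reduces it to a box of finite
    measure, on which a bounded function is integrable and Fubini applies. *)
Lemma integral_strip (g : R * R -> R) (C M : R) : measurable_fun [set: R * R] g ->
  (forall z, `|g z| <= C) -> (forall z, M < `|z.2| -> g z = 0) ->
  [/\ (mu \x mu)%E.-integrable (`[0, 1[ `*` setT) (EFin \o g),
      (forall x, mu.-integrable setT (fun v => (g (x, v))%:E)),
      mu.-integrable `[0, 1[ (fun x => (\int[mu]_v g (x, v))%:E) &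
      \int[(mu \x mu)%E]_(z in `[0, 1[ `*` setT) g z =
      \int[mu]_(x in `[0, 1[) \int[mu]_v g (x, v)].
Proof.
move=> mg gC g0.
pose T := measurableTypeR R.
have mI : measurable (`[0%R, 1%R[%classic : set T) by exact: measurable_itv.
have mE : measurable (`[0%R, 1%R[%classic `*` `[- M, M]%classic : set (T * T)).
  by apply: measurableX; exact: measurable_itv.
have mD : measurable (`[0%R, 1%R[%classic `*` [set: T] : set (T * T)).
  by apply: measurableX; [exact: measurable_itv|exact: measurableT].
have gE : (EFin \o g) \_ (`[0, 1[ `*` setT) = (EFin \o g) \_ (`[0, 1[ `*` `[- M, M]).
  apply/funext => -[x v]; rewrite /patch !classical_sets.in_setX/= in_setT andbT.
  case: ifPn => //= _; case: ifPn => // /negP vM.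
  rewrite g0// ltNge; apply/negP => /= vM'; apply: vM.
  by apply/mem_set => /=; rewrite in_itv/= -ler_norml.
have fE : ((mu \x mu)%E (`[0%R, 1%R[%classic `*` `[(- M)%R, M]%classic) < +oo)%E.
  rewrite product_measure1E; [|exact: measurable_itv|exact: measurable_itv].
  rewrite /= !lebesgue_measure_itv/= lte_fin ltr01 -EFinB subr0 mul1e.
  by case: ifP => _; rewrite -?EFinB ltry.
have iE : (mu \x mu)%E.-integrable (`[0, 1[ `*` `[- M, M]) (EFin \o g).
  apply: measurable_bounded_integrable => //.
    exact: (measurable_funTS mg).
  exists `|C|; split; first exact: num_real.
  move=> c Cc z _ /=; apply: ltW; apply: le_lt_trans Cc.
  exact: le_trans (gC _) (ler_norm _).
have iD : (mu \x mu)%E.-integrable (`[0, 1[ `*` setT) (EFin \o g).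
  apply/(integrable_mkcond _ mD); rewrite gE; exact/(integrable_mkcond _ mE).
have ix x : mu.-integrable setT (fun v => (g (x, v))%:E).
  apply: (@integrable_compact_support _ _ C M) => //.
    exact: (measurable_fun_pair2 x mg).
  by move=> v vM; exact: g0.
have iT := proj1 (integrable_mkcond _ mD) iD.
have FE x : fubini_F mu ((EFin \o g) \_ (`[0, 1[ `*` setT)) x =
    ((fun x => (\int[mu]_v g (x, v))%:E) \_ `[0, 1[) x.
  rewrite /fubini_F /patch; case: ifPn => xI.
    rewrite /Rintegral fineK; last exact: integrable_fin_num (ix x).
    apply: eq_integral => v _.
    by rewrite classical_sets.in_setX/= in_setT andbT xI.
  rewrite integral0_eq// => v _.
  by rewrite classical_sets.in_setX/= (negbTE xI).
split => //.
- apply/(integrable_mkcond _ mI).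
  by have := integrable_fubini_F iT; apply: eq_integrable => // x _; exact: FE.
- rewrite {1}/Rintegral integral_mkcond -(integral12_prod_meas1 iT).
  rewrite [RHS]/Rintegral [in RHS]integral_mkcond; congr fine.
  by apply: eq_integral => x _; exact: FE.
Qed.

End strip_integrals.

(** * Kernel averages of a whole time slice *)

Section kinetic_averages.
Context {R : realType}.
Local Notation mu := (@lebesgue_measure R).
Variables (M0 B : R) (M0_gt0 : 0 < M0) (B_gt0 : 0 < B).
Variables (phi dphi P Q : R -> R) (nP nQ : R).
Hypotheses (hphi : bounded_support M0 B phi) (hdphi : bounded_support M0 B dphi).
Hypothesis (phiE : forall v, is_derive v (1 : R) phi (dphi v)).
Hypotheses (hP : periodic_kernel P nP) (hQ : periodic_kernel Q nQ).
Hypothesis (QE : forall z, is_derive z (1 : R) Q (P z)).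

(** This has the form of the left side of the weak formulation, tested at [P (y - x) * phi v]
    transported by the path increment delta. At delta = 0 it is the convolution of P with the
    velocity average of f. *)
Definition kinetic_average (delta : R) (f : R -> R) (y : R) : R :=
  \int[(mu \x mu)%E]_(z in `[0, 1[ `*` setT)
    (chi (f z.1) z.2 * (P (y - z.1 - z.2 * delta) * phi z.2)).

Lemma kinetic_averageE (delta : R) (f : R -> R) (y : R) : measurable_fun setT f ->
  mu.-integrable `[0, 1[ (fun x => (chi_average P phi delta (f x) (y - x))%:E) /\
  kinetic_average delta f y =
  \int[mu]_(x in `[0, 1[) chi_average P phi delta (f x) (y - x).
Proof.
move=> mf; have [cP Pper _] := hP; have [cphi phi0 phiB] := hphi.
have [C C0 PC] := continuous_periodic_bounded cP Pper.
have mP := continuous_measurable_fun cP; have mphi := continuous_measurable_fun cphi.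
have mg : measurable_fun [set: R * R]
    (fun z : R * R => chi (f z.1) z.2 * (P (y - z.1 - z.2 * delta) * phi z.2)).
  by meas.
have [|z zM|i1 _ i2 E] := @integral_strip _ _ (1 * (C * B)) M0 mg.
- move=> z; rewrite !normrM ler_pM ?mulr_ge0 ?chi_norm_le//.
  by rewrite ler_pM.
- by rewrite phi0// !mulr0.
by split; [exact: i2|exact: E].
Qed.

Lemma measurable_chi_average (delta : R) (f : R -> R) : measurable_fun setT f ->
  measurable_fun [set: R * R]
    (fun z : R * R => chi_average P phi delta (f z.2) (z.1 - z.2)).
Proof.
move=> mf; have [cP Pper _] := hP; have [cphi phi0 phiB] := hphi.
have mP := continuous_measurable_fun cP; have mphi := continuous_measurable_fun cphi.
apply: (@measurable_Rintegral_param _ _ _ _ _ mu setT (fun zv : (R * R) * R =>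
  chi (f zv.1.2) zv.2 * (P (zv.1.1 - zv.1.2 - zv.2 * delta) * phi zv.2))) => //.
by meas.
Qed.

Lemma kinetic_average_le (delta : R) (f : R -> R) (y : R) : measurable_fun setT f ->
  (`|kinetic_average delta f y|%:E <=
   \int[mu]_(x in `[0%R, 1%R[) `|chi_average P phi delta (f x) (y - x)|%:E)%E.
Proof.
move=> mf; have [ia ->] := kinetic_averageE delta y mf.
rewrite EFin_normr_Rintegral//.
have /integrableP[mi _] := ia.
exact: (le_trans (le_abse_integral mu (measurable_itv _) mi)).
Qed.

Lemma measurable_kinetic_average (delta : R) (f : R -> R) : measurable_fun setT f ->
  measurable_fun setT (kinetic_average delta f).
Proof.
move=> mf.
have := @measurable_Rintegral_param _ _ _ _ _ mu `[0, 1[ _ (measurable_itv _)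
  (measurable_chi_average delta mf).
apply: eq_measurable_fun => y _; apply/esym.
by have [_ ->] := kinetic_averageE delta y mf.
Qed.

(** Once the integral in y is innermost, its bound is uniform in the value f x, so no norm of f
    appears. *)
Lemma integral_kinetic_average_size (delta : R) (f : R -> R) : measurable_fun setT f ->
  (\int[mu]_(y in `[0%R, 1%R[) `|kinetic_average delta f y|%:E
   <= (2 * M0 * B * nP)%:E)%E.
Proof.
move=> mf; have mc := measurable_chi_average delta mf.
apply: (@le_trans _ _ (\int[mu]_(y in `[0%R, 1%R[) \int[mu]_(x in `[0%R, 1%R[)
    `|chi_average P phi delta (f x) (y - x)|%:E)%E).
  by apply: ge0_le_integral_nomeas => y _ //; exact: kinetic_average_le.
rewrite (@tonelli_on _ _ _ _ _ mu mu _ _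
  (fun z : R * R => `|chi_average P phi delta (f z.2) (z.1 - z.2)|%:E))//; last first.
  by apply/measurable_EFinP; exact: measurable_fctnorm.
apply: (@le_trans _ _ (\int[mu]_(x in `[0%R, 1%R[) (2 * M0 * B * nP)%:E)%E).
  apply: ge0_le_integral_nomeas => x _; first exact: integral_ge0.
  exact: (integral_chi_average_size M0_gt0 B_gt0 hphi hP delta (f x) (- x)).
by rewrite integral_cst//= lebesgue_measure_itv/= lte_fin ltr01 oppr0 adde0 mule1.
Qed.

Lemma integral_kinetic_average_osc (delta : R) (f : R -> R) : measurable_fun setT f ->
  (`|delta|%:E * \int[mu]_(y in `[0%R, 1%R[) `|kinetic_average delta f y|%:E
   <= ((2 + 2 * M0) * B * nQ)%:E)%E.
Proof.
move=> mf; have mc := measurable_chi_average delta mf.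
have mk := measurable_kinetic_average delta mf.
rewrite -ge0_integralZl_EFin//=; last first.
  by apply/measurable_EFinP/measurable_funTS; exact: measurable_fctnorm.
apply: (@le_trans _ _ (\int[mu]_(y in `[0%R, 1%R[) \int[mu]_(x in `[0%R, 1%R[)
    (`|delta| * `|chi_average P phi delta (f x) (y - x)|)%:E)%E).
  apply: ge0_le_integral_nomeas => y _; first by rewrite -EFinM lee_fin mulr_ge0.
  under [leRHS]eq_integral do rewrite EFinM.
  rewrite ge0_integralZl_EFin//=; last first.
    apply/measurable_EFinP/measurable_funTS; apply: measurable_fctnorm.
    exact: (measurable_fun_pair2 y mc).
  by apply: lee_pmul => //; exact: kinetic_average_le.
rewrite (@tonelli_on _ _ _ _ _ mu mu _ _
  (fun z : R * R => (`|delta| * `|chi_average P phi delta (f z.2) (z.1 - z.2)|)%:E))//; last first.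
  apply/measurable_EFinP.
  by apply: measurable_fctM; [exact: measurable_fctC|exact: measurable_fctnorm].
apply: (@le_trans _ _ (\int[mu]_(x in `[0%R, 1%R[) ((2 + 2 * M0) * B * nQ)%:E)%E).
  apply: ge0_le_integral_nomeas => x _.
    by apply: integral_ge0 => y _; rewrite lee_fin mulr_ge0.
  exact: (integral_chi_average_osc M0_gt0 B_gt0 hphi hdphi phiE hP hQ QE delta (f x) (- x)).
by rewrite integral_cst//= lebesgue_measure_itv/= lte_fin ltr01 oppr0 adde0 mule1.
Qed.

(** The integral X satisfies X <= a and |delta| X <= b; writing X = X^(1 - gamma) X^gamma and using
    one bound in each factor gives a^(1 - gamma) b^gamma |delta|^(-gamma). *)
Lemma integral_kinetic_average_interp (delta gamma : R) (f : R -> R) :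
  0 < gamma < 1 -> 0 < nP -> 0 < nQ -> measurable_fun setT f ->
  (\int[mu]_(y in `[0%R, 1%R[) `|kinetic_average delta f y|%:E
   <= ((2 * M0 * B * nP) `^ (1 - gamma) * ((2 + 2 * M0) * B * nQ) `^ gamma)%:E
      * neg_power delta (- gamma))%E.
Proof.
move=> /andP[g0 g1] nP0 nQ0 mf.
have := integral_kinetic_average_size delta mf.
have := integral_kinetic_average_osc delta mf.
set X := integral _ _ _; set a := 2 * M0 * B * nP; set b := (2 + 2 * M0) * B * nQ.
have a0 : 0 < a by rewrite !mulr_gt0.
have b0 : 0 < b by rewrite !mulr_gt0// addr_gt0// mulr_gt0.
have X0 : (0 <= X)%E by exact: integral_ge0.
rewrite /neg_power opprK.
have c0 : 0 < a `^ (1 - gamma) * b `^ gamma by rewrite mulr_gt0 ?powR_gt0.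
(* At delta = 0 [neg_power] is +oo and the right side is infinite, since a and b are positive. *)
have [-> _ _|d0] := eqVneq delta 0.
  by rewrite normr0 powR0 ?gt_eqF// inve0 gt0_muley ?leey ?lte_fin.
have d0' : 0 < `|delta| by rewrite normr_gt0.
rewrite inver gt_eqF ?powR_gt0// -EFinM => Xb Xa.
have Xfin : X \is a fin_num by rewrite ge0_fin_numE// (le_lt_trans Xa) ?ltry.
move: Xa Xb X0; rewrite -(fineK Xfin) -EFinM !lee_fin; set x := fine X => xa xb x0.
have [->|xn0] := eqVneq x 0; first by rewrite !mulr_ge0 ?invr_ge0 ?powR_ge0.
have x0' : 0 < x by rewrite lt_neqAle eq_sym xn0.
have -> : x = x `^ (1 - gamma) * x `^ gamma.
  by rewrite -powRD ?subrK ?powRr1//; apply/implyP => _.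
rewrite -mulrA ler_pM ?powR_ge0//.
  by apply: ge0_ler_powR; rewrite ?nnegrE ?subr_ge0// ltW.
rewrite ler_pdivlMr ?powR_gt0// -powRM//.
rewrite mulrC; apply: ge0_ler_powR; rewrite ?nnegrE ?(ltW g0) ?(ltW b0)//.
exact: mulr_ge0.
Qed.

End kinetic_averages.

(** * Transport along the path *)

Section measure_term.
Context {R : realType}.
Local Notation mu := (@lebesgue_measure R).
Variables (M0 B : R) (B_gt0 : 0 < B).
Variables (phi dphi P P1 : R -> R) (nP nP1 : R).
Hypotheses (hphi : bounded_support M0 B phi) (hdphi : bounded_support M0 B dphi).
Hypotheses (hP : periodic_kernel P nP) (hP1 : periodic_kernel P1 nP1).
Variable (K : set R).
Hypotheses (mK : measurable K) (phiK : forall v, ~ K v -> phi v = 0)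
  (dphiK : forall v, ~ K v -> dphi v = 0).
Variables (T N eta W : R) (w : R -> R).
Hypotheses (N0 : 0 <= N) (eta0 : 0 <= eta) (mw : measurable_fun setT w)
  (wW : forall r, `|w r| <= W)
  (wN : forall r t, r \in `[0, T] -> t \in `[0, T] -> `|w t - w r| <= N * `|t - r| `^ eta).
Variable nu : {finite_measure set (R * R * R)%type -> \bar R}.

(** At z = ((r, x), v) this is the derivative in v of [P (y - x - v * (w t - w r)) * phi v], with P1
    in the place of P'. *)
Definition transported_derivative (t y : R) (z : R * R * R) : R :=
  P (y - z.1.2 - z.2 * (w t - w z.1.1)) * dphi z.2
  - (w t - w z.1.1) * P1 (y - z.1.2 - z.2 * (w t - w z.1.1)) * phi z.2.

Let h := transported_derivative.

(** Velocities are restricted to K, where the mass of m is measured; the integrand vanishes outside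
    K because [phi] and [dphi] do. *)
Definition time_slab (e t : R) : set (R * R * R) :=
  [set z | t - e <= z.1.1 <= t] `&` (`[0, T] `*` `[0, 1[ `*` K).

Let mE : measurable (`[0%R, T]%classic `*` `[0%R, 1%R[%classic `*` K : set (R * R * R)).
Proof.
by apply: measurableX mK; apply: measurableX; exact: measurable_itv.
Qed.

Let mslab0 e t : measurable [set z : R * R * R | t - e <= z.1.1 <= t].
Proof.
have mb : measurable_fun [set: R * R * R] (fun z : R * R * R => t - e <= z.1.1 <= t).
  by apply: measurable_and; apply: measurable_fun_ler; meas.
by have := mb measurableT [set true] I; rewrite setTI.
Qed.

Lemma measurable_time_slab e t : measurable (time_slab e t).
Proof. exact: measurableI. Qed.

Let mP : measurable_fun setT P.
Proof. by have [c _ _] := hP; exact: continuous_measurable_fun. Qed.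
Let mP1 : measurable_fun setT P1.
Proof. by have [c _ _] := hP1; exact: continuous_measurable_fun. Qed.
Let mphi : measurable_fun setT phi.
Proof. by have [c _ _] := hphi; exact: continuous_measurable_fun. Qed.
Let mdphi : measurable_fun setT dphi.
Proof. by have [c _ _] := hdphi; exact: continuous_measurable_fun. Qed.

Let mh t : measurable_fun [set: R * (R * R * R)] (fun z : R * (R * R * R) => h t z.1 z.2).
Proof. by rewrite /h /transported_derivative; meas. Qed.

Let mh1 t y : measurable_fun [set: R * R * R] (h t y).
Proof. by rewrite /h /transported_derivative; meas. Qed.

Let hK t y z : ~ K z.2 -> h t y z = 0.
Proof. by move=> nK; rewrite /h /transported_derivative phiK// dphiK// !mulr0 subrr. Qed.

Let ih t y D : measurable D -> nu.-integrable D (EFin \o h t y).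
Proof.
move=> mD; have [cP Pper _] := hP; have [cP1 P1per _] := hP1.
have [C C0 PC] := continuous_periodic_bounded cP Pper.
have [C1 C10 P1C] := continuous_periodic_bounded cP1 P1per.
have [_ _ phiB] := hphi; have [_ _ dphiB] := hdphi.
apply: measurable_bounded_integrable => //.
- have := fin_num_measure nu D mD.
  by rewrite fin_num_abs => /(le_lt_trans (lee_abs _)).
- exact: measurable_funTS.
exists `|C * B + (W + W) * C1 * B|; split; first exact: num_real.
move=> c Cc z _ /=; apply: ltW; apply: le_lt_trans Cc; apply: le_trans (ler_norm _).
rewrite /h /transported_derivative (le_trans (ler_normB _ _))//.
rewrite lerD// !normrM; first by rewrite ler_pM.
rewrite ler_pM ?mulr_ge0// ler_pM//.
by rewrite (le_trans (ler_normB _ _))// lerD.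
Qed.

(** The difference is an integral over the times in ]r, t], which lie in the slab as t - e <= r. The
    resulting bound does not depend on r, so that it passes through the later average over r. *)
Lemma measure_term_increment (r t e y : R) : 0 <= r -> r <= t -> t <= T -> t - e <= r ->
  (`|Rintegral nu (`[0, t] `*` `[0, 1[ `*` setT) (transported_derivative t y) -
     Rintegral nu (`[0, r] `*` `[0, 1[ `*` setT) (transported_derivative t y)|%:E
   <= \int[nu]_(z in time_slab e t) `|transported_derivative t y z|%:E)%E.
Proof.
move=> r0 rt tT er; rewrite -/h.
have mI b0 b1 (x1 x2 : R) : measurable
    ([set` Interval (BSide b0 x1) (BSide b1 x2)]%classic `*` `[0%R, 1%R[%classic `*` [set: R]
    : set (R * R * R)).
  apply: measurableX; last exact: measurableT.
  by apply: measurableX; exact: measurable_itv.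
have -> : `[0, t] `*` `[0 : R, 1[ `*` [set: R] =
    (`[0, r] `*` `[0 : R, 1[ `*` [set: R]) `|` (`]r, t] `*` `[0 : R, 1[ `*` [set: R]).
  apply/seteqP; split => -[[s x] v] /=; rewrite !in_itv/=.
    move=> [[/andP[s0 st] x01] _]; rewrite s0 st x01/=.
    by case: (leP s r) => sr; [left|right]; rewrite ?sr.
  move=> [[[/andP[s0 sr] x01] _]|[[/andP[rs st] x01] _]]; rewrite x01.
    by rewrite s0 (le_trans sr rt).
  by rewrite (le_trans r0 (ltW rs)) st.
rewrite Rintegral_setU//; first last.
- rewrite disj_set2E; apply/disj_setPS => -[[s x] v] /=; rewrite !in_itv/=.
  by move=> [[[/andP[_ sr] _] _] [[/andP[rs _] _] _]]; move: (lt_le_trans rs sr); rewrite ltxx.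
- by apply: ih; apply: measurableU.
rewrite addrAC subrr add0r EFin_normr_Rintegral//; last exact: ih.
have mih : measurable_fun (`]r, t] `*` `[0 : R, 1[ `*` [set: R]) (EFin \o h t y).
  by apply/measurable_EFinP; exact: (measurable_funTS (mh1 t y)).
apply: (le_trans (le_abse_integral nu (mI false false r t) mih)).
rewrite integral_mkcond [leRHS]integral_mkcond; apply: ge0_le_integral_nomeas => z _.
  by rewrite /patch; case: ifP.
rewrite /patch; case: ifPn => [/set_mem zin|_] /=; last by case: ifP => // _; rewrite lee_fin.
have [Kz|nKz] := pselect (K z.2); last by rewrite hK// normr0; case: ifP.
rewrite mem_set// /time_slab; move: zin => /=; rewrite !in_itv/= => -[[/andP[rs st] x01] _].
split; first by rewrite st (le_trans er (ltW rs)).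
by split => //; split => //; rewrite (le_trans r0 (ltW rs)) (le_trans st tT).
Qed.

Lemma measurable_measure_term (t e : R) :
  measurable_fun [set: R]
    (fun y => \int[nu]_(z in time_slab e t) `|transported_derivative t y z|%:E)%E.
Proof.
apply: (@measurable_integral_param _ _ _ _ _ nu _
  (fun z : R * (R * R * R) => `|h t z.1 z.2|%:E)) => //; first exact: measurable_time_slab.
by apply/measurable_EFinP; apply: measurable_fctnorm; exact: (mh t).
Qed.

(** For fixed z, integrating in y removes the translation, leaving the L^1 bounds of P and P1. In
    the slab the path increment in front of P1 is at most N e^eta. *)
Lemma integral_measure_term (t e : R) : t \in `[0, T] -> 0 <= e ->
  (\int[mu]_(y in `[0%R, 1%R[) \int[nu]_(z in time_slab e t)
      `|transported_derivative t y z|%:E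
   <= (B * nP + N * e `^ eta * B * nP1)%:E * nu (time_slab e t))%E.
Proof.
move=> tT e0; rewrite -/h; have B0 := ltW B_gt0.
have [_ _ phiB] := hphi; have [_ _ dphiB] := hdphi.
have ms := measurable_time_slab e t.
rewrite (@tonelli_on _ _ _ _ _ mu nu _ _ (fun z : R * (R * R * R) => `|h t z.1 z.2|%:E))//;
  last first.
  by apply/measurable_EFinP; apply: measurable_fctnorm; exact: (mh t).
rewrite -integral_cst//; apply: ge0_le_integral_nomeas => z; first by move=> _; exact: integral_ge0.
move=> [/=/andP[ez zt] [[zT _] _]].
set d := w t - w z.1.1; set c := - z.1.2 - z.2 * d.
have dN : `|d| <= N * e `^ eta.
  apply: le_trans (wN zT tT) _; apply: ler_wpM2l => //.
  apply: ge0_ler_powR; rewrite ?nnegrE// ger0_norm ?subr_ge0//.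
  by rewrite lerBlDr -lerBlDl.
apply: (@le_trans _ _ (\int[mu]_(y in `[0%R, 1%R[)
    ((B * `|P (y + c)|)%:E + (`|d| * B * `|P1 (y + c)|)%:E))%E).
  apply: ge0_le_integral_nomeas => y _ //.
  rewrite -EFinD lee_fin /h /transported_derivative -/d.
  have -> : y - z.1.2 - z.2 * d = y + c by rewrite /c addrA.
  rewrite (le_trans (ler_normB _ _))// !normrM lerD//.
    by rewrite mulrC ler_wpM2r.
  by rewrite -[leRHS]mulrA [B * _]mulrC mulrA ler_wpM2l ?mulr_ge0.
rewrite ge0_integralD//=; first last.
- by apply/measurable_EFinP/measurable_funTS; meas.
- by move=> y _; rewrite lee_fin !mulr_ge0.
- by apply/measurable_EFinP/measurable_funTS; meas.
- by move=> y _; rewrite lee_fin mulr_ge0.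
rewrite EFinD leeD//.
  under eq_integral do rewrite EFinM.
  rewrite ge0_integralZl_EFin//=; last first.
    by apply/measurable_EFinP/measurable_funTS; meas.
  by rewrite [leRHS]EFinM lee_pmul2l//; exact: integral_kernel_shift hP.
under eq_integral do rewrite EFinM.
rewrite ge0_integralZl_EFin ?mulr_ge0//=; last first.
  by apply/measurable_EFinP/measurable_funTS; meas.
rewrite [leRHS]EFinM; apply: lee_pmul => //.
- by rewrite lee_fin mulr_ge0.
- exact: integral_ge0.
- by rewrite lee_fin ler_wpM2r.
- exact: integral_kernel_shift hP1.
Qed.

Let slab_fun e (z : R * (R * R * R)) : R := if z.1 - e <= z.2.1.1 <= z.1 then 1 else 0.

Let slab_fun_ge0 e z : (0 <= (slab_fun e z)%:E)%E.
Proof. by rewrite lee_fin /slab_fun; case: ifP. Qed.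

Let measurable_slab_fun e :
  measurable_fun [set: R * (R * R * R)] (fun z => (slab_fun e z)%:E).
Proof.
apply/measurable_EFinP; apply: measurable_if; [|exact: measurable_fctC|exact: measurable_fctC].
by apply: measurable_and; apply: measurable_fun_ler; meas.
Qed.

Let time_slabE e t : (nu (time_slab e t) =
  \int[nu]_(z in `[0%R, T]%classic `*` `[0%R, 1%R[%classic `*` K) (slab_fun e (t, z))%:E)%E.
Proof.
rewrite -(integral_indic nu mE (mslab0 e t)); apply: eq_integral => z _.
rewrite /indic /slab_fun/=; congr EFin; case: ifPn => hz; first by rewrite mem_set.
by rewrite memNset//; apply/negP.
Qed.

Lemma measurable_time_slab_mass e :
  measurable_fun [set: R] (fun t => nu (time_slab e t)).
Proof.
apply: eq_measurable_fun (measurable_integral_param nu mE (measurable_slab_fun e)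
  (slab_fun_ge0 e)) => t _.
by rewrite time_slabE.
Qed.

(** A point at time r lies in the slabs of those t with r <= t <= r + e, a set of length e; Tonelli
    does the rest. *)
Lemma integral_time_slab (a b e : R) : 0 <= e ->
  (\int[mu]_(t in `[a, b]) nu (time_slab e t) <=
   e%:E * nu (`[0%R, T]%classic `*` `[0%R, 1%R[%classic `*` K))%E.
Proof.
move=> e0; under eq_integral do rewrite time_slabE.
rewrite (@tonelli_on _ _ _ _ _ mu nu _ _ (fun z => (slab_fun e z)%:E))//;
  last exact: measurable_slab_fun.
rewrite -integral_cst//; apply: ge0_le_integral_nomeas => z _; first exact: integral_ge0.
apply: (@le_trans _ _ (\int[mu]_(t in `[z.1.1, (z.1.1 + e)%R]) 1%:E)%E).
  rewrite integral_mkcond [leRHS]integral_mkcond; apply: ge0_le_integral_nomeas => t _.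
    by rewrite /patch; case: ifP.
  rewrite /patch; case: ifPn => _; last by case: ifP.
  rewrite /slab_fun mem_setE in_itv/=.
  by rewrite lerBlDr andbC; case: ifP.
rewrite integral_cst//= mul1e lebesgue_measure_itv/=; case: ifPn => _.
  by rewrite -EFinB lee_fin addrAC subrr add0r.
by rewrite lee_fin.
Qed.

End measure_term.

(** * Negative moments of the path increments *)

Section path_average.
Context {R : realType}.
Local Notation mu := (@lebesgue_measure R).
Variables (T iota : R) (Calpha : R -> R) (w wc : R -> R).
Hypotheses (mw : measurable_fun setT wc) (wcE : forall r, r \in `[0, T] -> wc r = w r).
Hypothesis path : path_irregular T iota Calpha w.

(** The exponential replaces the indicator of [t - e, t], up to a factor expR 1. *)
Definition path_weight (gamma e : R) (z : R * R) : \bar R :=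
  if z.2 <= z.1 then
    ((expR (- (e^-1 * (z.1 - z.2))))%:E * neg_power (wc z.1 - wc z.2) (- gamma))%E
  else 0%E.

Lemma neg_power_ge0 (x al : R) : (0 <= neg_power x al)%E.
Proof. by rewrite /neg_power inve_ge0 lee_fin powR_ge0. Qed.

Lemma path_weight_ge0 gamma e z : (0 <= path_weight gamma e z)%E.
Proof.
rewrite /path_weight; case: ifP => // _.
by rewrite mule_ge0 ?neg_power_ge0// lee_fin expR_ge0.
Qed.

Lemma measurable_neg_power (al : R) : measurable_fun [set: R] (fun x => neg_power x al).
Proof.
have E x : neg_power x al = if `|x| `^ (- al) == 0 then +oo%E else ((`|x| `^ (- al))^-1)%:E.
  by rewrite /neg_power inver.
have mp : measurable_fun [set: R] (fun x : R => `|x| `^ (- al)).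
  apply: (measurableT_comp (f := (fun x : R => x `^ (- al)))); first exact: measurable_powR.
  exact: normr_measurable.
rewrite (_ : (fun x => neg_power x al) = fun x : R => if `|x| `^ (- al) == 0 then +oo%E
  else (`|x| `^ (- al) `^ (-1))%:E); last first.
  by apply/funext => x; rewrite E; case: ifP => // _; rewrite powR_inv1// powR_ge0.
apply: measurable_fun_ifT.
- by apply: measurable_fun_eqr => //; exact: measurable_fctC.
- exact: measurable_cst.
- apply/measurable_EFinP.
  by apply: (measurableT_comp (f := (fun x : R => x `^ (- 1)))); first exact: measurable_powR.
Qed.

Lemma measurable_path_weight gamma e : measurable_fun [set: R * R] (path_weight gamma e).
Proof.
apply: measurable_fun_ifT.
- by apply: measurable_fun_ler; meas.
- apply: emeasurable_funM; first by apply/measurable_EFinP; meas.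
  apply: (measurableT_comp (f := (fun x => neg_power x (- gamma)))).
    exact: measurable_neg_power.
  by meas.
- exact: measurable_cst.
Qed.

(** For fixed r the weight vanishes when t < r, and the shift t -> t + r brings [r, T] to
    [0, T - r]: this is the irregularity hypothesis at alpha = - gamma, where (1 / e)^(-1 + iota
    gamma) = e^(1 - iota gamma). *)
Lemma integral_path_weight gamma e : 0 < gamma < 1 -> 0 < e <= 1 ->
  (\int[mu]_(t in `[0%R, T]) \int[mu]_(r in `[0%R, T]) path_weight gamma e (t, r)
   <= (Calpha (- gamma) * e `^ (1 - iota * gamma))%:E)%E.
Proof.
move=> /andP[g0 g1] /andP[e0 e1].
have [|C0 ir] := path (alpha := - gamma); first by rewrite ltrN2 g1 oppr_lt0 g0.
have mpw := measurable_path_weight gamma e.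
have pw0 := path_weight_ge0 gamma e.
rewrite (@tonelli_on _ _ _ _ _ mu mu _ _ _ (measurable_itv _) (measurable_itv _) mpw pw0).
have := ir e^-1; rewrite invf_ge1// => /(_ e1).
have -> : e^-1 `^ (-1 - iota * - gamma) = e `^ (1 - iota * gamma).
  by rewrite -powR_inv1 ?(ltW e0)// -powRrM; congr (_ `^ _); ring.
apply: le_trans.
apply: ge0_le_integral_nomeas => r /= rT; first exact: integral_ge0.
move: (rT); rewrite in_itv/= => /andP[r0 rT'].
pose g t : \bar R := path_weight gamma e (t, r).
have mg : measurable_fun [set: R] g by exact: (measurable_fun_pair1 r mpw).
apply: (@le_trans _ _ (\int[mu]_(t in `[(0 + r)%R, (T - r + r)%R]) g t)%E).
  rewrite add0r subrK integral_mkcond [leRHS]integral_mkcond.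
  apply: ge0_le_integral_nomeas => t _; first by rewrite /patch; case: ifP.
  rewrite /patch !mem_setE !in_itv/=.
  case: ifPn => [/andP[t0 tT]|_]; last first.
    by case: ifP => // _; exact: path_weight_ge0.
  case: ifPn => //; rewrite tT andbT => /negbTE rt.
  by rewrite /path_weight/= rt.
rewrite -ge0_integral_shift_itv//; last by move=> t; exact: path_weight_ge0.
apply: ge0_le_integral_nomeas => t /=; first by move=> _; exact: path_weight_ge0.
rewrite in_itv/= => /andP[t0 tTr].
rewrite /g /path_weight/= lerDr t0 addrK wcE; last first.
  by rewrite in_itv/= addr_ge0//= -lerBrDr.
by rewrite (wcE rT) (addrC t r).
Qed.

End path_average.

(** * Estimate of a single kernel average over time *)

Section kernel_estimate.
Context {R : realType}.
Local Notation mu := (@lebesgue_measure R).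
Variables (M0 B : R) (M0_gt0 : 0 < M0) (B_gt0 : 0 < B).
Variables (phi dphi : R -> R).
Hypotheses (hphi : bounded_support M0 B phi) (hdphi : bounded_support M0 B dphi)
  (phiE : forall v, is_derive v (1 : R) phi (dphi v)) (sphi : smooth phi).
Variables (P Q P1 : R -> R) (nP nQ nP1 : R).
Hypotheses (hP : periodic_kernel P nP) (hQ : periodic_kernel Q nQ)
  (hP1 : periodic_kernel P1 nP1) (nP0 : 0 < nP) (nQ0 : 0 < nQ) (nP10 : 0 < nP1).
Hypotheses (QE : forall z, is_derive z (1 : R) Q (P z))
  (PE : forall z, is_derive z (1 : R) P (P1 z)).
Hypothesis sP : forall n a b c, Ck n (fun z : R * R => P (a + b * z.1 + c * z.2)).
Variable (K : set R).
Hypotheses (mK : measurable K) (phiK : forall v, ~ K v -> phi v = 0)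
  (dphiK : forall v, ~ K v -> dphi v = 0).
Variables (T N eta iota : R) (Calpha : R -> R) (w wc : R -> R).
Hypotheses (N0 : 0 <= N) (eta0 : 0 <= eta) (mw : measurable_fun setT wc)
  (wW : forall r, `|wc r| <= N) (wcE : forall r, r \in `[0, T] -> wc r = w r)
  (wN : forall r t, r \in `[0, T] -> t \in `[0, T] -> `|wc t - wc r| <= N * `|t - r| `^ eta).
Hypothesis path : path_irregular T iota Calpha w.
Variables (u0 : R -> R) (u : R -> R -> R) (m : {charge set (R * R * R)%type -> \bar R}).
Hypothesis qs : quasi_solution T w u0 u m.
Hypothesis mu_t : forall t, t \in `[0, T] -> measurable_fun setT (u t).

Let nup : {finite_measure set (R * R * R)%type -> \bar R} := jordan_pos (hahnPN m).
Let nun : {finite_measure set (R * R * R)%type -> \bar R} := jordan_neg (hahnPN m).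
Let td := transported_derivative phi dphi P P1 wc.
Let slab := time_slab K T.

(** The test function depends on t: transported to time r it becomes
    [P (y - x - v * (w t - w r)) * phi v], so that at r = t the path disappears. *)
Lemma test_function_smooth (t y : R) :
  Cc_smooth_torus (fun z : R * R => P (y - z.1 - z.2 * w t) * phi z.2).
Proof.
have [_ Pper _] := hP; have [_ phi0 _] := hphi.
split.
- move=> n; apply: CkM; last exact/Ck_comp_snd/sphi.
  have := sP n y (-1) (- w t); congr (Ck n _); apply/funext => z.
  by congr P; ring.
- move=> x v /=; congr (_ * _); rewrite -(Pper (y - (x + 1) - _)); congr P; ring.
- by exists M0 => x v /= /phi0 ->; rewrite mulr0.
Qed.

Lemma transported_derivativeE (t y : R) (z : R * R * R) : t \in `[0, T] ->
  z.1.1 \in `[0, T] ->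
  derive1 (fun v : R => P (y - (z.1.2 - v * w z.1.1) - v * w t) * phi v) z.2 = td t y z.
Proof.
move=> tT zT; rewrite derive1E.
pose d := wc t - wc z.1.1.
have da : is_derive z.2 (1 : R) (fun v : R => y - z.1.2 - v * d) (- d).
  apply: (is_derive_rew (is_derive_fctB (is_derive_fctC (y - z.1.2) _ _)
    (is_derive_fctM (is_derive_id z.2 1) (is_derive_fctC d _ _)))).
  by ring.
have dPa : is_derive z.2 (1 : R) (fun v => P (y - z.1.2 - v * d))
    (- d * P1 (y - z.1.2 - z.2 * d)).
  by have := @is_derive1_comp _ P _ z.2 _ _ (PE (y - z.1.2 - z.2 * d)) da; rewrite mulrC.
rewrite (_ : (fun v => _) = fun v => P (y - z.1.2 - v * d) * phi v); last first.
  by apply/funext => v; rewrite /d !wcE//; congr (P _ * _); ring.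
have := is_derive_fctM dPa (phiE z.2).
move=> /@derive_val ->; rewrite /td /transported_derivative -/d; ring.
Qed.

(** The weak formulation is used at times t and r with the same test function, and the initial
    terms, both equal to F0, cancel. *)
Lemma quasi_solution_increment (r t e y : R) : 0 <= r -> r <= t -> t <= T -> t - e <= r ->
  (`|kinetic_average phi P 0 (u t) y|%:E <=
   `|kinetic_average phi P (wc t - wc r) (u r) y|%:E +
   (\int[nup]_(z in slab e t) `|td t y z|%:E +
    \int[nun]_(z in slab e t) `|td t y z|%:E))%E.
Proof.
move=> r0 rt tT er.
have t0 : 0 <= t := le_trans r0 rt; have rT : r <= T := le_trans rt tT.
have tin : t \in `[0, T] by rewrite in_itv/= t0.
have rin : r \in `[0, T] by rewrite in_itv/= r0.
have [_ _ weak] := qs; have test := test_function_smooth t y.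
have ciE x : x \in `[0, T] -> charge_integral m (`[0, x] `*` `[0, 1[ `*` setT)
    (fun z => derive1 (fun v : R => P (y - (z.1.2 - v * w z.1.1) - v * w t) * phi v) z.2) =
    Rintegral nup (`[0, x] `*` `[0, 1[ `*` setT) (td t y) -
    Rintegral nun (`[0, x] `*` `[0, 1[ `*` setT) (td t y).
  rewrite in_itv/= => /andP[x0 xT]; rewrite /charge_integral.
  have E : {in `[0, x] `*` `[0, 1[ `*` [set: R], (fun z : R * R * R =>
      derive1 (fun v : R => P (y - (z.1.2 - v * w z.1.1) - v * w t) * phi v) z.2) =1 td t y}.
    move=> z /set_mem [[/=]]; rewrite in_itv/= => /andP[z0 zx] _ _.
    by apply: transported_derivativeE; rewrite // in_itv/= z0 (le_trans zx xT).
  by congr (_ - _); exact: eq_Rintegral.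
have := weak _ t test tin; have := weak _ r test rin; rewrite !ciE//.
pose F0 := \int[(mu \x mu)%E]_(z in `[0, 1[ `*` setT)
  (chi (u0 z.1) z.2 * (P (y - z.1 - z.2 * w t) * phi z.2)).
set Ip := fun x => Rintegral nup (`[0, x] `*` `[0, 1[ `*` setT) (td t y).
set In := fun x => Rintegral nun (`[0, x] `*` `[0, 1[ `*` setT) (td t y).
rewrite -/(Ip r) -/(Ip t) -/(In r) -/(In t) => Er Et.
have {}Et : kinetic_average phi P 0 (u t) y = F0 - (Ip t - In t).
  apply: (etrans _ Et); apply: eq_Rintegral => z _ /=;
    congr (_ * (P _ * _)); ring.
have {}Er : kinetic_average phi P (wc t - wc r) (u r) y = F0 - (Ip r - In r).
  apply: (etrans _ Er); apply: eq_Rintegral => z _ /=;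
    rewrite !wcE//; congr (_ * (P _ * _)); ring.
have dp := measure_term_increment hphi hdphi hP hP1 phiK dphiK mw wW nup y r0 rt tT er.
have dn := measure_term_increment hphi hdphi hP hP1 phiK dphiK mw wW nun y r0 rt tT er.
apply: le_trans (leeD (lexx _) (leeD dp dn)).
rewrite -!EFinD lee_fin Et Er.
have -> : F0 - (Ip t - In t) = F0 - (Ip r - In r) + (- (Ip t - Ip r) + (In t - In r)) by ring.
rewrite (le_trans (ler_normD _ _))// lerD2l (le_trans (ler_normD _ _))//.
by rewrite normrN.
Qed.

Let cA gamma : R := (2 * M0 * B * nP) `^ (1 - gamma) * ((2 + 2 * M0) * B * nQ) `^ gamma.
Let cM e : R := B * nP + N * e `^ eta * B * nP1.

Let cM_ge0 e : 0 <= cM e.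
Proof.
have B0 := ltW B_gt0; rewrite /cM addr_ge0// ?mulr_ge0 ?powR_ge0// ltW//.
Qed.

(** The interpolated bound carries the negative power of the increment without an exponential; since
    t - r <= e, the product of [expR 1] and the exponential in [path_weight] is at least 1. *)
Lemma kinetic_average_slice (gamma e r t : R) : 0 < gamma < 1 -> 0 < e ->
  0 <= r -> r <= t -> t <= T -> t - e <= r ->
  (\int[mu]_(y in `[0%R, 1%R[) `|kinetic_average phi P 0 (u t) y|%:E <=
   (cA gamma * expR 1)%:E * path_weight wc gamma e (t, r) +
   (cM e)%:E * (nup (slab e t) + nun (slab e t)))%E.
Proof.
move=> g01 e0 r0 rt tT er.
have t0 : 0 <= t := le_trans r0 rt; have rT : r <= T := le_trans rt tT.
have tin : t \in `[0, T] by rewrite in_itv/= t0.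
have rin : r \in `[0, T] by rewrite in_itv/= r0.
have mp := measurable_measure_term hphi hdphi hP hP1 mK T mw nup t e.
have mn := measurable_measure_term hphi hdphi hP hP1 mK T mw nun t e.
have mk := measurable_kinetic_average hphi hP (wc t - wc r) (mu_t rin).
have mk' : measurable_fun (`[0, 1[ : set R)
    (fun y : R => `|kinetic_average phi P (wc t - wc r) (u r) y|%:E).
  by apply/measurable_EFinP; apply: measurable_funTS; exact: measurable_fctnorm.
apply: (@le_trans _ _ (\int[mu]_(y in `[0%R, 1%R[)
   (`|kinetic_average phi P (wc t - wc r) (u r) y|%:E +
   (\int[nup]_(z in slab e t) `|td t y z|%:E +
    \int[nun]_(z in slab e t) `|td t y z|%:E)))%E).
  by apply: ge0_le_integral_nomeas => y _ //; exact: quasi_solution_increment.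
rewrite ge0_integralD//=; first last.
- exact: (measurable_funTS (emeasurable_funD mp mn)).
- by move=> y _; rewrite adde_ge0//; exact: integral_ge0.
apply: leeD.
  apply: le_trans (integral_kinetic_average_interp M0_gt0 B_gt0 hphi hdphi phiE hP hQ QE
    (wc t - wc r) g01 nP0 nQ0 (mu_t rin)) _.
  rewrite -/(cA gamma) [(cA gamma * expR 1)%:E]EFinM -muleA.
  apply: lee_wpmul2l; first by rewrite lee_fin mulr_ge0 ?powR_ge0.
  rewrite /path_weight/= rt muleA -EFinM -expRD -[leLHS]mul1e.
  apply: lee_wpmul2r; first exact: neg_power_ge0.
  rewrite lee_fin -[leLHS]expR0 ler_expR subr_ge0 ler_pdivrMl// mulr1.
  by rewrite lerBlDr -lerBlDl.
rewrite ge0_integralD//=; first last.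
- exact: (measurable_funTS mn).
- by move=> y _; exact: integral_ge0.
- exact: (measurable_funTS mp).
- by move=> y _; exact: integral_ge0.
rewrite ge0_muleDr; [|exact: measure_ge0|exact: measure_ge0].
have e0' := ltW e0.
apply: leeD.
- exact: (integral_measure_term B_gt0 hphi hdphi hP hP1 mK N0 eta0 mw wN nup tin e0').
- exact: (integral_measure_term B_gt0 hphi hdphi hP hP1 mK N0 eta0 mw wN nun tin e0').
Qed.

(** The left side of the slice bound does not contain r, so it may be averaged over r in [t - e, t];
    this costs the factor 1 / e in front of the path weight, and e <= a keeps these times
    nonnegative. The integral over t then uses the irregularity of the path and the factor e gained
    from the slabs. *)
Lemma kinetic_average_time_estimate (gamma e a b M : R) : 0 < gamma < 1 -> 0 < e <= 1 ->
  e <= a -> b <= T -> kinetic_mass T m K = M%:E ->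
  (\int[mu]_(t in `[a, b]) \int[mu]_(y in `[0%R, 1%R[)
      `|kinetic_average phi P 0 (u t) y|%:E <=
   (cA gamma * expR 1 * Calpha (- gamma) * e `^ (- (iota * gamma)) + cM e * e * M)%:E)%E.
Proof.
move=> g01 e01 ea bT mM; have /andP[e0 e1] := e01; have e0' := ltW e0.
have cA0 : 0 <= cA gamma * expR 1 by rewrite !mulr_ge0 ?powR_ge0 ?expR_ge0.
have k0 : 0 <= e^-1 * (cA gamma * expR 1) by rewrite mulr_ge0 ?invr_ge0.
have pw0 z := path_weight_ge0 wc gamma e z.
have mpw := measurable_path_weight mw gamma e.
pose I1 t := (\int[mu]_(r in `[0%R, T]) path_weight wc gamma e (t, r))%E.
pose I2 t := (nup (slab e t) + nun (slab e t))%E.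
have I10 t : (0 <= I1 t)%E by exact: integral_ge0.
have I20 t : (0 <= I2 t)%E by rewrite adde_ge0.
have mI1 : measurable_fun [set: R] I1 by exact: (measurable_integral_param mu (measurable_itv _)).
have mI2 : measurable_fun [set: R] I2.
  by apply: emeasurable_funD; exact: measurable_time_slab_mass.
have slice t : a <= t <= b -> (\int[mu]_(y in `[0%R, 1%R[)
      `|kinetic_average phi P 0 (u t) y|%:E <=
    (e^-1 * (cA gamma * expR 1))%:E * I1 t + (cM e)%:E * I2 t)%E.
  move=> /andP[at_ tb].
  have te : 0 <= t - e by rewrite subr_ge0 (le_trans ea).
  have tT : t <= T := le_trans tb bT.
  set A := integral _ _ _.
  have A0 : (0 <= A)%E by exact: integral_ge0.
  have mute : mu `[t - e, t]%classic = e%:E.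
    by rewrite lebesgue_measure_itv/= lte_fin ltrBlDr ltrDl e0 -EFinB opprB addrC subrK.
  (* Multiplied by e, the left side is the integral of a constant over [t - e, t]. *)
  rewrite -(@lee_pmul2l _ e%:E)//.
  have -> : (e%:E * A = \int[mu]_(r in `[(t - e)%R, t]) A)%E.
    by rewrite integral_cst//= mute muleC.
  apply: (@le_trans _ _ (\int[mu]_(r in `[(t - e)%R, t])
    ((cA gamma * expR 1)%:E * path_weight wc gamma e (t, r) + (cM e)%:E * I2 t))%E).
    apply: ge0_le_integral_nomeas => r //=; rewrite in_itv/= => /andP[er rt].
    by apply: kinetic_average_slice => //; exact: le_trans te er.
  have mpt : measurable_fun `[t - e, t] (fun r => path_weight wc gamma e (t, r)).
    by apply: measurable_funTS; exact: (measurable_fun_pair2 t mpw).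
  rewrite ge0_integralD//=; first last.
  - by move=> r _; rewrite mule_ge0 ?lee_fin.
  - by apply: emeasurable_funM => //.
  - by move=> r _; rewrite mule_ge0 ?lee_fin.
  rewrite ge0_integralZl_EFin//= integral_cst//= mute.
  rewrite [leRHS]ge0_muleDr ?mule_ge0 ?lee_fin ?cM_ge0 ?k0//.
  apply: leeD; last by rewrite muleC.
  rewrite muleA -EFinM mulrA divff ?gt_eqF// mul1r.
  apply: lee_wpmul2l; first by rewrite lee_fin.
  apply: ge0_subset_integral => //.
    by apply: measurable_funTS; exact: (measurable_fun_pair2 t mpw).
  move=> r /=; rewrite !in_itv/= => /andP[er rt].
  by rewrite (le_trans te er) (le_trans rt tT).
apply: (@le_trans _ _ (\int[mu]_(t in `[a, b])
    ((e^-1 * (cA gamma * expR 1))%:E * I1 t + (cM e)%:E * I2 t))%E).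
  apply: ge0_le_integral_nomeas => t /=; first by move=> _; exact: integral_ge0.
  by rewrite in_itv/=; exact: slice.
rewrite ge0_integralD//=; first last.
- by apply: emeasurable_funM => //; exact: (measurable_funTS mI2).
- by move=> t _; rewrite mule_ge0 ?lee_fin.
- by apply: emeasurable_funM => //; exact: (measurable_funTS mI1).
- by move=> t _; rewrite mule_ge0 ?lee_fin.
rewrite [leRHS]EFinD; apply: leeD.
  rewrite ge0_integralZl_EFin//=; last exact: (measurable_funTS mI1).
  apply: (@le_trans _ _ ((e^-1 * (cA gamma * expR 1))%:E *
      (Calpha (- gamma) * e `^ (1 - iota * gamma))%:E)%E).
    apply: lee_wpmul2l; first by rewrite lee_fin.
    apply: le_trans (integral_path_weight mw wcE path g01 e01).
    apply: ge0_subset_integral => //; first exact: (measurable_funTS mI1).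
    move=> t /=; rewrite !in_itv/= => /andP[at_ tb].
    by rewrite (le_trans e0' (le_trans ea at_)) (le_trans tb bT).
  rewrite -EFinM lee_fin le_eqVlt; apply/orP; left; apply/eqP.
  have -> : 1 - iota * gamma = - (iota * gamma) + 1 by rewrite addrC.
  rewrite powRD; last by apply/implyP => _; rewrite gt_eqF.
  rewrite powRr1//.
  by rewrite (_ : _ * (_ * _) = (e^-1 * e) * (cA gamma * expR 1 * Calpha (- gamma)
    * e `^ (- (iota * gamma)))); [rewrite mulVf ?gt_eqF// mul1r|ring].
rewrite ge0_integralZl_EFin//=; last exact: (measurable_funTS mI2).
rewrite -mulrA [leRHS]EFinM; apply: lee_wpmul2l; first by rewrite lee_fin.
rewrite /I2 ge0_integralD//=; first last.
- by apply: measurable_funTS; exact: measurable_time_slab_mass.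
- by apply: measurable_funTS; exact: measurable_time_slab_mass.
rewrite [leRHS]EFinM -mM /kinetic_mass /charge_tv /charge_variation ge0_muleDr//.
by apply: leeD; exact: integral_time_slab.
Qed.

End kernel_estimate.

(** * Decomposition of |D|^s *)

Section kernel_family.
Context {R : realType}.
Local Notation mu := (@lebesgue_measure R).

Definition radius (sigma : R) : R := expR (- expR sigma).

Lemma radius01 sigma : 0 < radius sigma < 1.
Proof. by rewrite /radius expR_gt0/= -expR0 ltr_expR oppr_lt0 expR_gt0. Qed.

(** The square root of the radius, which is the number k of the pointwise bounds on the
    derivatives. *)
Let halfradius (sigma : R) : R := expR (- (expR sigma / 2)).

Let halfradius01 sigma : 0 < halfradius sigma < 1.
Proof.
by rewrite /halfradius expR_gt0/= -[ltRHS]expR0 ltr_expR oppr_lt0 divr_gt0 ?expR_gt0.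
Qed.

Let radiusE sigma : radius sigma = halfradius sigma ^+ 2.
Proof. by rewrite /radius /halfradius expr2 -expRD; congr expR; lra. Qed.

(** From exp(-x) <= 1 / (1 + x) at x = exp sigma. The lower bound is at least x / 2 for sigma <= 0
    and at least 1 / 2 for sigma >= 0. *)
Let gap_ge (sigma : R) : expR sigma / (1 + expR sigma) <= 1 - radius sigma.
Proof.
have e0 : 0 < expR sigma by exact: expR_gt0.
have h : radius sigma <= (1 + expR sigma)^-1.
  rewrite /radius expRN lef_pV2 ?posrE ?expR_gt0 ?addr_gt0//; exact: expR_ge1Dx.
have -> : expR sigma / (1 + expR sigma) = 1 - (1 + expR sigma)^-1.
  by field; rewrite gt_eqF// addr_gt0.
by rewrite lerD2l lerN2.
Qed.

(** A common constant for three derivatives: 592 is the largest numerical factor in the pointwise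
    bounds, 8 = 2^3 comes from the factor 1 / 2 in the gap 1 - radius, and pi^3 dominates the lower
    powers of pi. *)
Definition kernel_const : R := 592 * 8 * pi ^+ 3.

Lemma kernel_const_gt0 : 0 < kernel_const.
Proof. by apply: mulr_gt0; [lra|apply: exprn_gt0; exact: pi_gt0]. Qed.

Let pi_pow_le i : (i <= 3)%N -> (pi : R) ^+ i <= pi ^+ 3.
Proof.
by move=> i3; apply: ler_weXn2l => //; apply: le_trans (@pi_ge2 R); rewrite ler1n.
Qed.

Let const_le (c : R) i j : 0 <= c <= 592 -> (i <= 3)%N -> (j <= 3)%N ->
  c * pi ^+ i * 2 ^+ j <= kernel_const.
Proof.
move=> /andP[c0 c1] i3 j3; rewrite /kernel_const mulrAC.
rewrite ler_pM ?mulr_ge0 ?exprn_ge0 ?pi_ge0//; last exact: pi_pow_le.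
rewrite ler_pM ?exprn_ge0//.
have -> : 8 = 2 ^+ 3 :> R by rewrite -natrX.
by apply: ler_weXn2l => //; rewrite ler1n.
Qed.

Let kernel_bound (f : R -> R) (c : R) (i j : nat) (sigma n : R) : continuous f ->
  (forall z, f (z + 1) = f z) -> 0 <= c <= 592 -> (i <= 3)%N -> (j <= 3)%N ->
  (forall z, `|f z| <= c * pi ^+ i * (halfradius sigma / (1 - radius sigma) ^+ j) *
    poisson (radius sigma) z) ->
  halfradius sigma / (1 - radius sigma) ^+ j <= 2 ^+ j * n -> 0 <= n ->
  periodic_kernel f (kernel_const * n).
Proof.
move=> cf fper c592 i3 j3 hf hn n0; split => //.
have /andP[r0 r1] := radius01 sigma; have /andP[k0 k1] := halfradius01 sigma.
apply: (@le_trans _ _ (c * pi ^+ i * (halfradius sigma / (1 - radius sigma) ^+ j))%:E).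
  apply: (poisson_majorant (radius01 sigma)) hf.
  case/andP: c592 => c0 _.
  by rewrite !mulr_ge0 ?exprn_ge0 ?pi_ge0 ?invr_ge0 ?exprn_ge0 ?subr_ge0 ?(ltW k0) ?(ltW r1).
rewrite lee_fin; apply: (@le_trans _ _ (c * pi ^+ i * (2 ^+ j * n))).
  by case/andP: c592 => c0 _; rewrite ler_wpM2l// mulr_ge0// exprn_ge0// pi_ge0.
by rewrite mulrA ler_wpM2r//; exact: const_le.
Qed.

Let gap_neg (sigma : R) j : sigma <= 0 ->
  halfradius sigma / (1 - radius sigma) ^+ j <= 2 ^+ j * expR (- (j%:R * sigma)).
Proof.
move=> s0; have /andP[r0 r1] := radius01 sigma; have /andP[k0 k1] := halfradius01 sigma.
have e0 : 0 < expR sigma by exact: expR_gt0.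
have e1 : expR sigma <= 1 by rewrite -expR0 ler_expR.
have d2 : expR sigma / 2 <= 1 - radius sigma.
  apply: le_trans (gap_ge sigma); rewrite ler_wpM2l ?(ltW e0)// lef_pV2 ?posrE ?addr_gt0//.
  by lra.
rewrite -[leRHS]mul1r ler_pM ?invr_ge0 ?exprn_ge0 ?subr_ge0 ?(ltW k0) ?(ltW r1) ?(ltW k1)//.
rewrite expRN mulrC -[2 ^+ j]invrK -invfM lef_pV2 ?posrE; last 2 first.
- by rewrite exprn_gt0// subr_gt0.
- by rewrite mulr_gt0 ?invr_gt0 ?exprn_gt0 ?expR_gt0.
rewrite mulrC expRM_natl -exprVn -exprMn.
by apply: lerXn2r; rewrite ?nnegrE ?subr_ge0 ?(ltW r1)// 1?mulrC.
Qed.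

(** For sigma >= 0 the gap is at least 1 / 2, and [halfradius] is kept in the bound instead of being
    replaced by 1: it supplies the decay of the kernels at large sigma. *)
Let gap_pos (sigma : R) j : 0 <= sigma ->
  halfradius sigma / (1 - radius sigma) ^+ j <= 2 ^+ j * expR (- (expR sigma / 2)).
Proof.
move=> s0; have /andP[r0 r1] := radius01 sigma; have /andP[k0 k1] := halfradius01 sigma.
have e1 : 1 <= expR sigma by rewrite -expR0 ler_expR.
have d2 : 2^-1 <= 1 - radius sigma.
  apply: le_trans (gap_ge sigma); rewrite ler_pdivlMr; last by lra.
  by lra.
rewrite mulrC -/(halfradius sigma) ler_wpM2r ?(ltW k0)//.
rewrite -[leRHS]invrK lef_pV2 ?posrE ?invr_gt0 ?exprn_gt0 ?subr_gt0//.
by rewrite -exprVn; apply: lerXn2r; rewrite ?nnegrE ?invr_ge0 ?subr_ge0 ?(ltW r1).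
Qed.

Let dpoissonB sigma z : `|dpoisson (radius sigma) z| <=
  4 * pi ^+ 1 * (halfradius sigma / (1 - radius sigma) ^+ 1) * poisson (radius sigma) z.
Proof.
have /andP[k0 k1] := halfradius01 sigma.
by rewrite !expr1; exact: (dpoisson_le k0 k1 (radiusE sigma)).
Qed.

Let d2poissonB sigma z : `|d2poisson (radius sigma) z| <=
  40 * pi ^+ 2 * (halfradius sigma / (1 - radius sigma) ^+ 2) * poisson (radius sigma) z.
Proof.
have /andP[k0 k1] := halfradius01 sigma.
exact: (d2poisson_le k0 k1 (radiusE sigma)).
Qed.

Let d3poissonB sigma z : `|d3poisson (radius sigma) z| <=
  592 * pi ^+ 3 * (halfradius sigma / (1 - radius sigma) ^+ 3) * poisson (radius sigma) z.
Proof.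
have /andP[k0 k1] := halfradius01 sigma.
exact: (d3poisson_le k0 k1 (radiusE sigma)).
Qed.

Lemma dpoisson_kernel sigma : sigma <= 0 ->
  periodic_kernel (dpoisson (radius sigma)) (kernel_const * expR (- (1%:R * sigma))).
Proof.
move=> s0; have r01 := radius01 sigma.
apply: (kernel_bound (continuous_dpoisson r01) (@dpoisson_periodic _ _) _ _ _
  (dpoissonB sigma) (gap_neg 1 s0)); rewrite ?expR_ge0//.
by apply/andP; split; lra.
Qed.

Lemma d2poisson_kernel sigma : sigma <= 0 ->
  periodic_kernel (d2poisson (radius sigma)) (kernel_const * expR (- (2%:R * sigma))).
Proof.
move=> s0; have r01 := radius01 sigma.
apply: (kernel_bound (continuous_d2poisson r01) (@d2poisson_periodic _ _) _ _ _
  (d2poissonB sigma) (gap_neg 2 s0)); rewrite ?expR_ge0//.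
by apply/andP; split; lra.
Qed.

Lemma d3poisson_kernel sigma : sigma <= 0 ->
  periodic_kernel (d3poisson (radius sigma)) (kernel_const * expR (- (3%:R * sigma))).
Proof.
move=> s0; have r01 := radius01 sigma.
apply: (kernel_bound (continuous_d3poisson r01) (@d3poisson_periodic _ _) _ _ _
  (d3poissonB sigma) (gap_neg 3 s0)); rewrite ?expR_ge0//.
by apply/andP; split; lra.
Qed.

Lemma d2poisson_kernel_large sigma : 0 <= sigma ->
  periodic_kernel (d2poisson (radius sigma)) (kernel_const * expR (- (expR sigma / 2))).
Proof.
move=> s0; have r01 := radius01 sigma.
apply: (kernel_bound (continuous_d2poisson r01) (@d2poisson_periodic _ _) _ _ _
  (d2poissonB sigma) (gap_pos 2 s0)); rewrite ?expR_ge0//.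
by apply/andP; split; lra.
Qed.

Lemma d2poisson_plane_smooth (r : R) n (a b c : R) : 0 < r < 1 ->
  Ck n (fun z : R * R => d2poisson r (a + b * z.1 + c * z.2)).
Proof.
move=> r01.
have [hc hs] := Ck_plane_cos_sin n (2 * pi * a) (2 * pi * b) (2 * pi * c).
have E (z : R * R) : 2 * pi * (a + b * z.1 + c * z.2) =
    2 * pi * a + 2 * pi * b * z.1 + 2 * pi * c * z.2 by ring.
have {}hc : Ck n (fun z : R * R => cos (2 * pi * (a + b * z.1 + c * z.2))).
  by have := hc; congr (Ck n _); apply/funext => z; rewrite E.
have {}hs : Ck n (fun z : R * R => sin (2 * pi * (a + b * z.1 + c * z.2))).
  by have := hs; congr (Ck n _); apply/funext => z; rewrite E.
have C (x : R) : Ck n (fun _ : R * R => x) by exact: Ck_cst.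
have hX m (f : R * R -> R) : Ck n f -> Ck n (fun z => f z ^+ m).
  move=> hf; elim: m => [|m IH]; first exact: C.
  rewrite (_ : (fun z => f z ^+ m.+1) = fun z => f z * f z ^+ m); first exact: CkM.
  by apply/funext => y; rewrite exprS.
have hD : Ck n (fun z : R * R => (pden r (a + b * z.1 + c * z.2))^-1).
  apply: CkV; first by move=> z; rewrite gt_eqF// pden_gt0.
  rewrite /pden; apply: CkD => //.
  rewrite (_ : (fun z => _) = fun z : R * R =>
    1 + (- (2 * r)) * cos (2 * pi * (a + b * z.1 + c * z.2))).
    by apply: CkD => //; exact: CkM.
  by apply/funext => z; rewrite mulNr.
rewrite /d2poisson; apply: CkM => //.
rewrite (_ : (fun z => _) = fun z : R * R =>
   32 * pi ^+ 2 * r ^+ 2 * sin (2 * pi * (a + b * z.1 + c * z.2)) ^+ 2 *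
   (pden r (a + b * z.1 + c * z.2))^-1 ^+ 3 +
   (- (8 * pi ^+ 2 * r)) * cos (2 * pi * (a + b * z.1 + c * z.2)) *
   (pden r (a + b * z.1 + c * z.2))^-1 ^+ 2); last by apply/funext => z; ring.
apply: CkD.
- by apply: CkM; [apply: CkM => //; exact: hX|exact: hX].
- by apply: CkM; [exact: CkM|exact: hX].
Qed.

End kernel_family.

(** * Fubini for real-valued integrals *)

Section integral_exchange.
Context {d1 d2 : measure_display} {T1 : measurableType d1} {T2 : measurableType d2}
  {R : realType}.
Variables (m1 : {sigma_finite_measure set T1 -> \bar R})
  (m2 : {sigma_finite_measure set T2 -> \bar R}).

Lemma integral_prod_on (D1 : set T1) (D2 : set T2) (f : T1 * T2 -> \bar R) :
  measurable D1 -> measurable D2 -> measurable_fun [set: T1 * T2] f ->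
  (forall z, (0 <= f z)%E) ->
  (\int[m1 \x m2]_(z in D1 `*` D2) f z =
   \int[m1]_(x in D1) \int[m2]_(y in D2) f (x, y))%E.
Proof.
move=> mD1 mD2 mf f0; have mD : measurable (D1 `*` D2) by exact: measurableX.
rewrite integral_mkcond (@fubini_tonelli1 _ _ _ _ _ m1 m2 (f \_ (D1 `*` D2))); first last.
- by move=> z; rewrite /patch; case: ifP.
- exact/(measurable_restrictT f mD)/measurable_funTS.
rewrite [RHS]integral_mkcond; apply: eq_integral => x _.
rewrite /fubini_F /patch; case: ifPn => xD1.
  rewrite [RHS]integral_mkcond; apply: eq_integral => y _.
  by rewrite /patch classical_sets.in_setX/= xD1.
by rewrite integral0_eq// => y _; rewrite classical_sets.in_setX/= (negbTE xD1).
Qed.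

(** A slice may fail to be integrable, in which case its real integral takes a default value; this
    happens only on a null set, off which the iterated real integrals agree with the extended
    ones. *)
Lemma Rintegral_exchange (D1 : set T1) (D2 : set T2) (f : T1 * T2 -> R) :
  measurable D1 -> measurable D2 -> measurable_fun [set: T1 * T2] f ->
  (\int[m1]_(x in D1) \int[m2]_(y in D2) `|f (x, y)|%:E < +oo)%E ->
  \int[m1]_(x in D1) \int[m2]_(y in D2) f (x, y) =
  \int[m2]_(y in D2) \int[m1]_(x in D1) f (x, y).
Proof.
move=> mD1 mD2 mf foo; have mD : measurable (D1 `*` D2) by exact: measurableX.
have mF : measurable_fun setT (EFin \o f) by exact/measurable_EFinP.
have iD : (m1 \x m2)%E.-integrable (D1 `*` D2) (EFin \o f).
  apply/integrableP; split; first exact: measurable_funTS.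
  rewrite (integral_prod_on (f := fun z => `|f z|%:E))//.
  by apply/measurable_EFinP; exact: measurableT_comp.
have iT := proj1 (integrable_mkcond _ mD) iD.
have FE x : fubini_F m2 ((EFin \o f) \_ (D1 `*` D2)) x =
    ((fun x => (\int[m2]_(y in D2) (f (x, y))%:E)%E) \_ D1) x.
  rewrite /fubini_F /patch; case: ifPn => xD1.
    rewrite [RHS]integral_mkcond; apply: eq_integral => y _.
    by rewrite /patch classical_sets.in_setX/= xD1.
  by rewrite integral0_eq// => y _; rewrite classical_sets.in_setX/= (negbTE xD1).
have GE y : fubini_G m1 ((EFin \o f) \_ (D1 `*` D2)) y =
    ((fun y => (\int[m1]_(x in D1) (f (x, y))%:E)%E) \_ D2) y.
  rewrite /fubini_G /patch; case: ifPn => yD2.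
    rewrite [RHS]integral_mkcond; apply: eq_integral => x _.
    by rewrite /patch classical_sets.in_setX/= yD2 andbT.
  by rewrite integral0_eq// => x _; rewrite classical_sets.in_setX/= (negbTE yD2) andbF.
have EF : (\int[m1]_(x in D1) (\int[m2]_(y in D2) f (x, y))%:E =
    \int[m1]_x fubini_F m2 ((EFin \o f) \_ (D1 `*` D2)) x)%E.
  have mFf := measurable_fubini_F iT.
  rewrite integral_mkcond; apply: ae_eq_integral => //.
  - apply: (eq_measurable_fun (fun x => (fine (fubini_F m2 ((EFin \o f) \_ (D1 `*` D2)) x))%:E)).
      by move=> x _; rewrite FE /patch; case: ifP.
    by apply/measurable_EFinP; exact: measurableT_comp mFf.
  - apply: filterS (ae_integrable1 iT) => x /(integrable_fin_num measurableT) + _.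
    rewrite -/(fubini_F m2 ((EFin \o f) \_ (D1 `*` D2)) x) FE /patch.
    by case: ifP => // _ xfin; rewrite /Rintegral fineK.
have EG : (\int[m2]_(y in D2) (\int[m1]_(x in D1) f (x, y))%:E =
    \int[m2]_y fubini_G m1 ((EFin \o f) \_ (D1 `*` D2)) y)%E.
  have mGf := measurable_fubini_G iT.
  rewrite integral_mkcond; apply: ae_eq_integral => //.
  - apply: (eq_measurable_fun (fun y => (fine (fubini_G m1 ((EFin \o f) \_ (D1 `*` D2)) y))%:E)).
      by move=> y _; rewrite GE /patch; case: ifP.
    by apply/measurable_EFinP; exact: measurableT_comp mGf.
  - apply: filterS (ae_integrable2 iT) => y /(integrable_fin_num measurableT) + _.
    rewrite -/(fubini_G m1 ((EFin \o f) \_ (D1 `*` D2)) y) GE /patch.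
    by case: ifP => // _ yfin; rewrite /Rintegral fineK.
by rewrite {1}/Rintegral EF [in RHS]/Rintegral EG; congr fine; exact: Fubini iT.
Qed.

End integral_exchange.

(** * Exponential weights in sigma *)

Section exponential_weights.
Context {R : realType}.
Local Notation mu := (@lebesgue_measure R).

(** When the extended integral is infinite, the real one is 0 and the bound is trivial. *)
Lemma normr_Rintegral_le d (X : measurableType d) (m : {measure set X -> \bar R})
    (D : set X) (f : X -> R) : measurable D -> measurable_fun D f ->
  (`|Rintegral m D f|%:E <= \int[m]_(x in D) `|f x|%:E)%E.
Proof.
move=> mD mf; have mF : measurable_fun D (EFin \o f) by exact/measurable_EFinP.
apply: le_trans (le_abse_integral m mD mF).
rewrite /Rintegral; case: (integral _ _ _) => [r| |] //=; by rewrite normr0 leey.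
Qed.

Lemma integral_exp_abs_le (om : R) : 0 < om ->
  (\int[mu]_sg (expR (- (om * `|sg|)))%:E <= (2 / om)%:E)%E.
Proof.
move=> om0.
have cexp : continuous (fun x : R => expR (- (om * x))).
  move=> x; apply: continuous_comp; last exact: continuous_expR.
  by apply: cvgN; apply: cvgM; [exact: cvg_cst|exact: cvg_id].
have dF x : is_derive x (1 : R) (fun x => - om^-1 * expR (- (om * x))) (expR (- (om * x))).
  rewrite (_ : (fun x => - om^-1 * expR (- (om * x))) =
      fun x => - om^-1 * (expR \o *%R (- om)) x); last first.
    by apply/funext => z; rewrite -(mulNr om).
  apply: (is_derive_rew (is_derive_fctM (is_derive_fctC _ _ _)
    (is_derive_mulr_comp (is_derive_expR _)))).
  by rewrite mulr0 addr0 !mulNr mulrN opprK mulrA mulVf ?mul1r// gt_eqF.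
have half : (\int[mu]_(x in `[0%R, +oo[) (expR (- (om * x)))%:E = (om^-1)%:E)%E.
  rewrite (@ge0_continuous_FTC2y _ _ (fun x => - om^-1 * expR (- (om * x))) 0 0).
  - by rewrite mulr0 oppr0 expR0 mulr1 -EFinB sub0r opprK.
  - by move=> x _; exact: expR_ge0.
  - by apply: continuous_subspaceT => x; exact: cexp.
  - rewrite -(mulr0 (- om^-1)); apply: cvgM; first exact: cvg_cst.
    apply: (cvg_comp (fun x : R => om * x) (fun x => expR (- x))); last exact: cvgr_expR.
    exact: gt0_cvgMry.
  - by move=> x _; case: (dF x).
  - by apply: cvg_at_right_filter; apply: is_derive_continuous dF _.
  - by move=> x _; rewrite derive1E; case: (dF x).
rewrite ge0_symfun_integralT; last 3 first.
- by move=> x; exact: expR_ge0.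
- move=> x; apply: continuous_comp; last exact: continuous_expR.
  by apply: cvgN; apply: cvgM; [exact: cvg_cst|exact: cvg_norm].
- by move=> x; rewrite /= normrN.
have -> : [set x : R | 0 <= x] = `[0%R, +oo[%classic.
  by apply/seteqP; split => x /=; rewrite in_itv/= andbT.
rewrite EFinM lee_wpmul2l// -half le_eqVlt; apply/orP; left; apply/eqP.
apply: eq_integral => x; rewrite inE/= in_itv/= andbT => x0.
by rewrite ger0_norm.
Qed.

(** The left side is largest where exp sg = A / q; the inequality is that of the tangent to the
    exponential at that point. *)
Lemma affine_sub_exp_le (A q sg : R) : 0 < A -> 0 < q ->
  A * sg - q * expR sg <= A * (ln (A / q) - 1).
Proof.
move=> A0 q0; have Aq : 0 < A / q by exact: divr_gt0.
have : A / q * (1 + (sg - ln (A / q))) <= expR sg.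
  have -> : expR sg = A / q * expR (sg - ln (A / q)).
    by rewrite expRD expRN lnK ?posrE// mulrCA divff ?mulr1// gt_eqF.
  by rewrite ler_pM2l// expR_ge1Dx.
rewrite -(ler_pM2l q0) mulrA mulrCA divff ?gt_eqF// mulr1 => h.
by rewrite lerBlDr -lerBlDl; apply: le_trans h; rewrite le_eqVlt; apply/orP; left; apply/eqP; ring.
Qed.

(** For sg >= 0 the affine bound is applied with slope be + 1, the extra unit paying for exp(- om
    sg) as om <= 1; for sg <= 0, om <= be suffices. The constant does not depend on om. *)
Lemma exp_decay (be q : R) : 0 < be -> 0 < q ->
  exists2 C, 0 < C & forall om sg, om <= be -> om <= 1 ->
    expR (be * sg - q * expR sg) <= C * expR (- (om * `|sg|)).
Proof.
move=> be0 q0; set A := be + 1; have A0 : 0 < A by rewrite addr_gt0.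
exists (1 + expR (A * (ln (A / q) - 1))); first by rewrite addr_gt0// expR_gt0.
move=> om sg ombe om1; have := expR_ge0 (A * (ln (A / q) - 1)) => C0.
have E0 x : 0 <= expR x :> R by exact: expR_ge0.
have [s0|/ltW s0] := leP 0 sg.
  rewrite ger0_norm// mulrDl mul1r -expRD ler_wpDl//.
  rewrite ler_expR; have := affine_sub_exp_le sg A0 q0; rewrite /A.
  have : om * sg <= sg by rewrite ler_piMl.
  by set X := (be + 1) * (_ - _) => h1 h2; nra.
rewrite ler0_norm// mulrDl mul1r ler_wpDr ?mulr_ge0//.
rewrite ler_expR mulrN opprK.
have : be * sg <= om * sg by rewrite ler_wnM2r.
have : 0 <= q * expR sg by rewrite mulr_ge0// ltW.
by lra.
Qed.

End exponential_weights.

(** * Convolution with the kernels as a Fourier multiplier *)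

Section poisson_multiplier.
Context {R : realType}.
Local Notation mu := (@lebesgue_measure R).

Lemma measurable_d2poisson_radius :
  measurable_fun [set: R * R] (fun z : R * R => d2poisson (radius z.1) z.2).
Proof.
have mc := @continuous_cos R; have ms := @continuous_sin R.
have mX n (f : R * R -> R) : measurable_fun setT f -> measurable_fun setT (fun z => f z ^+ n).
  by move=> mf; exact: measurable_funX.
have mr : measurable_fun [set: R * R] (fun z : R * R => radius z.1).
  by rewrite /radius; meas.
have mln : measurable_fun [set: R] (@ln R) by exact: measurable_ln.
(* The denominator is positive, so its inverse is exp(- ln), a composition of measurable
   functions. *)
have mV : measurable_fun [set: R * R]
    (fun z : R * R => expR (- ln (pden (radius z.1) z.2))).
  by rewrite /pden; do 5?[meas; apply: mX].
rewrite (_ : (fun z => _) = fun z : R * R =>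
  let r := radius z.1 in let V := expR (- ln (pden (radius z.1) z.2)) in
  (1 - r ^+ 2) * (32 * pi ^+ 2 * r ^+ 2 * sin (2 * pi * z.2) ^+ 2 * V ^+ 3
    - 8 * pi ^+ 2 * r * cos (2 * pi * z.2) * V ^+ 2)) /=; last first.
  apply/funext => z; rewrite /d2poisson expRN lnK// posrE.
  exact: pden_gt0 (radius01 _).
by do 8?[meas; apply: mX].
Qed.

Lemma Rintegral_periodic (c : R) (f : R -> R) : measurable_fun setT f ->
  (forall x, f (x + 1) = f x) ->
  \int[mu]_(y in `[0, 1[) f (y + c) = \int[mu]_(y in `[0, 1[) f y.
Proof.
move=> mf fper; rewrite /Rintegral; congr fine; rewrite integralE [RHS]integralE.
have mF : measurable_fun setT (EFin \o f) by exact/measurable_EFinP.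
congr (_ - _)%E.
- rewrite -[RHS](@ge0_integral_periodic _ c (fun y => ((EFin \o f)^\+ y)%E)).
  + by apply: eq_integral => y _; rewrite !funeposE.
  + exact: measurable_funepos.
  + by move=> x; exact: funepos_ge0.
  + by move=> x; rewrite !funeposE /= fper.
- rewrite -[RHS](@ge0_integral_periodic _ c (fun y => ((EFin \o f)^\- y)%E)).
  + by apply: eq_integral => y _; rewrite !funenegE.
  + exact: measurable_funeneg.
  + by move=> x; exact: funeneg_ge0.
  + by move=> x; rewrite !funenegE /= fper.
Qed.

Variables (r : R) (r01 : 0 < r < 1).

Let cd2 : continuous (d2poisson r). Proof. exact: continuous_d2poisson. Qed.

Let shift_trig k : [/\ continuous (fun y : R => cos (2 * pi * k%:R * y)),
  continuous (fun y : R => sin (2 * pi * k%:R * y)),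
  (forall y : R, cos (2 * pi * k%:R * (y + 1)) = cos (2 * pi * k%:R * y)) &
  (forall y : R, sin (2 * pi * k%:R * (y + 1)) = sin (2 * pi * k%:R * y))].
Proof.
split; [exact: continuous_cos_mulr|exact: continuous_sin_mulr| |] => y;
  rewrite mulrDr mulr1.
- exact: cos_periodic_nat.
- exact: sin_periodic_nat.
Qed.

Let cM (f g : R -> R) : continuous f -> continuous g -> continuous (fun z => f z * g z).
Proof. by move=> cf cg y; apply: cvgM; [exact: cf|exact: cg]. Qed.
Let cZ (c : R) (f : R -> R) : continuous f -> continuous (fun z => c * f z).
Proof. by move=> cf y; apply: cvgM; [exact: cvg_cst|exact: cf]. Qed.
Let RintZ (c : R) (f : R -> R) : continuous f ->
  \int[mu]_(x in `[0, 1[) (c * f x) = c * \int[mu]_(x in `[0, 1[) f x.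
Proof. by move=> cf; apply: RintegralZl => //; exact: continuous_integrable_co. Qed.

Lemma d2poisson_translate_fourier k (x : R) :
  \int[mu]_(y in `[0, 1[) (d2poisson r (y - x) * cos (2 * pi * k%:R * y)) =
    - (2 * pi * k%:R) ^+ 2 * r ^+ k * cos (2 * pi * k%:R * x) /\
  \int[mu]_(y in `[0, 1[) (d2poisson r (y - x) * sin (2 * pi * k%:R * y)) =
    - (2 * pi * k%:R) ^+ 2 * r ^+ k * sin (2 * pi * k%:R * x).
Proof.
have [cc cs pc ps] := shift_trig k.
have md2 := continuous_measurable_fun cd2.
have mc := continuous_measurable_fun cc; have ms := continuous_measurable_fun cs.
have md2x : measurable_fun [set: R] (fun y : R => d2poisson r (y - x)) by meas.
split.
- rewrite -(@Rintegral_periodic x); last 2 first.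
  + by apply: measurable_fctM.
  + by move=> y; rewrite pc addrAC d2poisson_periodic.
  transitivity (\int[mu]_(y in `[0, 1[)
      (cos (2 * pi * k%:R * x) * (d2poisson r y * cos (2 * pi * k%:R * y)) -
       sin (2 * pi * k%:R * x) * (d2poisson r y * sin (2 * pi * k%:R * y)))).
    by apply: eq_Rintegral => y _; rewrite addrK mulrDr cosD; ring.
  rewrite RintegralB//; last 2 first.
  + apply: continuous_integrable_co; exact: cZ (cM cd2 cc).
  + apply: continuous_integrable_co; exact: cZ (cM cd2 cs).
  rewrite !RintZ; [|exact: cM|exact: cM].
  by rewrite d2poisson_fourier_cos// d2poisson_fourier_sin//; ring.
- rewrite -(@Rintegral_periodic x); last 2 first.
  + by apply: measurable_fctM.
  + by move=> y; rewrite ps addrAC d2poisson_periodic.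
  transitivity (\int[mu]_(y in `[0, 1[)
      (sin (2 * pi * k%:R * x) * (d2poisson r y * cos (2 * pi * k%:R * y)) +
       cos (2 * pi * k%:R * x) * (d2poisson r y * sin (2 * pi * k%:R * y)))).
    by apply: eq_Rintegral => y _; rewrite addrK mulrDr sinD; ring.
  rewrite RintegralD//; last 2 first.
  + apply: continuous_integrable_co; exact: cZ (cM cd2 cc).
  + apply: continuous_integrable_co; exact: cZ (cM cd2 cs).
  rewrite !RintZ; [|exact: cM|exact: cM].
  by rewrite d2poisson_fourier_cos// d2poisson_fourier_sin//; ring.
Qed.

Lemma bounded_integrable_co (f : R -> R) (C : R) : measurable_fun setT f ->
  (forall x, `|f x| <= C) -> mu.-integrable `[0, 1[ (EFin \o f).
Proof.
move=> mf fC; apply: measurable_bounded_integrable => //.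
- by rewrite /= lebesgue_measure_itv/= lte_fin ltr01 -EFinB ltry.
- exact: measurable_funTS.
- exists `|C|; split; first exact: num_real.
  move=> x Cx v _ /=; apply: ltW; apply: le_lt_trans Cx.
  exact: le_trans (fC _) (ler_norm _).
Qed.

(** Integrating against e and exchanging the integrals moves the kernel onto e, which is an
    eigenfunction with eigenvalue lam. *)
Let convolution_coef (f e : R -> R) (Cf : R) (lam : R) :
  measurable_fun setT f -> (forall x, `|f x| <= Cf) ->
  continuous e -> (forall x, `|e x| <= 1) ->
  (forall x, \int[mu]_(y in `[0, 1[) (d2poisson r (y - x) * e y) = lam * e x) ->
  \int[mu]_(y in `[0, 1[) ((\int[mu]_(x in `[0, 1[) (d2poisson r (y - x) * f x)) * e y) =
  lam * \int[mu]_(x in `[0, 1[) (f x * e x).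
Proof.
move=> mf fC ce e1 E.
have md2 := continuous_measurable_fun cd2; have me := continuous_measurable_fun ce.
have [Cd Cd0 dC] := continuous_periodic_bounded cd2 (@d2poisson_periodic _ r).
have Cf0 : 0 <= Cf by exact: le_trans (fC 0).
transitivity (\int[mu]_(y in `[0, 1[) \int[mu]_(x in `[0, 1[) (d2poisson r (y - x) * f x * e y)).
  apply: eq_Rintegral => y _; rewrite RintegralZr//.
  apply: (@bounded_integrable_co _ (Cd * Cf)); first by meas.
  by move=> x; rewrite normrM ler_pM.
rewrite (@Rintegral_exchange _ _ _ _ _ mu mu _ _
  (fun z : R * R => d2poisson r (z.1 - z.2) * f z.2 * e z.1))//=; last 2 first.
- by meas.
- apply: (@le_lt_trans _ _
    (\int[mu]_(y in `[0%R, 1%R[) \int[mu]_(x in `[0%R, 1%R[) (Cd * Cf * 1)%:E)%E).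
    apply: ge0_le_integral_nomeas => y _; first exact: integral_ge0.
    apply: ge0_le_integral_nomeas => x _ //.
    by rewrite lee_fin normrM (normrM (d2poisson _ _)) ler_pM ?mulr_ge0// ler_pM.
  have Icst (c : R) : (\int[mu]_(y in `[0%R, 1%R[) c%:E = c%:E)%E.
    by rewrite integral_cst//= lebesgue_measure_itv/= lte_fin ltr01 oppr0 adde0 mule1.
  by rewrite !Icst ltry.
rewrite -RintegralZl//; last first.
  apply: (@bounded_integrable_co _ (Cf * 1)); first by meas.
  by move=> x; rewrite normrM ler_pM.
apply: eq_Rintegral => x _.
transitivity (\int[mu]_(y in `[0, 1[) (f x * (d2poisson r (y - x) * e y))).
  by apply: eq_Rintegral => y _; ring.
rewrite RintegralZl//; first by rewrite E; ring.
apply: (@bounded_integrable_co _ (Cd * 1)); first by meas.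
by move=> y; rewrite normrM ler_pM.
Qed.

Lemma d2poisson_convolution_fourier k (f : R -> R) (Cf : R) :
  measurable_fun setT f -> (forall x, `|f x| <= Cf) ->
  fourier_cos (fun y => \int[mu]_(x in `[0, 1[) (d2poisson r (y - x) * f x)) k =
    - (2 * pi * k%:R) ^+ 2 * r ^+ k * fourier_cos f k /\
  fourier_sin (fun y => \int[mu]_(x in `[0, 1[) (d2poisson r (y - x) * f x)) k =
    - (2 * pi * k%:R) ^+ 2 * r ^+ k * fourier_sin f k.
Proof.
move=> mf fC; have [cc cs _ _] := shift_trig k.
split; apply: (convolution_coef mf fC) => // x.
- exact: cos_max.
- by have [] := d2poisson_translate_fourier k x.
- exact: sin_max.
- by have [] := d2poisson_translate_fourier k x.
Qed.

End poisson_multiplier.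

(** * Superposition of layers *)

Section superposition.
Context {R : realType}.
Local Notation mu := (@lebesgue_measure R).

(** The positive or the negative part has infinite integral, so the extended integral is infinite
    and [fine] returns 0. *)
Lemma Rintegral_not_integrable d (X : measurableType d) (m : {measure set X -> \bar R})
    (D : set X) (f : X -> R) : measurable D -> measurable_fun D f ->
  ~ m.-integrable D (EFin \o f) -> \int[m]_(x in D) f x = 0.
Proof.
move=> mD mf; have mF : measurable_fun D (EFin \o f) by exact/measurable_EFinP.
move=> ni; rewrite /Rintegral integralE.
have Ip : (0 <= \int[m]_(x in D) (EFin \o f)^\+ x)%E.
  by apply: integral_ge0 => x _; exact: funepos_ge0.
have In : (0 <= \int[m]_(x in D) (EFin \o f)^\- x)%E.
  by apply: integral_ge0 => x _; exact: funeneg_ge0.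
have : ((\int[m]_(x in D) (EFin \o f)^\+ x) + (\int[m]_(x in D) (EFin \o f)^\- x) = +oo)%E.
  apply/eqP; rewrite -leye_eq leNgt; apply/negP => h; apply: ni.
  apply/integrableP; split => //.
  rewrite -ge0_integralD// in h; last 2 first.
  - exact: measurable_funepos.
  - exact: measurable_funeneg.
  apply: le_lt_trans h; apply: ge0_le_integral_nomeas => x _ //.
  by rewrite -/((EFin \o f) x) -[in leLHS]/((abse \o (EFin \o f)) x) fune_abse.
by case: (integral _ _ _) Ip => [p| |]; case: (integral _ _ _) In => [n| |].
Qed.

(** If f is not integrable and k is nonzero, both sides take the default value 0. The lemma serves
    slices known to be integrable only almost everywhere. *)
Lemma Rintegral_mulr d (X : measurableType d) (m : {measure set X -> \bar R})
    (D : set X) (f : X -> R) (k : R) : measurable D -> measurable_fun D f ->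
  \int[m]_(x in D) (f x * k) = \int[m]_(x in D) f x * k.
Proof.
move=> mD mf; have [->|k0] := eqVneq k 0.
  rewrite mulr0 /Rintegral integral0_eq// => x _; by rewrite mulr0.
have [i|ni] := pselect (m.-integrable D (EFin \o f)); first exact: RintegralZr.
rewrite (Rintegral_not_integrable mD mf ni) mul0r Rintegral_not_integrable//.
  by apply: measurable_funM => //; exact: measurable_cst.
move=> i; apply: ni.
have := integrableZr mD k^-1 i; apply: eq_integrable => // x _ /=.
by rewrite -EFinM mulfK.
Qed.

Variables (a b L om : R) (F : R -> R -> R -> R).
Hypotheses (L0 : 0 <= L) (om0 : 0 < om).
Hypothesis mF : measurable_fun [set: R * R * R] (fun p : R * R * R => F p.2 p.1.1 p.1.2).
Hypothesis hF : forall sg, (\int[mu]_(t in `[a, b]) \int[mu]_(y in `[0%R, 1%R[)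
  `|F sg t y|%:E <= (L * expR (- (om * `|sg|)))%:E)%E.

Definition superposition (t y : R) : R := \int[mu]_sg F sg t y.

Lemma measurable_superposition :
  measurable_fun [set: R * R] (fun z : R * R => superposition z.1 z.2).
Proof. exact: (@measurable_Rintegral_param _ _ _ _ _ mu setT _ measurableT mF). Qed.

Let mass (t : R) : \bar R :=
  (\int[mu]_(y in `[0%R, 1%R[) \int[mu]_sg `|F sg t y|%:E)%E.

Let mabs : measurable_fun [set: R * R * R] (fun p : R * R * R => `|F p.2 p.1.1 p.1.2|%:E).
Proof. by apply/measurable_EFinP; exact: measurable_fctnorm. Qed.

Let measurable_mass : measurable_fun setT mass.
Proof.
apply: (@measurable_integral_param _ _ _ _ _ mu `[0%R, 1%R[%classic
  (fun z : R * R => \int[mu]_sg `|F sg z.1 z.2|%:E)%E) => //.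
- exact: (@measurable_integral_param _ _ _ _ _ mu setT _ measurableT mabs).
- by move=> z; exact: integral_ge0.
Qed.

(** By Tonelli the integral over sg comes last, where the layers are dominated by L exp(- om |sg|),
    of integral at most 2 L / om. *)
Let massE : (\int[mu]_(t in `[a, b]) mass t <= (L * (2 / om))%:E)%E.
Proof.
have swap t : mass t = (\int[mu]_sg \int[mu]_(y in `[0%R, 1%R[) `|F sg t y|%:E)%E.
  apply: (@tonelli_on _ _ _ _ _ mu mu _ _ (fun z : R * R => `|F z.2 t z.1|%:E)) => //.
  have mt : measurable_fun [set: R * R] (fun z : R * R => ((t, z.1), z.2)).
    by apply: measurable_fun_pair; [apply: measurable_fun_pair|]; meas.
  exact: (measurableT_comp mabs mt).
under eq_integral do rewrite swap.
rewrite (@tonelli_on _ _ _ _ _ mu mu _ _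
  (fun z : R * R => \int[mu]_(y in `[0%R, 1%R[) `|F z.2 z.1 y|%:E)%E)//; last 2 first.
- have mt : measurable_fun [set: R * R * R] (fun z : R * R * R => ((z.1.1, z.2), z.1.2)).
    by apply: measurable_fun_pair; [apply: measurable_fun_pair|]; meas.
  apply: (@measurable_integral_param _ _ _ _ _ mu `[0%R, 1%R[%classic
    (fun z : R * R * R => `|F z.1.2 z.1.1 z.2|%:E)) => //.
  exact: (measurableT_comp mabs mt).
- by move=> z; exact: integral_ge0.
apply: (@le_trans _ _ (\int[mu]_sg (L%:E * (expR (- (om * `|sg|)))%:E))%E).
  apply: ge0_le_integral_nomeas => sg _; last by rewrite -EFinM; exact: hF.
  by apply: integral_ge0 => t _; exact: integral_ge0.
rewrite ge0_integralZl_EFin//; last first.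
  by apply/measurable_EFinP; meas.
by rewrite [leRHS]EFinM lee_wpmul2l// integral_exp_abs_le.
Qed.

Lemma integral_superposition :
  (\int[mu]_(t in `[a, b]) \int[mu]_(y in `[0%R, 1%R[) `|superposition t y|%:E
   <= (L * (2 / om))%:E)%E.
Proof.
apply: le_trans massE; apply: ge0_le_integral_nomeas => t _; first exact: integral_ge0.
apply: ge0_le_integral_nomeas => y _ //.
apply: normr_Rintegral_le => //.
exact: (measurable_fun_pair2 (t, y) mF).
Qed.

Lemma integrable_superposition :
  (mu \x mu)%E.-integrable (`[a, b] `*` `[0, 1[)
    (fun z : R * R => (superposition z.1 z.2)%:E).
Proof.
have mG := measurable_superposition.
apply/integrableP; split.
  by apply/measurable_funTS; exact/measurable_EFinP.
rewrite (@integral_prod_on _ _ _ _ _ mu mu _ _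
  (fun z : R * R => `|superposition z.1 z.2|%:E))//=; last first.
  by apply/measurable_EFinP; exact: measurable_fctnorm.
by rewrite (le_lt_trans integral_superposition)// ltry.
Qed.

(** Fubini needs the absolute integral in (sigma, y), which is finite for almost every t. *)
Lemma superposition_test : {ae mu, forall t, t \in `[a, b] ->
  mu.-integrable `[0, 1[ (EFin \o superposition t) /\
  forall e : R -> R, continuous e -> (forall y, `|e y| <= 1) ->
    \int[mu]_(y in `[0, 1[) (superposition t y * e y) =
    \int[mu]_sg \int[mu]_(y in `[0, 1[) (F sg t y * e y)}.
Proof.
have imass : mu.-integrable `[a, b] mass.
  apply/integrableP; split; first exact: (measurable_funTS measurable_mass).
  under eq_integral.
    move=> t _; rewrite gee0_abs; last by apply: integral_ge0 => y _; exact: integral_ge0.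
    over.
  by rewrite (le_lt_trans massE)// ltry.
have mab : measurable (`[a, b]%classic : set (measurableTypeR R)) by exact: measurable_itv.
have := integrable_ae mab imass.
apply: filterS => t /= + tab.
move=> /(_ tab); rewrite ge0_fin_numE; last first.
  by apply: integral_ge0 => y _; exact: integral_ge0.
move=> mt.
have mFt : measurable_fun [set: R * R] (fun z : R * R => F z.2 t z.1).
  have mtz : measurable_fun [set: R * R] (fun z : R * R => ((t, z.1), z.2)).
    by apply: measurable_fun_pair; [apply: measurable_fun_pair|]; meas.
  exact: (measurableT_comp mF mtz).
have mFty y : measurable_fun [set: R] (fun sg => F sg t y).
  exact: (measurable_fun_pair2 y mFt).
split.
  apply/integrableP; split.
    apply/measurable_funTS/measurable_EFinP.
    exact: (measurable_fun_pair2 t measurable_superposition).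
  apply: le_lt_trans mt; apply: ge0_le_integral_nomeas => y _ //.
  by apply: (@normr_Rintegral_le _ _ _ mu setT (fun sg => F sg t y)) => //; exact: mFty.
move=> e ce e1; have me := continuous_measurable_fun ce.
transitivity (\int[mu]_(y in `[0, 1[) \int[mu]_sg (F sg t y * e y)).
  by apply: eq_Rintegral => y _; rewrite (Rintegral_mulr mu (e y) measurableT (mFty y)).
apply: (@Rintegral_exchange _ _ _ _ _ mu mu _ _
  (fun z : R * R => F z.2 t z.1 * e z.1)) => //.
  by meas.
apply: le_lt_trans mt; apply: ge0_le_integral_nomeas => y _; first exact: integral_ge0.
apply: ge0_le_integral_nomeas => sg _ //.
by rewrite lee_fin normrM ler_piMr.
Qed.

End superposition.

(** * Integral representation of |D|^s *)

Section riesz_representation.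
Context {R : realType}.
Local Notation mu := (@lebesgue_measure R).

(** Euler's Gamma function at [be], after the substitution x = exp sg. *)
Definition exp_gamma (be : R) : R := \int[mu]_sg expR (be * sg - expR sg).


Lemma integrable_exp_gamma (be : R) : 0 < be ->
  mu.-integrable setT (fun sg : R => (expR (be * sg - expR sg))%:E).
Proof.
move=> be0; have [C C0 hC] := exp_decay be0 (@ltr01 R).
set om := Num.min be 1; have om0 : 0 < om by rewrite lt_min be0 ltr01.
have mw : measurable_fun [set: R] (fun sg : R => expR (be * sg - expR sg)) by meas.
apply/integrableP; split; first exact/measurable_EFinP.
apply: (@le_lt_trans _ _ (\int[mu]_sg (C%:E * (expR (- (om * `|sg|)))%:E))%E).
  apply: ge0_le_integral_nomeas => sg _ //.
  rewrite -EFinM lee_fin ger0_norm ?expR_ge0// -[expR sg]mul1r.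
  by apply: hC; rewrite /om ge_min lexx ?orbT.
rewrite ge0_integralZl_EFin//; last 2 first.
- by apply/measurable_EFinP; meas.
- exact: ltW.
apply: (@le_lt_trans _ _ (C * (2 / om))%:E); last by rewrite ltry.
by rewrite [leRHS]EFinM lee_wpmul2l// ?lee_fin ?(ltW C0)// integral_exp_abs_le.
Qed.

Lemma exp_gamma_gt0 (be : R) : 0 < be -> 0 < exp_gamma be.
Proof.
move=> be0; have i := integrable_exp_gamma be0.
have fin := integrable_fin_num measurableT i.
rewrite -lte_fin /exp_gamma /Rintegral fineK//.
apply: (@lt_le_trans _ _ (\int[mu]_(sg in `[0%R, 1%R[) (expR (- expR 1))%:E)%E).
  rewrite integral_cst//= lebesgue_measure_itv/= lte_fin ltr01 oppr0 adde0 mule1.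
  by rewrite lte_fin expR_gt0.
rewrite [leLHS]integral_mkcond; apply: ge0_le_integral_nomeas => sg _.
  by rewrite /patch; case: ifP => // _; rewrite lee_fin expR_ge0.
rewrite /patch; case: ifPn => [|_]; last by rewrite lee_fin expR_ge0.
rewrite inE/= in_itv/= => /andP[s0 s1]; rewrite lee_fin ler_expR.
have : expR sg <= expR 1 by rewrite ler_expR ltW.
have : 0 <= be * sg by rewrite mulr_ge0// ltW.
by lra.
Qed.

Lemma exp_gamma_scale (be q : R) : 0 < q ->
  \int[mu]_sg expR (be * sg - q * expR sg) = q `^ (- be) * exp_gamma be.
Proof.
move=> q0.
have E sg : expR (be * sg - q * expR sg) =
    q `^ (- be) * expR (be * (sg + ln q) - expR (sg + ln q)).
  rewrite /powR gt_eqF// -expRD [expR (sg + ln q)]expRD lnK ?posrE//.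
  by congr expR; ring.
have mw : measurable_fun [set: R] (fun sg : R => expR (be * sg - expR sg)) by meas.
have mE : measurable_fun [set: R] (fun sg : R => (expR (be * sg - expR sg))%:E).
  exact/measurable_EFinP.
under eq_Rintegral do rewrite E.
rewrite /exp_gamma /Rintegral -(@ge0_integral_shift _ (ln q) _ mE) => [|x]; last first.
  by rewrite lee_fin expR_ge0.
transitivity (fine ((q `^ (- be))%:E *
    \int[mu]_sg (expR (be * (sg + ln q) - expR (sg + ln q)))%:E)%E); last first.
  by case: (integral _ _ _) => [x| |] //=; rewrite ?mulr0 ?gt0_muley ?gt0_muleNy ?lte_fin ?powR_gt0.
congr fine; rewrite -ge0_integralZl_EFin ?powR_ge0//; last first.
  by apply/measurable_EFinP; meas.
Qed.

Variables (v : R -> R -> R) (Cv : R).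
Hypothesis mv : measurable_fun [set: R * R] (fun z : R * R => v z.1 z.2).
Hypothesis vC : forall t x, `|v t x| <= Cv.

Definition poisson_layer (sg t y : R) : R :=
  \int[mu]_(x in `[0, 1[) (d2poisson (radius sg) (y - x) * v t x).

Lemma measurable_poisson_layer :
  measurable_fun [set: R * R * R] (fun p : R * R * R => poisson_layer p.2 p.1.1 p.1.2).
Proof.
have md := @measurable_d2poisson_radius R.
apply: (@measurable_Rintegral_param _ _ _ _ _ mu `[0, 1[%classic
  (fun p : R * R * R * R => d2poisson (radius p.1.2) (p.1.1.2 - p.2) * v p.1.1.1 p.2)) => //.
apply: measurable_fctM.
- have m1 : measurable_fun [set: R * R * R * R]
      (fun p : R * R * R * R => (p.1.2, p.1.1.2 - p.2)).
    by apply: measurable_fun_pair; meas.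
  exact: (measurableT_comp md m1).
- have m1 : measurable_fun [set: R * R * R * R] (fun p : R * R * R * R => (p.1.1.1, p.2)).
    by apply: measurable_fun_pair; meas.
  exact: (measurableT_comp mv m1).
Qed.

(** |D|^s is this multiple of the superposition of the layers because
    int exp ((2 - s) sg - k exp sg) dsg = k^(s - 2) * exp_gamma (2 - s). *)
Definition riesz_kernel_const (s : R) : R := - ((2 * pi) `^ (s - 2) / exp_gamma (2 - s)).

(** A layer multiplies the k-th mode by -(2 pi k)^2 exp(-k exp sg). Integrated against exp((2 - s)
    sg) this is -(2 pi k)^2 k^(s - 2) Gamma(2 - s), which the constant turns into (2 pi k)^s. The
    decay assumed in sg makes the superposition converge in L^1 and allows its Fourier coefficients
    to be computed layer by layer, for almost every t. *)
Lemma riesz_of_layers (s a b L om : R) : s < 2 -> 0 <= L -> 0 < om ->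
  (forall sg, (\int[mu]_(t in `[a, b]) \int[mu]_(y in `[0%R, 1%R[)
     `|expR ((2 - s) * sg) * poisson_layer sg t y|%:E
     <= (L * expR (- (om * `|sg|)))%:E)%E) ->
  exists g : R -> R -> R,
  [/\ measurable_fun [set: R * R] (fun z : R * R => g z.1 z.2),
      (mu \x mu)%E.-integrable (`[a, b] `*` `[0, 1[) (fun z : R * R => (g z.1 z.2)%:E),
      (\int[mu]_(t in `[a, b]) \int[mu]_(y in `[0%R, 1%R[) `|g t y|%:E
        <= (`|riesz_kernel_const s| * L * (2 / om))%:E)%E &
      {ae mu, forall t, t \in `[a, b] -> riesz_derivative s (v t) (g t)}].
Proof.
move=> s2 L0 om0 hL; set c := riesz_kernel_const s; set be := 2 - s in hL *.
have be0 : 0 < be by rewrite subr_gt0.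
pose F sg t y := c * (expR (be * sg) * poisson_layer sg t y).
have mlay := measurable_poisson_layer.
have mF : measurable_fun [set: R * R * R] (fun p : R * R * R => F p.2 p.1.1 p.1.2).
  apply: measurable_fctM; first exact: measurable_fctC.
  by apply: measurable_fctM => //; meas.
have cL : 0 <= `|c| * L by rewrite mulr_ge0.
have hF sg : (\int[mu]_(t in `[a, b]) \int[mu]_(y in `[0%R, 1%R[)
    `|F sg t y|%:E <= (`|c| * L * expR (- (om * `|sg|)))%:E)%E.
  have mabs : measurable_fun [set: R * R] (fun z : R * R =>
      `|expR (be * sg) * poisson_layer sg z.1 z.2|%:E).
    apply/measurable_EFinP; apply: measurable_fctnorm.
    apply: measurable_fctM; first exact: measurable_fctC.
    have m1 : measurable_fun [set: R * R] (fun z : R * R => (z, sg)).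
      by apply: measurable_fun_pair; meas.
    exact: (measurableT_comp mlay m1).
  have mt t := measurable_fun_pair2 t mabs.
  have E t : (\int[mu]_(y in `[0%R, 1%R[) `|F sg t y|%:E =
     `|c|%:E * \int[mu]_(y in `[0%R, 1%R[) `|expR (be * sg) * poisson_layer sg t y|%:E)%E.
    rewrite -ge0_integralZl_EFin//.
      by apply: eq_integral => y _; rewrite -EFinM -normrM.
    exact: (measurable_funTS (mt t)).
  under eq_integral do rewrite E.
  rewrite ge0_integralZl_EFin//; last 2 first.
  - by move=> t _; exact: integral_ge0.
  - apply: measurable_funTS.
    exact: (@measurable_integral_param _ _ _ _ _ mu `[0%R, 1%R[%classic _ (measurable_itv _) mabs).
  by rewrite -mulrA [leRHS]EFinM lee_wpmul2l.
exists (superposition F); split.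
- exact: measurable_superposition.
- exact: (integrable_superposition cL om0 mF hF).
- exact: (integral_superposition cL om0 mF hF).
have := superposition_test cL om0 mF hF.
apply: (filterS (F := nbhs (almost_everywhere (mu : set (measurableTypeR R) -> \bar R)))).
move=> t /= + tab => /(_ tab)[ig test].
have mvt : measurable_fun [set: R] (v t) := measurable_fun_pair2 t mv.
have iv := @bounded_integrable_co R (v t) Cv mvt (vC t).
have coef k (e : R -> R) (S : R) : continuous e -> (forall y, `|e y| <= 1) ->
    (forall sg, \int[mu]_(y in `[0, 1[) (poisson_layer sg t y * e y) =
       - (2 * pi * k%:R) ^+ 2 * radius sg ^+ k * S) ->
    \int[mu]_(y in `[0, 1[) (superposition F t y * e y) =
      (if k == 0%N then 0 else (2 * pi * k%:R) `^ s * S).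
  move=> ce e1 hS; rewrite test//.
  have mlt sg : measurable_fun [set: R] (poisson_layer sg t).
    have m1 : measurable_fun [set: R] (fun y : R => ((t, y), sg)).
      by apply: measurable_fun_pair; [apply: measurable_fun_pair|]; meas.
    exact: (measurableT_comp mlay m1).
  have me := continuous_measurable_fun ce.
  set K := c * (- (2 * pi * k%:R) ^+ 2 * S).
  have mI : measurable (`[0%R, 1%R[%classic : set (measurableTypeR R)) by exact: measurable_itv.
  have mle sg : measurable_fun [set: R] (fun y => poisson_layer sg t y * e y).
    exact: measurable_fctM.
  transitivity (\int[mu]_sg (expR (be * sg - k%:R * expR sg) * K)).
    apply: eq_Rintegral => sg _.
    transitivity (\int[mu]_(y in `[0, 1[) (poisson_layer sg t y * e y * (c * expR (be * sg)))).
      by apply: eq_Rintegral => y _; rewrite /F; ring.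
    have mleI : measurable_fun (`[0%R, 1%R[%classic : set (measurableTypeR R))
        (fun y => poisson_layer sg t y * e y) by exact: (measurable_funTS (mle sg)).
    apply: (etrans (Rintegral_mulr mu _ mI mleI)); rewrite hS.
    have -> : expR (be * sg - k%:R * expR sg) = expR (be * sg) * radius sg ^+ k.
      by rewrite expRD /radius -expRM_natl mulrN.
    by rewrite /K; ring.
  rewrite (Rintegral_mulr mu _ measurableT); last by apply: measurable_fctexp; meas.
  (* At k = 0 the integral over sg diverges, but the factor (2 pi k)^2 contained in K is 0, so the
     zero mode vanishes. *)
  have [kz|k0] := eqVneq k 0%N.
    have K0 : K = 0 by rewrite /K kz mulr0 expr0n oppr0 mul0r mulr0.
    by rewrite [X in _ * X]K0 mulr0.
  have kR : 0 < k%:R :> R by rewrite ltr0n lt0n.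
  have pi0 := @pi_gt0 R.
  rewrite exp_gamma_scale// /K /c /riesz_kernel_const -/be.
  have x0 : 0 < 2 * pi * k%:R :> R by rewrite !mulr_gt0.
  have -> : (2 * pi * k%:R) `^ s = (2 * pi) `^ (s - 2) * k%:R `^ (- be) * (2 * pi * k%:R) ^+ 2.
    rewrite -powR_mulrn ?(ltW x0)// /be opprB -powRM ?mulr_ge0 ?(ltW pi0)//.
    rewrite -powRD; first by congr (_ `^ _); ring.
    by rewrite (gt_eqF x0) implybT.
  by field; rewrite gt_eqF// exp_gamma_gt0.
split => //.
- rewrite /fourier_cos (coef 0%N _ (fourier_cos (v t) 0)) => [//||y|sg].
  + exact: continuous_cos_mulr.
  + exact: cos_max.
  + by have [] := d2poisson_convolution_fourier (radius01 sg) 0 mvt (vC t).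
move=> k k0; split.
- rewrite {1}/fourier_cos (coef k _ (fourier_cos (v t) k)) => [|||sg].
  + by rewrite gtn_eqF.
  + exact: continuous_cos_mulr.
  + by move=> y; exact: cos_max.
  + by have [] := d2poisson_convolution_fourier (radius01 sg) k mvt (vC t).
- rewrite {1}/fourier_sin (coef k _ (fourier_sin (v t) k)) => [|||sg].
  + by rewrite gtn_eqF.
  + exact: continuous_sin_mulr.
  + by move=> y; exact: sin_max.
  + by have [] := d2poisson_convolution_fourier (radius01 sg) k mvt (vC t).
Qed.

End riesz_representation.

(** * Balancing the estimates *)

Section exponents.
Context {R : realType}.

(** The irregularity hypothesis stops short of alpha = -1, so gamma < 1 must be compensated by the
    strict inequality s < sm. For s >= 0 the midpoint of s / sm and 1 works; for s < 0 any gamma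
    does. *)
Lemma interpolation_exponent (s sm : R) : 0 <= sm -> s < sm ->
  exists2 gamma, 0 < gamma < 1 & s < gamma * sm.
Proof.
move=> sm0 ssm; have [s0|s0] := ltP s 0.
  exists 2^-1; first by apply/andP; split; lra.
  by apply: (lt_le_trans s0); rewrite mulr_ge0.
have smgt : 0 < sm := le_lt_trans s0 ssm.
have q0 : 0 <= s / sm by rewrite divr_ge0.
have q1 : s / sm < 1 by rewrite ltr_pdivrMr// mul1r.
exists ((s / sm + 1) / 2); first by apply/andP; split; lra.
have -> : (s / sm + 1) / 2 * sm = (s + sm) / 2 by field; rewrite gt_eqF.
by lra.
Qed.

Variables (s gamma eta iota p theta E om : R).
Variables (A0 A1 B1 Ca N rho : R).
Hypotheses (A0_gt0 : 0 < A0) (A1_gt0 : 0 < A1) (B1_ge0 : 0 <= B1) (Ca_ge0 : 0 <= Ca)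
  (N_ge0 : 0 <= N) (rho01 : 0 < rho <= 1) (eta0 : 0 <= eta).
Hypotheses (E1 : p * iota * gamma <= E) (E2 : 1 - p <= E) (E3 : 1 - p * (1 + eta) <= E).
Hypotheses (om1 : om <= gamma - s - theta * iota * gamma) (om2 : om <= theta - s)
  (om3 : om <= theta * (1 + eta) - 1 - s).

Definition decay_const : R :=
  A0 `^ (1 - gamma) * A1 `^ gamma * expR 1 * Ca * rho `^ (- (iota * gamma)) + B1 + N * B1.

Lemma decay_const_ge0 : 0 <= decay_const.
Proof. by rewrite /decay_const !addr_ge0// ?mulr_ge0 ?powR_ge0 ?expR_ge0. Qed.

(** After substitution of e, each of the three terms is a constant times a power of X times an
    exponential in sigma. As ln X >= 0 and sigma <= 0, only the exponents matter: E1, E2, E3 compare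
    those of X and om1, om2, om3 those of exp sigma. Powers are written as [expR] to make the
    comparison linear in ln X and sigma. *)
Lemma weighted_estimate_le (M X sigma e : R) : 0 <= M <= X -> 1 <= X -> sigma <= 0 ->
  e = rho * X `^ (- p) * expR (theta * sigma) ->
  expR ((2 - s) * sigma) *
   ((A0 * expR (- (2%:R * sigma))) `^ (1 - gamma) *
    (A1 * expR (- (1%:R * sigma))) `^ gamma * expR 1 * Ca * e `^ (- (iota * gamma)) +
    (B1 * expR (- (2%:R * sigma)) + N * e `^ eta * (B1 * expR (- (3%:R * sigma)))) * e * M)
  <= decay_const * X `^ E * expR (om * sigma).
Proof.
move=> /andP[M0 MX] X1 s0 eE; have X0 : 0 < X := lt_le_trans ltr01 X1.
have /andP[r0 r1] := rho01.
have lX0 : 0 <= ln X by rewrite ln_ge0.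
have lr0 : ln rho <= 0 by rewrite ln_le0.
have e0 : 0 < e by rewrite eE !mulr_gt0 ?powR_gt0 ?expR_gt0.
have powE (x y : R) : 0 < x -> x `^ y = expR (y * ln x) by move=> x0; rewrite /powR gt_eqF.
have lA (x y : R) : 0 < x -> ln (x * expR y) = ln x + y.
  by move=> x0; rewrite lnM ?posrE ?expR_gt0// expRK.
have le : ln e = ln rho - p * ln X + theta * sigma.
  by rewrite eE lA ?mulr_gt0 ?powR_gt0// powE// lA// mulNr.
have {}eE : e = expR (ln e) by rewrite lnK// posrE.
have XE : X = expR (ln X) by rewrite lnK// posrE.
have h1 : p * iota * gamma * ln X <= E * ln X by rewrite ler_wpM2r.
have h2 : (1 - p) * ln X <= E * ln X by rewrite ler_wpM2r.
have h3 : (1 - p * (1 + eta)) * ln X <= E * ln X by rewrite ler_wpM2r.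
have k1 : (gamma - s - theta * iota * gamma) * sigma <= om * sigma by rewrite ler_wnM2r.
have k2 : (theta - s) * sigma <= om * sigma by rewrite ler_wnM2r.
have k3 : (theta * (1 + eta) - 1 - s) * sigma <= om * sigma by rewrite ler_wnM2r.
(* The coefficient of sigma is (2 - s) - 2 (1 - gamma) - gamma - theta iota gamma = gamma - s -
   theta iota gamma. *)
have T1 : expR ((2 - s) * sigma) * ((A0 * expR (- (2%:R * sigma))) `^ (1 - gamma) *
    (A1 * expR (- (1%:R * sigma))) `^ gamma * expR 1 * Ca * e `^ (- (iota * gamma)))
    <= A0 `^ (1 - gamma) * A1 `^ gamma * expR 1 * Ca * rho `^ (- (iota * gamma)) *
       X `^ E * expR (om * sigma).
  rewrite !powE ?mulr_gt0 ?expR_gt0// le !lA//.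
  rewrite (_ : _ * _ = expR 1 * Ca * (expR ((2 - s) * sigma) *
    (expR ((1 - gamma) * (ln A0 + - (2%:R * sigma))) *
    (expR (gamma * (ln A1 + - (1%:R * sigma))) *
    expR (- (iota * gamma) * (ln rho - p * ln X + theta * sigma)))))); last by ring.
  rewrite [leRHS](_ : _ = expR 1 * Ca * (expR ((1 - gamma) * ln A0) *
    (expR (gamma * ln A1) * (expR (- (iota * gamma) * ln rho) *
    (expR (E * ln X) * expR (om * sigma)))))); last by ring.
  rewrite -!expRD ler_wpM2l ?mulr_ge0 ?expR_ge0// ler_expR.
  rewrite -subr_ge0; move: h1 k1; rewrite -subr_ge0 -(subr_ge0 _ (om * sigma)) => h1 k1.
  by apply: le_trans (addr_ge0 h1 k1) _; rewrite le_eqVlt; apply/orP; left; apply/eqP; ring.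
(* With M <= X, the exponent of X is 1 - p and the coefficient of sigma is (2 - s) - 2 + theta =
   theta - s. *)
have T2 : expR ((2 - s) * sigma) * (B1 * expR (- (2%:R * sigma)) * e * M)
    <= B1 * X `^ E * expR (om * sigma).
  apply: (@le_trans _ _ (expR ((2 - s) * sigma) * (B1 * expR (- (2%:R * sigma)) * e * X))).
    by rewrite ler_wpM2l ?expR_ge0// ler_wpM2l// !mulr_ge0 ?expR_ge0// ltW.
  rewrite eE (powE X)// {1}XE le.
  rewrite (_ : _ * _ = B1 * (expR ((2 - s) * sigma) * (expR (- (2%:R * sigma)) *
    (expR (ln rho - p * ln X + theta * sigma) * expR (ln X))))); last by ring.
  rewrite -mulrA -!expRD ler_wpM2l// ler_expR.
  by lra.
(* The Hölder factor raises e to the power 1 + eta, against a kernel bound exp(-3 sigma): X has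
   exponent 1 - p (1 + eta), sigma has coefficient theta (1 + eta) - 1 - s, and the power of rho is
   at most 1. *)
have T3 : expR ((2 - s) * sigma) *
    (N * e `^ eta * (B1 * expR (- (3%:R * sigma))) * e * M)
    <= N * B1 * X `^ E * expR (om * sigma).
  apply: (@le_trans _ _ (expR ((2 - s) * sigma) *
      (N * e `^ eta * (B1 * expR (- (3%:R * sigma))) * e * X))).
    by rewrite ler_wpM2l ?expR_ge0// ler_wpM2l// !mulr_ge0 ?expR_ge0 ?powR_ge0// ltW.
  rewrite (powE e)// eE (powE X)// {1}XE expRK le.
  rewrite (_ : _ * _ = N * B1 * (expR ((2 - s) * sigma) * (expR (- (3%:R * sigma)) *
    (expR (eta * (ln rho - p * ln X + theta * sigma)) *
    (expR (ln rho - p * ln X + theta * sigma) * expR (ln X)))))); last by ring.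
  rewrite -[leRHS]mulrA -!expRD ler_wpM2l ?mulr_ge0// ler_expR.
  have : eta * ln rho <= 0 by rewrite mulr_ge0_le0.
  by lra.
apply: le_trans (_ : _ <= _ + _ + _) _; last first.
  rewrite [leRHS](_ : _ = A0 `^ (1 - gamma) * A1 `^ gamma * expR 1 * Ca *
       rho `^ (- (iota * gamma)) * X `^ E * expR (om * sigma) + B1 * X `^ E * expR (om * sigma) +
       N * B1 * X `^ E * expR (om * sigma)); last by rewrite /decay_const; ring.
  exact: lerD (lerD T1 T2) T3.
by rewrite le_eqVlt; apply/orP; left; apply/eqP; ring.
Qed.

End exponents.

(** * Consequences of the hypotheses on w, phi, u and m *)

Section unpacking.
Context {R : realType}.
Local Notation mu := (@lebesgue_measure R).

(** Each supremum is bounded by the sum N because the other is nonnegative; T > 0 provides two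
    distinct times, so the second is not taken over the empty set. *)
Lemma holder_norm_bounds (T eta N : R) (w : R -> R) : 0 < T ->
  holder_norm T eta w = N%:E ->
  [/\ 0 <= N, (forall r, r \in `[0, T] -> `|w r| <= N) &
      forall r t, r \in `[0, T] -> t \in `[0, T] -> `|w t - w r| <= N * `|t - r| `^ eta].
Proof.
move=> T0; rewrite /holder_norm.
set S1 := ereal_sup _; set S2 := ereal_sup _ => SN.
have b1 r : r \in `[0, T] -> (`|w r|%:E <= S1)%E.
  by move=> rT; apply: ereal_sup_ubound; exists r.
have b2 r t : r \in `[0, T] -> t \in `[0, T] -> r != t ->
    ((`|w t - w r| / (`|t - r| `^ eta))%:E <= S2)%E.
  by move=> rT tT rt; apply: ereal_sup_ubound; exists (r, t).
have in0 : 0 \in `[0, T] by rewrite in_itv/= lexx ltW.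
have inT : T \in `[0, T] by rewrite in_itv/= lexx ltW.
have S10 : (0 <= S1)%E by apply: le_trans (b1 _ in0); rewrite lee_fin.
have S20 : (0 <= S2)%E.
  apply: le_trans (b2 _ _ in0 inT _); last by rewrite lt_eqF.
  by rewrite lee_fin divr_ge0 ?powR_ge0.
have N0 : 0 <= N by rewrite -lee_fin -SN adde_ge0.
have S1N : (S1 <= N%:E)%E by rewrite -SN leeDl.
have S2N : (S2 <= N%:E)%E by rewrite -SN leeDr.
split=> // [r rT|r t rT tT]; first by rewrite -lee_fin (le_trans (b1 _ rT)).
have [->|rt] := eqVneq r t; first by rewrite subrr normr0 mulr_ge0// powR_ge0.
have := le_trans (b2 _ _ rT tT rt) S2N.
rewrite lee_fin ler_pdivrMr// powR_gt0// normr_gt0 subr_eq0.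
by rewrite eq_sym.
Qed.

Lemma derive_eq0_off_closed (phi : R -> R) (K : set R) : closed K ->
  (forall v, ~ K v -> phi v = 0) -> forall v, ~ K v -> 'D_1 phi v = 0.
Proof.
move=> cK phiK v Kv.
have oK : open (~` K) by rewrite openC.
rewrite (@near_eq_derive _ _ _ phi (cst 0) v 1) ?oner_neq0//; first exact: derive_cst.
have : \forall z \near v, (~` K) z by exact: open_nbhs_nbhs.
by apply: filterS => z Kz; rewrite /cst phiK.
Qed.

Lemma continuous_support_bounded (phi : R -> R) (M : R) : 0 < M -> continuous phi ->
  (forall v, M < `|v| -> phi v = 0) -> exists2 B, 0 < B & forall v, `|phi v| <= B.
Proof.
move=> M0 cphi phi0; have MM : - M <= M by rewrite (le_trans _ (ltW M0))// oppr_le0 ltW.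
have [c _ hc] := @EVT_max R (fun z => `|phi z|) (- M) M MM
  (continuous_subspaceT (fun y => cvg_norm (cphi y))).
exists (`|phi c| + 1) => [|v]; first by rewrite ltr_wpDl.
have [vM|vM] := leP `|v| M.
  by rewrite (le_trans (hc _ _)) ?lerDl// in_itv/= -ler_norml.
by rewrite phi0// normr0 addr_ge0.
Qed.

Lemma Cc_smooth_bounds (phi : R -> R) : Cc_smooth phi -> exists M0 B : R,
  [/\ 0 < M0, 0 < B, bounded_support M0 B phi, bounded_support M0 B ('D_1 phi) &
      forall v, is_derive v (1 : R) phi ('D_1 phi v)].
Proof.
move=> [sphi [M phiM]]; have [dphi cdphi] := sphi 1%N.
pose M0 := `|M| + 1; have M0_gt0 : 0 < M0 by rewrite ltr_wpDl.
have phi0 v : M0 < `|v| -> phi v = 0.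
  by move=> h; apply: phiM; apply: le_lt_trans h; rewrite /M0 (le_trans (ler_norm M))// lerDl.
have dphi0 v : M0 < `|v| -> 'D_1 phi v = 0.
  move=> vM; apply: (@derive_eq0_off_closed _ `[- M0, M0]%classic); first exact: interval_closed.
    move=> z zM; apply: phi0; rewrite ltNge; apply/negP => zM0; apply: zM.
    by rewrite /= in_itv/= -ler_norml.
  by rewrite /= in_itv/= -ler_norml leNgt vM.
have cphi := sphi 0%N.
have [B1 B10 phiB] := continuous_support_bounded M0_gt0 cphi phi0.
have [B2 B20 dphiB] := continuous_support_bounded M0_gt0 (cdphi 1) dphi0.
exists M0, (B1 + B2); split => //.
- exact: addr_gt0.
- by split => // v; rewrite (le_trans (phiB v))// lerDl ltW.
- split; [exact: cdphi|exact: dphi0|move=> v].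
  by rewrite (le_trans (dphiB v))// lerDr ltW.
- by move=> v; apply: derivableP; apply/derivable1_diffP.
Qed.

Lemma hsobolev_norm_ge0 (s : R) (f : R -> R) : (0 <= hsobolev_norm s f)%E.
Proof. by apply: le_ereal_inf_tmp => _ [g _ <-]; exact: integral_ge0. Qed.

Lemma L1_hsobolev_norm_ge0 (I : set R) (s : R) (f : R -> R -> R) :
  (0 <= L1_hsobolev_norm I s f)%E.
Proof. by apply: integral_ge0 => t _; exact: hsobolev_norm_ge0. Qed.

(** The essential supremum of a nonnegative function is nonnegative as soon as the underlying
    measure is not zero. *)
Lemma Linfty_L1_norm_ge0 (T : R) (u : R -> R -> R) : (0 <= Linfty_L1_norm T u)%E.
Proof.
have muT : (0 < mu [set: R])%E.
  rewrite (_ : [set: R] = `]-oo, +oo[%classic); last by rewrite set_itvNyy.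
  by rewrite lebesgue_measure_itv/= addye// ltry.
apply: ess_sup_gee; first exact: muT.
apply: nearW => t; rewrite /patch; case: ifP => // _; exact: integral_ge0.
Qed.

Lemma kinetic_mass_fin (T : R) (m : {charge set (R * R * R)%type -> \bar R}) (K : set R) :
  measurable K -> exists2 M : R, 0 <= M & kinetic_mass T m K = M%:E.
Proof.
move=> mK; pose X := measurableTypeR R.
have mD : measurable ((`[0, T] `*` `[0, 1[ : set (X * X)) `*` (K : set X)).
  by apply: measurableX => //; apply: measurableX; exact: measurable_itv.
pose nup : {finite_measure set (R * R * R)%type -> \bar R} := jordan_pos (hahnPN m).
pose nun : {finite_measure set (R * R * R)%type -> \bar R} := jordan_neg (hahnPN m).
have pfin := fin_num_measure nup _ mD; have nfin := fin_num_measure nun _ mD.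
exists (fine (nup (`[0, T] `*` `[0, 1[ `*` K)) + fine (nun (`[0, T] `*` `[0, 1[ `*` K))).
  by rewrite addr_ge0// fine_ge0.
by rewrite EFinD !fineK.
Qed.

(** A quasi-solution is only controlled on [0, T]. *)
Definition time_patch (T : R) (u : R -> R -> R) (t x : R) : R :=
  if t \in `[0, T] then u t x else 0.

Lemma measurable_time_patch T u : Linfty_CL1 T u ->
  measurable_fun [set: R * R] (fun z : R * R => time_patch T u z.1 z.2).
Proof.
move=> [_ mu_ _ _ _]; pose X := measurableTypeR R.
have mD : measurable ((`[0, T] : set X) `*` [set: X]).
  by apply: measurableX; [exact: measurable_itv|exact: measurableT].
have := proj1 (measurable_restrictT _ mD) mu_; apply: eq_measurable_fun => z _.
by rewrite /patch /time_patch classical_sets.in_setX in_setT andbT mem_setE.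
Qed.

Lemma measurable_path_patch (T : R) (w : R -> R) : {within `[0, T], continuous w} ->
  measurable_fun [set: R] (fun r => if r \in `[0, T] then w r else 0).
Proof.
move=> cw.
have mD : measurable (`[0, T]%classic : set (measurableTypeR R)) by exact: measurable_itv.
have := proj1 (measurable_restrictT _ mD) (subspace_continuous_measurable_fun mD cw).
by apply: eq_measurable_fun => z _; rewrite /patch mem_setE.
Qed.

Variables (M0 B : R) (M0_gt0 : 0 < M0) (phi : R -> R).
Hypothesis hphi : bounded_support M0 B phi.

Lemma velocity_average_le u t x : `|velocity_average phi u t x| <= 2 * M0 * B.
Proof.
have [cphi phi0 phiB] := hphi; have mphi := continuous_measurable_fun cphi.
have B0 : 0 <= B := le_trans (normr_ge0 _) (phiB 0).
rewrite -lee_fin.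
apply: (le_trans (normr_Rintegral_le mu measurableT (f := fun v => chi (u t x) v * phi v) _)).
  by meas.
apply: (@le_trans _ _ (\int[mu]_(v in `[(- M0)%R, M0]) B%:E)%E).
  rewrite [leRHS]integral_mkcond; apply: ge0_le_integral_nomeas => v _ //.
  rewrite /patch; case: ifPn => [_|/negP vM].
    by rewrite lee_fin normrM -[leRHS]mul1r ler_pM// chi_norm_le.
  rewrite phi0 ?mulr0 ?normr0// ltNge; apply/negP => vM'; apply: vM.
  by rewrite inE/= in_itv/= -ler_norml.
rewrite integral_cst//= lebesgue_measure_itv/= lte_fin gtrN// -EFinB -EFinM lee_fin.
by rewrite le_eqVlt; apply/orP; left; apply/eqP; ring.
Qed.

Lemma measurable_velocity_average u :
  measurable_fun [set: R * R] (fun z : R * R => u z.1 z.2) ->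
  measurable_fun [set: R * R] (fun z : R * R => velocity_average phi u z.1 z.2).
Proof.
move=> mu_; have [cphi _ _] := hphi; have mphi := continuous_measurable_fun cphi.
apply: (@measurable_Rintegral_param _ _ _ _ _ mu setT
  (fun p : R * R * R => chi (u p.1.1 p.1.2) p.2 * phi p.2)) => //.
apply: measurable_fctM; last by meas.
apply: measurable_chi; last by meas.
exact: (measurableT_comp mu_ measurable_fst).
Qed.

(** At delta = 0 the kernel is independent of v and leaves the velocity integral: this identifies
    the quantity controlled by the weak formulation with the layer in the representation of
    |D|^s. *)
Lemma kinetic_average_layer (P : R -> R) (nP : R) u t y : periodic_kernel P nP ->
  measurable_fun [set: R] (u t) ->
  kinetic_average phi P 0 (u t) y =
  \int[mu]_(x in `[0, 1[) (P (y - x) * velocity_average phi u t x).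
Proof.
move=> hP mut; have [_ ->] := kinetic_averageE hphi hP 0 y mut.
have [cphi _ _] := hphi; have mphi := continuous_measurable_fun cphi.
apply: eq_Rintegral => x _; rewrite /velocity_average mulrC.
rewrite -(Rintegral_mulr mu _ measurableT); last by meas.
by apply: eq_Rintegral => v _; rewrite mulr0 subr0; ring.
Qed.

End unpacking.

(** * Estimate of one weighted layer *)

Section layer_estimate.
Context {R : realType}.
Local Notation mu := (@lebesgue_measure R).
Variables (T eta iota : R) (Calpha : R -> R) (N : R) (phi : R -> R) (s a b : R) (K : set R).
Hypotheses (T_gt0 : 0 < T) (eta0 : 0 <= eta) (a_gt0 : 0 < a) (ab : a <= b) (bT : b < T).
Hypotheses (cK : compact K) (phiK : forall v, phi v != 0 -> K v) (sphi : smooth phi).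
Variables (M0 B : R) (M0_gt0 : 0 < M0) (B_gt0 : 0 < B).
Hypotheses (hphi : bounded_support M0 B phi) (hdphi : bounded_support M0 B ('D_1 phi))
  (phiE : forall v, is_derive v (1 : R) phi ('D_1 phi v)).
Variables (gamma p theta E om C : R).
Hypotheses (g01 : 0 < gamma < 1) (p0 : 0 <= p) (theta0 : 0 <= theta) (E0 : 0 <= E) (C0 : 0 < C).
Hypotheses (E1 : p * iota * gamma <= E) (E2 : 1 - p <= E) (E3 : 1 - p * (1 + eta) <= E).
Hypotheses (om1 : om <= gamma - s - theta * iota * gamma) (om2 : om <= theta - s)
  (om3 : om <= theta * (1 + eta) - 1 - s).
Hypothesis large_decay : forall sigma,
  expR ((2 - s) * sigma - 2^-1 * expR sigma) <= C * expR (- (om * `|sigma|)).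

Variable kc : R.
Hypotheses (kc_gt0 : 0 < kc)
  (dpoissonK : forall sigma, sigma <= 0 ->
    periodic_kernel (dpoisson (radius sigma)) (kc * expR (- (1%:R * sigma))))
  (d2poissonK : forall sigma, sigma <= 0 ->
    periodic_kernel (d2poisson (radius sigma)) (kc * expR (- (2%:R * sigma))))
  (d3poissonK : forall sigma, sigma <= 0 ->
    periodic_kernel (d3poisson (radius sigma)) (kc * expR (- (3%:R * sigma))))
  (d2poissonK_large : forall sigma, 0 <= sigma ->
    periodic_kernel (d2poisson (radius sigma)) (kc * expR (- (expR sigma / 2)))).

Let A0 := 2 * M0 * B * kc.
Let A1 := (2 + 2 * M0) * B * kc.
Let B1 := B * kc.

(** The first summand serves sigma <= 0, the second sigma >= 0. The constant is fixed before w,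
    while the signs of [Calpha (- gamma)] and N are known only once w is given; the absolute values
    make it nonnegative beforehand. *)
Definition layer_const : R :=
  decay_const gamma iota A0 A1 B1 `|Calpha (- gamma)| `|N| (Num.min a 1) + A0 * (b - a) * C.

Let A0_gt0 : 0 < A0. Proof. by rewrite !mulr_gt0. Qed.
Let A1_gt0 : 0 < A1. Proof. by rewrite !mulr_gt0// addr_gt0// mulr_gt0. Qed.
Let B1_ge0 : 0 <= B1. Proof. by rewrite ltW// mulr_gt0. Qed.

Let decay_ge0 : 0 <= decay_const gamma iota A0 A1 B1 `|Calpha (- gamma)| `|N| (Num.min a 1).
Proof. exact: (decay_const_ge0 gamma iota A0 A1 _ B1_ge0). Qed.

Let tail_ge0 : 0 <= A0 * (b - a) * C.
Proof.
by apply: mulr_ge0 (ltW C0); apply: (mulr_ge0 (ltW A0_gt0)); rewrite subr_ge0.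
Qed.

Lemma layer_const_ge0 : 0 <= layer_const.
Proof. exact: addr_ge0. Qed.

Variables (w u0 : R -> R) (u : R -> R -> R) (m : {charge set (R * R * R)%type -> \bar R}).
Hypotheses (hw : holder_space T eta w) (hN : holder_norm T eta w = N%:E)
  (path : path_irregular T iota Calpha w) (qs : quasi_solution T w u0 u m).
Variable M : R.
Hypotheses (M_ge0 : 0 <= M) (hM : kinetic_mass T m K = M%:E).

Let X := Num.max M 1.
Let X1 : 1 <= X. Proof. by rewrite le_max lexx orbT. Qed.
Let v := velocity_average phi (time_patch T u).

Let inT t : t \in `[a, b] -> t \in `[0, T].
Proof.
rewrite !in_itv/= => /andP[at_ tb].
by rewrite (le_trans (ltW a_gt0) at_) (le_trans tb (ltW bT)).
Qed.

Let patchE t : t \in `[0, T] -> time_patch T u t = u t.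
Proof. by move=> tT; apply/funext => x; rewrite /time_patch tT. Qed.

Let mpatch : measurable_fun [set: R * R] (fun z : R * R => time_patch T u z.1 z.2).
Proof. by apply: measurable_time_patch; case: qs. Qed.

Let mut t : t \in `[0, T] -> measurable_fun [set: R] (u t).
Proof. by move=> tT; rewrite -patchE//; exact: (measurable_fun_pair2 t mpatch). Qed.

Let layerE sigma nP t y : periodic_kernel (d2poisson (radius sigma)) nP -> t \in `[a, b] ->
  poisson_layer v sigma t y = kinetic_average phi (d2poisson (radius sigma)) 0 (u t) y.
Proof.
move=> hP /inT tT; rewrite -(patchE tT).
by rewrite (kinetic_average_layer hphi y hP (measurable_fun_pair2 t mpatch)).
Qed.

Let mlayer sigma :
  measurable_fun [set: R * R] (fun z : R * R => `|poisson_layer v sigma z.1 z.2|%:E).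
Proof.
apply/measurable_EFinP; apply: measurable_fctnorm.
have m1 : measurable_fun [set: R * R] (fun z : R * R => (z, sigma)).
  by apply: measurable_fun_pair; meas.
have mv := measurable_velocity_average hphi mpatch.
exact: (measurableT_comp (measurable_poisson_layer mv) m1).
Qed.

Let weight_out sigma nP : periodic_kernel (d2poisson (radius sigma)) nP ->
  (\int[mu]_(t in `[a, b]) \int[mu]_(y in `[0%R, 1%R[)
     `|expR ((2 - s) * sigma) * poisson_layer v sigma t y|%:E =
   (expR ((2 - s) * sigma))%:E * \int[mu]_(t in `[a, b]) \int[mu]_(y in `[0%R, 1%R[)
     `|kinetic_average phi (d2poisson (radius sigma)) 0 (u t) y|%:E)%E.
Proof.
move=> hP; have w0 := expR_ge0 ((2 - s) * sigma).
have layE t : t \in `[a, b] -> (\int[mu]_(y in `[0%R, 1%R[) `|poisson_layer v sigma t y|%:E =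
    \int[mu]_(y in `[0%R, 1%R[)
      `|kinetic_average phi (d2poisson (radius sigma)) 0 (u t) y|%:E)%E.
  by move=> tab; apply: eq_integral => y _; rewrite (layerE y hP tab).
have -> : (\int[mu]_(t in `[a, b]) \int[mu]_(y in `[0%R, 1%R[)
     `|kinetic_average phi (d2poisson (radius sigma)) 0 (u t) y|%:E =
   \int[mu]_(t in `[a, b]) \int[mu]_(y in `[0%R, 1%R[) `|poisson_layer v sigma t y|%:E)%E.
  by apply: eq_integral => t; rewrite inE/= => tab; rewrite layE.
have mI : measurable_fun (`[a, b] : set (measurableTypeR R))
    (fun t => \int[mu]_(y in `[0%R, 1%R[) `|poisson_layer v sigma t y|%:E)%E.
  apply: measurable_funTS.
  exact: (@measurable_integral_param _ _ _ _ _ mu `[0%R, 1%R[%classic _ (measurable_itv _)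
    (mlayer sigma)).
have mab : measurable (`[a, b] : set (measurableTypeR R)) by exact: measurable_itv.
transitivity (\int[mu]_(t in `[a, b]) ((expR ((2 - s) * sigma))%:E *
    \int[mu]_(y in `[0%R, 1%R[) `|poisson_layer v sigma t y|%:E))%E.
  apply: eq_integral => t _; rewrite -ge0_integralZl_EFin//.
    by apply: eq_integral => y _; rewrite normrM ger0_norm// EFinM.
  by apply: measurable_funTS; exact: (measurable_fun_pair2 t (mlayer sigma)).
apply: ge0_integralZl_EFin w0 => //.
by move=> t _; exact: integral_ge0.
Qed.

(** For sigma > 0 the kernel is doubly exponentially small and its size alone is enough. For sigma
    <= 0 the time estimate is applied with the balanced length e. *)
Lemma weighted_layer_le sigma :
  (\int[mu]_(t in `[a, b]) \int[mu]_(y in `[0%R, 1%R[)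
     `|expR ((2 - s) * sigma) * poisson_layer v sigma t y|%:E
   <= (layer_const * X `^ E * expR (- (om * `|sigma|)))%:E)%E.
Proof.
have w0 := expR_ge0 ((2 - s) * sigma).
have X0 : 0 < X := lt_le_trans ltr01 X1.
(* The bound for large sigma does not involve m; X^E >= 1 puts it in the common form. *)
have XE1 : 1 <= X `^ E by rewrite /powR gt_eqF// -[leLHS]expR0 ler_expR mulr_ge0// ln_ge0.
have Aba : 0 <= A0 * (b - a) by apply: (mulr_ge0 (ltW A0_gt0)); rewrite subr_ge0.
have [s0|/ltW s0] := leP sigma 0; last first.
  have hP := d2poissonK_large s0; rewrite (weight_out hP).
  apply: (@le_trans _ _ ((expR ((2 - s) * sigma))%:E *
    (2 * M0 * B * (kc * expR (- (expR sigma / 2))) * (b - a))%:E)%E).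
    rewrite lee_wpmul2l//.
    apply: (@le_trans _ _ (\int[mu]_(t in `[a, b])
        (2 * M0 * B * (kc * expR (- (expR sigma / 2))))%:E)%E).
      apply: ge0_le_integral_nomeas => t tab; first exact: integral_ge0.
      exact: (integral_kinetic_average_size M0_gt0 B_gt0 hphi hP 0 (mut (inT tab))).
    rewrite integral_cst//= lebesgue_measure_itv/= lte_fin.
    case: ltP => [_|ba]; first by rewrite -EFinB -EFinM.
    by rewrite mule0 lee_fin !mulr_ge0 ?expR_ge0 ?subr_ge0// ltW.
  rewrite -EFinM lee_fin.
  rewrite [leLHS](_ : _ = A0 * (b - a) * (expR ((2 - s) * sigma) * expR (- (2^-1 * expR sigma)))).
    rewrite -expRD; apply: (@le_trans _ _ (A0 * (b - a) * (C * expR (- (om * `|sigma|))))).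
      by apply: (ler_wpM2l Aba); exact: large_decay.
    rewrite mulrA ler_wpM2r ?expR_ge0// -[leLHS]mulr1; apply: ler_pM => //.
    by rewrite /layer_const lerDr.
  by rewrite [2^-1 * _]mulrC /A0; ring.
have hP := d2poissonK s0; rewrite (weight_out hP).
have [N0 wN wH] := holder_norm_bounds T_gt0 hN.
have [cw _] := hw.
(* Extension by 0 keeps the bound N and gives measurability on the whole line; the Hölder bound is
   only used between times of [0, T]. *)
pose wc r := if r \in `[0, T] then w r else 0.
have wcE r : r \in `[0, T] -> wc r = w r by rewrite /wc => ->.
have wW r : `|wc r| <= N by rewrite /wc; case: ifPn => [/wN//|_]; rewrite normr0.
have wcH r t : r \in `[0, T] -> t \in `[0, T] -> `|wc t - wc r| <= N * `|t - r| `^ eta.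
  by move=> rT tT; rewrite !wcE//; exact: wH.
have phi0 z : ~ K z -> phi z = 0.
  by move=> Kz; apply/eqP; apply: contra_notT Kz; exact: phiK.
have clK : closed K by apply: compact_closed => //; exact: Rhausdorff.
have dphi0 := derive_eq0_off_closed clK phi0.
have mK := compact_measurable cK.
(* As X >= 1 and sigma <= 0, e <= min(a, 1): thus [t - e, t] stays in [0, T] for t in [a, b], and 1
   / e >= 1 is an admissible lambda. *)
pose e := Num.min a 1 * X `^ (- p) * expR (theta * sigma).
have rho01 : 0 < Num.min a 1 <= 1 by rewrite lt_min a_gt0 ltr01 ge_min lexx orbT.
have e_le : e <= Num.min a 1.
  have /andP[r0 _] := rho01.
  rewrite /e -mulrA ger_pMr// mulr_ile1 ?powR_ge0 ?expR_ge0//.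
    by rewrite /powR gt_eqF// -[leRHS]expR0 ler_expR mulNr oppr_le0 mulr_ge0// ln_ge0.
  by rewrite -expR0 ler_expR mulr_ge0_le0.
have e01 : 0 < e <= 1.
  have /andP[r0 r1] := rho01.
  by rewrite (le_trans e_le r1) andbT !mulr_gt0 ?powR_gt0 ?expR_gt0.
have ea : e <= a by rewrite (le_trans e_le)// ge_min lexx.
have r01 := radius01 sigma.
have kpos i : 0 < kc * expR (- (i%:R * sigma)) by rewrite mulr_gt0 ?expR_gt0.
have main := kinetic_average_time_estimate M0_gt0 B_gt0 hphi hdphi phiE sphi
  hP (dpoissonK s0) (d3poissonK s0) (kpos 2%N) (kpos 1%N) (kpos 3%N)
  (fun z => is_derive_dpoisson z r01) (fun z => is_derive_d2poisson z r01)
  (fun n x y z => d2poisson_plane_smooth n x y z r01) mK phi0 dphi0 N0 eta0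
  (measurable_path_patch cw) wW wcE wcH path qs mut g01 e01 ea (ltW bT) hM.
apply: (le_trans (lee_wpmul2l _ main)); first by rewrite lee_fin.
rewrite -EFinM lee_fin.
have Ca0 : 0 <= Calpha (- gamma).
  by have /andP[g0 g1] := g01; have [|//] := path (alpha := - gamma); rewrite ltrN2 g1 oppr_lt0.
have MX : 0 <= M <= X by rewrite M_ge0 le_max lexx.
have := @weighted_estimate_le R s gamma eta iota p theta E om A0 A1 B1 `|Calpha (- gamma)| `|N|
  (Num.min a 1) A0_gt0 A1_gt0 B1_ge0 (normr_ge0 _) (normr_ge0 _) rho01 eta0 E1 E2 E3 om1 om2 om3
  M X sigma e MX X1 s0 erefl.
move=> h; rewrite (ler0_norm s0) mulrN opprK.
apply: (@le_trans _ _ (decay_const gamma iota A0 A1 B1 `|Calpha (- gamma)| `|N| (Num.min a 1) *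
  X `^ E * expR (om * sigma))); last first.
  by rewrite !ler_wpM2r ?expR_ge0 ?powR_ge0// /layer_const lerDl.
apply: le_trans h; rewrite !ger0_norm// /A0 /A1 /B1.
by rewrite (mulrA (2 * M0 * B) kc) (mulrA ((2 + 2 * M0) * B) kc) -(mulrA (N * _) B) !(mulrA B kc).
Qed.

End layer_estimate.

(** Let A be a null set off which the inequality holds. The function equal to g off A and to +oo on
    A is measurable, dominates f on all of D, and has integral at most that of g. It is applied to
    Sobolev norms of time slices as functions of t. *)
Lemma ge0_ae_le_integral_nomeas (d : measure_display) (X : measurableType d) (R : realType)
    (m : {measure set X -> \bar R}) (D : set X) (f g : X -> \bar R) : measurable D ->
  (forall x, 0 <= f x)%E -> (forall x, 0 <= g x)%E -> measurable_fun setT g ->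
  {ae m, forall x, D x -> (f x <= g x)%E} ->
  (\int[m]_(x in D) f x <= \int[m]_(x in D) g x)%E.
Proof.
move=> mD f0 g0 mg [A [mA A0 fgA]].
have mcA : measurable (~` A) by exact: measurableC.
pose inf : X -> \bar R := cst +oo%E.
have minf : measurable_fun setT inf by exact: measurable_cst.
have mh1 := proj1 (measurable_restrictT g mcA) (measurable_funTS mg).
have mh2 := proj1 (measurable_restrictT inf mA) (measurable_funTS minf).
have h1_0 x : (0 <= (g \_ (~` A)) x)%E by rewrite /patch; case: ifP.
have h2_0 x : (0 <= (inf \_ A) x)%E by rewrite /patch; case: ifP => // _; exact: leey.
apply: (@le_trans _ _ (\int[m]_(x in D) ((g \_ (~` A)) x + (inf \_ A) x))%E).
  apply: ge0_le_integral_nomeas => // x Dx.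
  have [xA|xA] := pselect (A x).
    have -> : (inf \_ A) x = +oo%E by rewrite /patch mem_set.
    by rewrite addey ?leey// gt_eqF// (lt_le_trans _ (h1_0 x)).
  have -> : (g \_ (~` A)) x = g x by rewrite /patch mem_set.
  rewrite (le_trans _ (leeDl _ (h2_0 x)))//.
  by apply: contrapT => fg; apply: xA; apply: fgA => /= /(_ Dx).
rewrite ge0_integralD//; [|exact: measurable_funTS|exact: measurable_funTS].
rewrite -[X in (_ + X)%E]integral_mkcondr [X in (_ + X)%E](_ : _ = 0%E).
  rewrite adde0; apply: ge0_le_integral_nomeas => // x _.
  by rewrite /patch; case: ifP.
rewrite integral_cst//; last exact: measurableI.
suff -> : m (D `&` A) = 0%E by rewrite mule0.
apply/eqP; rewrite eq_le measure_ge0 andbT -A0.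
by apply: le_measure; rewrite ?inE//; exact: measurableI.
Qed.

Theorem theorem10 (R : realType) (T eta iota : R) (Calpha : R -> R) (N : R)
    (phi : R -> R) (s a b : R) (K : set R)
    (hT : 0 < T)
    (heta : 0 <= eta <= 1)
    (hiota : 2^-1 <= iota <= 1)
    (hphi : Cc_smooth phi)
    (hs : s < (1 + eta - iota) / (1 + eta + iota))
    (ha : 0 < a) (hab : a <= b) (hb : b < T)
    (hK : compact K) (hphiK : forall v, phi v != 0 -> K v) :
  exists C : R,
    forall (w : R -> R) (u0 : R -> R) (u : R -> R -> R)
           (m : {charge set (R * R * R)%type -> \bar R}),
      holder_space T eta w ->
      holder_norm T eta w = N%:E ->
      path_irregular T iota Calpha w ->
      quasi_solution T w u0 u m ->
      L1loc_hsobolev T s (velocity_average phi u) /\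
      (L1_hsobolev_norm `[a, b]%classic s (velocity_average phi u)
       <= C%:E *
          ((Linfty_L1_norm T u + 1)
             `^ ((1 + eta) / (iota + 1 + eta))%R
           * (maxe (kinetic_mass T m K) 1)
             `^ ((iota + eta) / (iota + 1 + eta))%R
           + L1_hsobolev_norm `[0%R, T]%classic (-1)%R (velocity_average phi u)))%E.
Proof.
pose mu := @lebesgue_measure R.
have [M0 [B [M0_gt0 B_gt0 phiB dphiB phiE]]] := Cc_smooth_bounds hphi.
have /andP[eta0 eta1] := heta; have /andP[iota0 iota1] := hiota.
have iota_gt0 : 0 < iota by rewrite (lt_le_trans _ iota0).
set d := 1 + eta + iota in hs; have d0 : 0 < d by rewrite /d; lra.
have dE : iota + 1 + eta = d by rewrite /d; ring.
rewrite dE; set E := (iota + eta) / d.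
pose p := d^-1; have p0 : 0 < p by rewrite invr_gt0.
have pd : p * d = 1 by rewrite mulVf// gt_eqF.
have dp1 : p * (1 + eta) = 1 - p * iota by move: pd; rewrite /d; lra.
(* theta is the power of delta in e, and [sm] is s_*, which equals 1 - 2 p iota. *)
pose theta := 2 * p; pose sm := (1 + eta - iota) / d.
have smE : sm = 1 - 2 * (p * iota) by rewrite /sm -/p; move: pd; rewrite /d; lra.
have EE : E = 1 - p by rewrite /E -/p; move: pd; rewrite /d; lra.
have pi0 : 0 < p * iota by rewrite mulr_gt0.
have pe0 : 0 <= p * eta by rewrite mulr_ge0// ltW.
have sm0 : 0 <= sm by rewrite divr_ge0 ?(ltW d0)//; lra.
have theta0 : 0 <= theta by rewrite mulr_ge0 ?(ltW p0).
have E0 : 0 <= E by rewrite divr_ge0 ?(ltW d0)//; lra.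
have [gamma g01 sg] := interpolation_exponent sm0 hs.
have /andP[g0 g1] := g01.
have om1 : gamma * sm = gamma - theta * iota * gamma by rewrite smE /theta; ring.
(* eta <= 1 makes the second rate 2 p - s at least s_* - s. *)
have pe1 : p * eta <= p by rewrite ler_piMr// ltW.
have om2 : sm <= theta by move: dp1; rewrite smE /theta; lra.
have om3 : theta * (1 + eta) - 1 = sm by rewrite smE /theta -mulrA dp1; ring.
(* The rate om is the smaller of gamma s_* - s and s_* - s, cut off at 1 for the sake of
   [exp_decay]. *)
pose om := Num.min (Num.min (gamma * sm - s) (sm - s)) 1.
have om_gt0 : 0 < om by rewrite !lt_min !subr_gt0 sg hs ltr01.
have [oma omb omc] : [/\ om <= gamma * sm - s, om <= sm - s & om <= 1].
  by rewrite /om !ge_min !lexx ?orbT.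
have s1 : s < 1 by rewrite (lt_trans hs)// -/sm smE; lra.
have be0 : 0 < 2 - s by lra.
have half0 : 0 < 2^-1 :> R by rewrite invr_gt0.
have [C1 C10 hC1] := exp_decay be0 half0.
have large sigma : expR ((2 - s) * sigma - 2^-1 * expR sigma) <= C1 * expR (- (om * `|sigma|)).
  by apply: hC1 => //; lra.
pose L a' b' := layer_const iota Calpha N a' b' M0 B gamma C1 (@kernel_const R).
have Lge0 a' b' : a' <= b' -> 0 <= L a' b'.
  by move=> ab'; exact: (layer_const_ge0 iota Calpha N ab' M0_gt0 B_gt0 gamma C10 kernel_const_gt0).
have h1 : p * iota * gamma <= E by rewrite EE; nra.
have h2 : 1 - p <= E by rewrite EE.
have h3 : 1 - p * (1 + eta) <= E by rewrite EE dp1; nra.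
have k1 : om <= gamma - s - theta * iota * gamma by lra.
have k2 : om <= theta - s by lra.
have k3 : om <= theta * (1 + eta) - 1 - s by lra.
(* The normalisation of the representation of |D|^s, the layer bound, and 2 / om from the integral
   of exp(- om |sigma|). *)
exists (`|riesz_kernel_const s| * L a b * (2 / om)) => w u0 u m hw hN path qs.
have mK := compact_measurable hK.
have [M M_ge0 hM] := kinetic_mass_fin T m mK.
set X := Num.max M 1; have X1 : 1 <= X by rewrite le_max lexx orbT.
have XE1 : 0 <= X `^ E by exact: powR_ge0.
pose v := velocity_average phi (time_patch T u).
have mpatch : measurable_fun [set: R * R] (fun z : R * R => time_patch T u z.1 z.2).
  by apply: measurable_time_patch; case: qs.
have mv := measurable_velocity_average phiB mpatch.
have vC t x : `|v t x| <= 2 * M0 * B by exact: velocity_average_le.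
have vE t : t \in `[0, T] -> v t = velocity_average phi u t.
  by move=> tT; apply/funext => x; rewrite /v /velocity_average /time_patch tT.
(* Membership in the local space requires all compact subintervals of (0, T); the norm estimate uses
   [a, b]. *)
have core a' b' : 0 < a' -> a' <= b' -> b' < T -> exists g : R -> R -> R,
    [/\ measurable_fun [set: R * R] (fun z : R * R => g z.1 z.2),
      (mu \x mu)%E.-integrable (`[a', b'] `*` `[0, 1[) (fun z : R * R => (g z.1 z.2)%:E),
      (\int[mu]_(t in `[a', b']) \int[mu]_(y in `[0%R, 1%R[) `|g t y|%:E
        <= (`|riesz_kernel_const s| * (L a' b' * X `^ E) * (2 / om))%:E)%E &
      {ae mu, forall t, t \in `[a', b'] -> riesz_derivative s (velocity_average phi u t) (g t)}].
  move=> a0 ab bT.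
  have L0 : 0 <= L a' b' * X `^ E.
    by rewrite mulr_ge0// Lge0.
  have s2 : s < 2 by rewrite -subr_gt0.
  have [g [mg ig gL gae]] := riesz_of_layers mv vC s2 L0 om_gt0
    (weighted_layer_le hT eta0 a0 ab bT hK hphiK hphi.1 M0_gt0 B_gt0 phiB dphiB phiE g01
      (ltW p0) theta0 E0 C10 h1 h2 h3 k1 k2 k3 large kernel_const_gt0 dpoisson_kernel
      d2poisson_kernel d3poisson_kernel d2poisson_kernel_large hw hN path qs M_ge0 hM).
  exists g; split; [exact: mg|exact: ig|exact: gL|move: gae].
  apply: (filterS (F := nbhs (almost_everywhere (mu : set (measurableTypeR R) -> \bar R)))).
  move=> t + tab => /(_ tab); have tT : t \in `[0, T].
    move: tab; rewrite !in_itv/= => /andP[at_ tb].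
    by rewrite (le_trans (ltW a0) at_) (le_trans tb (ltW bT)).
  by rewrite -/v (vE t tT).
split.
  by move=> a' b' a0 ab bT; have [g [_ ig _ gae]] := core _ _ a0 ab bT; exists g.
have [g [mg ig gL gae]] := core _ _ ha hab hb.
have Lab0 : 0 <= L a b * X `^ E by rewrite mulr_ge0// Lge0.
have om0' : 0 <= 2 / om by rewrite divr_ge0// ltW.
have mab : measurable (`[a, b]%classic : set (measurableTypeR R)) by exact: measurable_itv.
(* The Sobolev norm of a slice is an infimum, for which g t competes at almost every t. *)
have norm_le : (L1_hsobolev_norm `[a, b]%classic s (velocity_average phi u) <=
    \int[mu]_(t in `[a, b]) \int[mu]_(y in `[0%R, 1%R[) `|g t y|%:E)%E.
  apply: ge0_ae_le_integral_nomeas mab _ _ _ _.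
  - by move=> t; exact: hsobolev_norm_ge0.
  - by move=> t; exact: integral_ge0.
  - apply: (@measurable_integral_param _ _ _ _ _ mu `[0%R, 1%R[%classic
      (fun z : R * R => `|g z.1 z.2|%:E)) => //.
    by apply/measurable_EFinP; exact: measurable_fctnorm.
  - move: gae.
    apply: (filterS (F := nbhs (almost_everywhere (mu : set (measurableTypeR R) -> \bar R)))).
    by move=> t /= h tab; apply: ereal_inf_lbound; exists (g t) => //; exact: h.
apply: (le_trans norm_le); apply: (le_trans gL).
rewrite hM.
have -> : maxe M%:E 1%E = X%:E by rewrite /X EFin_max.
(* The factor containing u is at least 1 and the norm of order -1 is nonnegative, so inserting them
   only enlarges the right side. *)
have U1 : (1 <= (Linfty_L1_norm T u + 1) `^ ((1 + eta) / d)%R)%E.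
  have q0 : 0 <= (1 + eta) / d by rewrite divr_ge0 ?(ltW d0)//; lra.
  have U0 := Linfty_L1_norm_ge0 T u.
  rewrite -[leLHS](poweR1r ((1 + eta) / d)).
  apply: (gt0_ler_poweR q0); rewrite ?in_itv/= ?lee_fin ?leey ?andbT ?adde_ge0//.
  by rewrite leeDr.
have W0 := L1_hsobolev_norm_ge0 `[0%R, T]%classic (-1) (velocity_average phi u).
have -> : `|riesz_kernel_const s| * (L a b * X `^ E) * (2 / om) =
    `|riesz_kernel_const s| * L a b * (2 / om) * X `^ E by ring.
rewrite poweR_EFin [leLHS]EFinM.
apply: lee_wpmul2l.
  exact: (mulr_ge0 (mulr_ge0 (normr_ge0 _) (Lge0 _ _ hab)) om0').
apply: le_trans (leeDl _ W0).
by rewrite -[leLHS]mul1e; apply: lee_wpmul2r => //; rewrite lee_fin.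
Qed.
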